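(* Let $(A,\rho_A,[\cdot,\cdot]_A)$ be a Lie algebroid over a manifold $M$, $E$ a vector bundle over $M$, $\nabla:\Gamma(A)\to\mathscr{CDO}(E)$ a flat $\mathbb{R}$-linear connection of $A$ on $E$, and $p\ge1$ an integer. For a metric $h$ on $E$ the form $\mathrm{cs}_p(\nabla,\nabla^h)$ is $d_{A,\mathbb{R}}$-closed, and its cohomology class $[\mathrm{cs}_p(\nabla,\nabla^h)]\in H^{2p-1}_{\rho_A,\mathbb{R}}(A)$ does not depend on the choice of the metric $h$.
   Context: All manifolds, bundles and sections are smooth; vector bundles are real. A Lie algebroid $(A,\rho_A,[\cdot,\cdot]_A)$ over $M$ is a vector bundle $A\to M$ with a vector bundle homomorphism $\rho_A:A\to TM$ (the anchor) and a real Lie algebra structure $[\cdot,\cdot]_A$ on $\Gamma(A)$ satisfying $[a,fb]_A=f[a,b]_A+\rho_A(a)(f)\,b$ for $a,b\in\Gamma(A)$, $f\in C^\infty(M)$. The anchor induces a Lie algebra homomorphism $\Gamma(A)\to\mathfrak{X}(M)$, $a\mapsto\rho_A\circ a$. $\mathscr{CDO}(E)$ is the space of covariant differential operators of $E$: $\mathbb{R}$-linear $\ell:\Gamma(E)\to\Gamma(E)$ for which there is exactly one vector field $\tilde\ell\in\mathfrak{X}(M)$ with $\ell(f\zeta)=f\ell(\zeta)+\tilde\ell(f)\zeta$ for all $f\in C^\infty(M)$, $\zeta\in\Gamma(E)$. An $\mathbb{R}$-linear connection of $A$ on $E$ is an $\mathbb{R}$-linear (not necessarily $C^\infty(M)$-linear,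 nor local) map $\nabla:\Gamma(A)\to\mathscr{CDO}(E)$, $a\mapsto\nabla_a$, with $\widetilde{\nabla_a}=\rho_A\circ a$. Its curvature is $R^\nabla_{a,b}=\nabla_a\nabla_b-\nabla_b\nabla_a-\nabla_{[a,b]_A}\in\Gamma(\mathrm{End}\,E)$; $\nabla$ is flat if $R^\nabla=0$. A metric $h$ on $E$ is a smooth positive definite symmetric fibre metric. Given $\nabla$ and $h$, $\nabla^h$ is the $\mathbb{R}$-linear connection of $A$ on $E$ defined by $(\rho_A\circ a)(h(s,t))=h(\nabla_as,t)+h(s,\nabla^h_at)$ for $a\in\Gamma(A)$, $s,t\in\Gamma(E)$. $\mathcal{A}lt^n_{\mathbb{R}}(\Gamma(A);C^\infty(M))$ is the space of $\mathbb{R}$-multilinear antisymmetric maps $\Gamma(A)^n\to C^\infty(M)$ (for $n=0$: $C^\infty(M)$). The operator $d_{A,\mathbb{R}}$ on these is $$(d_{A,\mathbb{R}}\eta)(a_1,\dots,a_{n+1})=\sum_i(-1)^{i+1}(\rho_A\circ a_i)\bigl(\eta(a_1,\dots\hat{\imath}\dots,a_{n+1})\bigr)+\sum_{i<j}(-1)^{i+j}\eta([a_i,a_j]_A,a_1,\dots\hat{\imath}\dots\hat{\jmath}\dots,a_{n+1}),$$ and $H^\bullet_{\rho_A,\mathbb{R}}(A)$ is the cohomology of the complex $(\mathcal{A}lt^\bullet_{\mathbb{R}}(\Gamma(A);C^\infty(M)),d_{A,\mathbb{R}})$. For $p\ge1$, and an $\mathbb{R}$-linear connection $\nabla$ of a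 Lie algebroid on a vector bundle, $\mathrm{ch}_p(\nabla)=\mathrm{Tr}_*(R^\nabla)^p$, where $$(R^\nabla)^p(a_1,\dots,a_{2p})=\frac1{2^p}\sum_{\tau\in S_{2p}}\mathrm{sgn}\,\tau\; R^\nabla_{a_{\tau(1)},a_{\tau(2)}}\circ\cdots\circ R^\nabla_{a_{\tau(2p-1)},a_{\tau(2p)}}$$ and $\mathrm{Tr}_*$ takes the fibrewise trace of the values. For $\mathbb{R}$-linear connections $\nabla^0,\nabla^1$ of $A$ on $E$, let $\mathrm{pr}_2:\mathbb{R}\times M\to M$ be the projection and $T\mathbb{R}\times A$ the product Lie algebroid over $\mathbb{R}\times M$; write $a$ for the section $0\times a$ and $\partial/\partial t$ for $\frac{\partial}{\partial t}\times0$. The affine combination $\nabla^{\mathrm{aff}_1}$ is the $\mathbb{R}$-linear connection of $T\mathbb{R}\times A$ on $\mathrm{pr}_2^*E$ with $\nabla^{\mathrm{aff}_1}_{\partial/\partial t}(\nu\circ\mathrm{pr}_2)=0$ and $\nabla^{\mathrm{aff}_1}_a(\nu\circ\mathrm{pr}_2)(t,\cdot)=(1-t)\nabla^0_a\nu+t\nabla^1_a\nu$ for $\nu\in\Gamma(E)$, $a\in\Gamma(A)$ (extended to all sections of $\mathrm{pr}_2^*E$ by the Leibniz rule; only these operators, and the brackets $[\partial/\partial t,a]=0$, $[a,b]=[a,b]_A$, are needed below). The Chern–Simons form $\mathrm{cs}_p(\nabla^0,\nabla^1)\in\mathcal{A}lt^{2p-1}_{\mathbb{R}}(\Gamma(A);C^\infty(M))$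 is $$\mathrm{cs}_p(\nabla^0,\nabla^1)(a_1,\dots,a_{2p-1})=\int_0^1\mathrm{ch}_p(\nabla^{\mathrm{aff}_1})\Bigl(\frac{\partial}{\partial t},a_1,\dots,a_{2p-1}\Bigr)\Big|_{(t,\cdot)}dt.$$ *)

(* Defs.v *)
(* World: MathComp-Analysis, over an arbitrary realType. *)
From HB Require Import structures.
From mathcomp Require Import all_boot all_order all_algebra all_fingroup.
From mathcomp Require Import all_classical all_reals all_analysis.

Set Implicit Arguments.
Unset Strict Implicit.
Unset Printing Implicit Defensive.

Import Order.TTheory GRing.Theory Num.Theory.
Import numFieldNormedType.Exports.

Local Open Scope classical_set_scope.
Local Open Scope ring_scope.

Section EuclideanSmooth.
Context {R : realType} {n : nat}.
Implicit Types (D : set 'rV[R]_n) (f g : 'rV[R]_n -> R).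

(* On an open set of R^n, existence and continuity of all iterated directional
   derivatives of order at most k is the usual notion of class C^k. *)
Fixpoint Ck (k : nat) D f : Prop :=
  (forall y, D y -> {for y, continuous f}) /\
  (if k is k'.+1 then
     (forall y v, D y -> derivable f y v) /\ forall v, Ck k' D ('D_v f)
   else True).

Definition smooth_on D f := forall k, Ck k D f.

Lemma Ck_cont k D f y : Ck k D f -> D y -> {for y, continuous f}.
Proof. by case: k => [|k] [+ _]; apply. Qed.

Lemma Ck_le k D f : Ck k.+1 D f -> Ck k D f.
Proof.
elim: k f => [|k IH] f; first by case.
by move=> [cf [df Df]]; split=> //; split=> // v; apply/IH/Df.
Qed.

Lemma open_near_eq D f g y : open D -> D y -> (forall z, D z -> f z = g z) ->
  \forall z \near y, f z = g z.
Proof.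
by move=> oD Dy fg; near=> z; apply: fg; near: z; exact: open_nbhs_nbhs.
Unshelve. all: by end_near. Qed.

Lemma Ck_ext k D f g : open D -> (forall y, D y -> f y = g y) ->
  Ck k D f -> Ck k D g.
Proof.
move=> oD; elim: k f g => [|k IH] f g fg; rewrite /= => -[cf rest].
  split=> // y Dy; rewrite /prop_for /continuous_at -(fg y Dy).
  apply: cvg_trans (cf y Dy); apply: (@near_eq_cvg _ _ (nbhs y)).
  exact: (open_near_eq oD Dy fg).
split.
  move=> y Dy; rewrite /prop_for /continuous_at -(fg y Dy).
  apply: cvg_trans (cf y Dy); apply: (@near_eq_cvg _ _ (nbhs y)).
  exact: (open_near_eq oD Dy fg).
case: rest => df Df; split=> [y v Dy|v].
  by apply: near_eq_derivable (df y v Dy); exact: (open_near_eq oD Dy fg).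
apply: (IH _ _ _ (Df v)) => y Dy.
by apply: near_eq_derive; exact: (open_near_eq oD Dy fg).
Qed.

Lemma Ck_cst k D c : Ck k D (cst c).
Proof.
elim: k c => [|k IH] c; first by split=> // y _; exact: cst_continuous.
split; first by move=> y _; exact: cst_continuous.
split=> [y v _|v]; first exact: derivable_cst.
suff -> : 'D_v (cst c : 'rV[R]_n -> R) = cst 0 by [].
by apply/funext => y; rewrite derive_cst.
Qed.

Lemma Ck_add k D f g : open D -> Ck k D f -> Ck k D g ->
  Ck k D (fun y => f y + g y).
Proof.
move=> oD; elim: k f g => [|k IH] f g.
  by move=> [cf _] [cg _]; split=> // y Dy; exact: cvgD (cf y Dy) (cg y Dy).
move=> [cf [df Df]] [cg [dg Dg]].
split; first by move=> y Dy; exact: cvgD (cf y Dy) (cg y Dy).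
split=> [y v Dy|v].
  by have := derivableD (df y v Dy) (dg y v Dy).
apply: Ck_ext (IH _ _ (Df v) (Dg v)) => // y Dy.
by rewrite -(deriveD (df y v Dy) (dg y v Dy)).
Qed.

Lemma Ck_mul k D f g : open D -> Ck k D f -> Ck k D g ->
  Ck k D (fun y => f y * g y).
Proof.
move=> oD; elim: k f g => [|k IH] f g.
  by move=> [cf _] [cg _]; split=> // y Dy; exact: cvgM (cf y Dy) (cg y Dy).
move=> ff gg; have [cf [df Df]] := ff; have [cg [dg Dg]] := gg.
split; first by move=> y Dy; exact: cvgM (cf y Dy) (cg y Dy).
split=> [y v Dy|v].
  by have := derivableM (df y v Dy) (dg y v Dy).
apply: (@Ck_ext _ _ (fun y => f y * 'D_v g y + g y * 'D_v f y)) => //.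
  by move=> y Dy; have := deriveM (df y v Dy) (dg y v Dy).
apply: Ck_add => //; apply: IH; by [exact: (Ck_le ff) | exact: (Ck_le gg) | exact: Df | exact: Dg].
Qed.

End EuclideanSmooth.

Record chart (R : realType) (n : nat) (M : topologicalType) := Chart {
  cdom : set M;
  cmap :> M -> 'rV[R]_n;
  cinv : 'rV[R]_n -> M;
  cdom_open : open cdom;
  cimg_open : open (cmap @` cdom);
  cmapK : forall x, cdom x -> cinv (cmap x) = x;
  cmap_cont : {within cdom, continuous cmap};
  cinv_cont : {within cmap @` cdom, continuous cinv} }.

Record manifold (R : realType) (n : nat) := Manifold {
  mspace :> topologicalType;
  mspace_hausdorff : hausdorff_space mspace;
  mspace_second_countable : @second_countable mspace;
  atlas : set (chart R n mspace);
  atlas_cover : forall x : mspace, exists2 c, atlas c & cdom c x;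
  atlas_compat : forall (c d : chart R n mspace) (i : 'I_n), atlas c -> atlas d ->
    smooth_on (c @` (cdom c `&` cdom d)) (fun y => d (cinv c y) 0 i) }.

Section Manifold.
Context {R : realType} {n : nat} (M : manifold R n).

Definition smooth_in (U : set M) (f : M -> R) :=
  forall c, atlas c -> smooth_on (c @` (U `&` cdom c)) (fun y => f (cinv c y)).

Lemma cimg_setI_open (U : set M) (c : chart R n M) :
  open U -> open (c @` (U `&` cdom c)).
Proof.
move=> oU.
have -> : c @` (U `&` cdom c) = (c @` cdom c) `&` cinv c @^-1` U.
  apply/seteqP; split=> [y [x [Ux cx] <-]|y [[x cx <-]]].
    by split; [exists x | rewrite /preimage/= cmapK].
  by rewrite /preimage/= cmapK // => Ux; exists x.
rewrite openE => y [cy Uy]; rewrite /interior.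
have := @cinv_cont _ _ _ c; rewrite continuous_open_subspace; last exact: cimg_open.
move=> /(_ y (mem_set cy)) h.
apply: filterI; first by apply: open_nbhs_nbhs; split=> //; exact: cimg_open.
by apply: h; apply: open_nbhs_nbhs.
Qed.

Lemma smooth_in_cst U c : smooth_in U (cst c).
Proof. by move=> d _ k; exact: Ck_cst. Qed.

Lemma smooth_in_ext U f g : open U -> (forall x, U x -> f x = g x) ->
  smooth_in U f -> smooth_in U g.
Proof.
move=> oU fg sf c ac k; apply: Ck_ext (sf c ac k); first exact: cimg_setI_open.
by move=> _ [x [Ux cx] <-]; rewrite cmapK //; exact: fg.
Qed.

Lemma smooth_in_add U f g : open U -> smooth_in U f -> smooth_in U g ->
  smooth_in U (fun x => f x + g x).
Proof.
by move=> oU sf sg c ac k; apply: Ck_add (sf c ac k) (sg c ac k); exact: cimg_setI_open.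
Qed.

Lemma smooth_in_mul U f g : open U -> smooth_in U f -> smooth_in U g ->
  smooth_in U (fun x => f x * g x).
Proof.
by move=> oU sf sg c ac k; apply: Ck_mul (sf c ac k) (sg c ac k); exact: cimg_setI_open.
Qed.

Lemma smooth_in_sub U V f : open U -> open V -> V `<=` U ->
  smooth_in U f -> smooth_in V f.
Proof.
move=> oU oV VU sf c ac k; have := sf c ac k.
have VUc : c @` (V `&` cdom c) `<=` c @` (U `&` cdom c).
  by apply: image_subset => x [/VU Ux ?].
move: (fun y => _) => g; elim: k g => [|k IH] g.
  by move=> [cg _]; split=> // y /VUc; exact: cg.
move=> [cg [dg Dg]]; split; first by move=> y /VUc; exact: cg.
by split=> [y v /VUc /dg|v]; [exact | exact: IH (Dg v)].
Qed.

Record smooth_fun := SmoothFun {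
  sfun :> M -> R;
  sfun_smooth : smooth_in setT sfun }.

(* T_x M is identified with R^n through a chart around x chosen once and for all
   for each x; in any other chart the components of a tangent vector at x are
   obtained through the differential of the change of charts. *)
Definition chart_at (x : M) : chart R n M :=
  projT1 (cid2 (@atlas_cover _ _ M x)).

Definition tangent (x : M) := 'rV[R]_n.

Definition tangent_app (x : M) (v : tangent x) (f : M -> R) : R :=
  'D_v (fun y => f (cinv (chart_at x) y)) (chart_at x x).

Definition tangent_coord (c : chart R n M) (x : M) (v : tangent x) (i : 'I_n) : R :=
  tangent_app v (fun z => c z 0 i).

Definition smooth_vfield (X : forall x, tangent x) :=
  forall c i, atlas c -> smooth_in (cdom c) (fun x => tangent_coord c (X x) i).

End Manifold.

(* A local trivialization over an open set, given by the fibrewise isomorphisms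
   with R^r and their inverses. *)
Record local_triv (R : realType) (M : topologicalType) (r : nat)
    (F : M -> vectType R) := LocalTriv {
  tdom : set M;
  tmap : forall x, 'Hom(F x, 'rV[R]_r);
  tinv : forall x, 'Hom('rV[R]_r, F x);
  tdom_open : open tdom;
  tmapK : forall x, tdom x -> cancel (tmap x) (tinv x);
  tinvK : forall x, tdom x -> cancel (tinv x) (tmap x) }.

(* A bundle of rank r is a family of vector spaces with a cover by local
   trivializations whose transition functions are smooth; these determine the
   topology and the smooth structure of the total space. *)
Record vbundle (R : realType) (n : nat) (M : manifold R n) (r : nat) := VBundle {
  fibre :> M -> vectType R;
  trivs : set (local_triv r fibre);
  trivs_cover : forall x, exists2 T, trivs T & tdom T x;
  trivs_compat : forall S T (v : 'rV[R]_r) (i : 'I_r), trivs S -> trivs T ->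
    smooth_in (tdom S `&` tdom T) (fun x => tmap T x (tinv S x v) 0 i) }.

Section Sections.
Context {R : realType} {n : nat} {M : manifold R n} {r : nat} (E : vbundle M r).

Definition smooth_section (s : forall x, E x) :=
  forall T i, trivs T -> smooth_in (tdom T) (fun x => tmap T x (s x) 0 i).

Record section := Section {
  sval :> forall x, E x;
  section_smooth : smooth_section sval }.

Lemma section_ext (s t : section) : (forall x, s x = t x) -> s = t.
Proof.
case: s t => [s sP] [t tP] /= st.
have {}st : s = t by exact: functional_extensionality_dep.
by subst t; congr Section; exact: Prop_irrelevance.
Qed.

Lemma smooth_section0 : smooth_section (fun x => 0).
Proof.
move=> T i _; apply: smooth_in_ext (smooth_in_cst (tdom T) 0).
  exact: tdom_open.
by move=> x _; rewrite linear0 mxE.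
Qed.

Lemma smooth_sectionD (s t : section) : smooth_section (fun x => s x + t x).
Proof.
move=> T i tT; have oT := tdom_open T.
apply: smooth_in_ext (smooth_in_add oT (section_smooth s i tT) (section_smooth t i tT)) => //.
by move=> x _; rewrite linearD mxE.
Qed.

Lemma smooth_section_mul (f : M -> R) (s : section) :
  smooth_in setT f -> smooth_section (fun x => f x *: s x).
Proof.
move=> sf T i tT; have oT := tdom_open T.
have sfT : smooth_in (tdom T) f by apply: smooth_in_sub sf => //; exact: openT.
apply: smooth_in_ext (smooth_in_mul oT sfT (section_smooth s i tT)) => //.
by move=> x _; rewrite linearZ mxE.
Qed.

Definition section0 := Section smooth_section0.
Definition sectionD (s t : section) := Section (smooth_sectionD s t).
Definition sectionM (f : smooth_fun M) (s : section) :=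
  Section (smooth_section_mul s (sfun_smooth f)).
Definition sectionZ (c : R) (s : section) :=
  Section (smooth_section_mul s (smooth_in_cst setT c)).

HB.instance Definition _ := gen_eqMixin section.
HB.instance Definition _ := gen_choiceMixin section.

Fact section_addA : associative sectionD.
Proof. by move=> s t u; apply: section_ext => x; exact: addrA. Qed.
Fact section_addC : commutative sectionD.
Proof. by move=> s t; apply: section_ext => x; exact: addrC. Qed.
Fact section_add0 : left_id section0 sectionD.
Proof. by move=> s; apply: section_ext => x; exact: add0r. Qed.
Fact section_addN : left_inverse section0 (sectionZ (-1)) sectionD.
Proof. by move=> s; apply: section_ext => x /=; rewrite /cst scaleN1r addNr. Qed.

HB.instance Definition _ := GRing.isZmodule.Build section
  section_addA section_addC section_add0 section_addN.

Fact section_scaleA a b s : sectionZ a (sectionZ b s) = sectionZ (a * b) s.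
Proof. by apply: section_ext => x; exact: scalerA. Qed.
Fact section_scale1 : left_id 1 sectionZ.
Proof. by move=> s; apply: section_ext => x; exact: scale1r. Qed.
Fact section_scaleDr : right_distributive sectionZ +%R.
Proof. by move=> a s t; apply: section_ext => x; exact: scalerDr. Qed.
Fact section_scaleDl s : {morph sectionZ^~ s : a b / a + b}.
Proof. by move=> a b; apply: section_ext => x; exact: scalerDl. Qed.

HB.instance Definition _ := GRing.Zmodule_isLmodule.Build R section
  section_scaleA section_scale1 section_scaleDr section_scaleDl.

(* A pointwise defined family of vectors as a section, with value 0 if the
   family is not smooth. *)
Definition section_of (s : forall x, E x) : section :=
  if pselect (smooth_section s) is left sP then Section sP else 0.

End Sections.

Record lie_algebroid (R : realType) (n : nat) (M : manifold R n) (r : nat) :=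
  LieAlgebroid {
  la_bundle :> vbundle M r;
  anchor : forall x, la_bundle x -> tangent x;
  anchor_linear : forall x, linear (anchor (x := x));
  anchor_smooth : forall T c (v : 'rV[R]_r) i, trivs T -> atlas c ->
    smooth_in (tdom T `&` cdom c) (fun x => tangent_coord c (anchor (tinv T x v)) i);
  bracket : section la_bundle -> section la_bundle -> section la_bundle;
  bracket_linearl : forall b, linear (bracket^~ b);
  bracket_linearr : forall a, linear (bracket a);
  bracket_alt : forall a, bracket a a = 0;
  bracket_jacobi : forall a b c,
    bracket a (bracket b c) + bracket b (bracket c a) + bracket c (bracket a b) = 0;
  bracket_leibniz : forall a b (f : smooth_fun M) x,
    bracket a (sectionM f b) x =
      f x *: bracket a b x + tangent_app (anchor (a x)) f *: b x }.

Section Connections.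
Context {R : realType} {n : nat} {M : manifold R n} {rA rE : nat}.
Variables (A : lie_algebroid M rA) (E : vbundle M rE).

Definition anchor_sec (a : section A) : forall x : M, tangent x :=
  fun x => anchor (a x).

Definition vfield_app (X : forall x : M, tangent x) (f : M -> R) : M -> R :=
  fun x => tangent_app (X x) f.

Definition is_symbol (l : section E -> section E) (X : forall x : M, tangent x) :=
  smooth_vfield X /\
  forall (f : smooth_fun M) (s : section E) x,
    l (sectionM f s) x = f x *: l s x + vfield_app X f x *: s x.

Definition is_cdo (l : section E -> section E) :=
  linear l /\ exists! X, is_symbol l X.

Record connection := Connection {
  nabla :> section A -> section E -> section E;
  nabla_linear : forall s, linear (nabla^~ s);
  nabla_cdo : forall a, is_cdo (nabla a);
  nabla_symbol : forall a, is_symbol (nabla a) (anchor_sec a) }.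

Record metric := Metric {
  hmet :> forall x, E x -> E x -> R;
  hmet_linearl : forall x (w : E x), scalar (fun v => hmet v w);
  hmet_sym : forall x (v w : E x), hmet v w = hmet w v;
  hmet_pos : forall x (v : E x), v != 0 -> 0 < hmet v v;
  hmet_smooth : forall T (v w : 'rV[R]_rE), trivs T ->
    smooth_in (tdom T) (fun x => hmet (tinv T x v) (tinv T x w)) }.

Definition hmet_sec (h : metric) (s t : section E) : M -> R :=
  fun x => h x (s x) (t x).

(* The connection adjoint to D with respect to h: the section D^h_a t is the
   (unique) solution u of the defining equation. *)
Definition adjoint_conn (D : section A -> section E -> section E) (h : metric)
    (a : section A) (t : section E) : section E :=
  xget 0 [set u | forall s x,
    vfield_app (anchor_sec a) (hmet_sec h s t) x =
      hmet_sec h (D a s) t x + hmet_sec h s u x].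

End Connections.

Section Chern.
Context {R : realType}.

(* L is a Lie algebra of sections with bracket br, acting on the module S of
   sections of a bundle by D. *)
Definition curvature (L : Type) (S : zmodType) (br : L -> L -> L)
    (D : L -> S -> S) (a b : L) (s : S) : S :=
  D a (D b s) - D b (D a s) - D (br a b) s.

Definition lftrace (V : vectType R) (phi : 'End(V)) : R :=
  \tr (passmx.mxof (vbasis {:V}) (vbasis {:V}) phi).

(* The endomorphism of a fibre V induced by an operator on sections: it sends the
   value ev s at the base point of a section s to the value ev' s of the image. *)
Definition fibre_end (V : vectType R) (T : Type) (ev ev' : T -> V) : 'End(V) :=
  xget 0 [set phi : 'End(V) | forall s, phi (ev s) = ev' s].

Definition ord_double p (k : 'I_p) : 'I_p.*2 :=
  Ordinal (eq_ind_r is_true (ltn_ord k) (ltn_double k p)).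

Lemma ord_doubleS_subproof p (k : 'I_p) : (k.*2.+1 < p.*2)%N.
Proof. by rewrite -doubleS leq_double. Qed.

Definition ord_doubleS p (k : 'I_p) : 'I_p.*2 := Ordinal (ord_doubleS_subproof k).

Definition curvature_power (V : vectType R) (L : Type) (K : L -> L -> 'End(V))
    (p : nat) (a : 'I_p.*2 -> L) : 'End(V) :=
  (2 ^+ p)^-1 *: \sum_(tau : 'S_p.*2)
    (-1) ^+ tau *: \big[(@comp_lfun _ V V V) / \1%VF]_(k < p)
      K (a (tau (ord_double k))) (a (tau (ord_doubleS k))).

(* The value of Tr_*(R^D)^p in the fibre V = F_b at a point b of the base, where
   ev : S -> V is the evaluation at b.  The sections iota s, s : T, are to span
   every fibre, so that the curvature endomorphisms of V are determined by their
   values on them. *)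
Definition chern (L T : Type) (S : zmodType) (V : vectType R)
    (br : L -> L -> L) (D : L -> S -> S) (iota : T -> S) (ev : S -> V)
    (p : nat) (a : 'I_p.*2 -> L) : R :=
  lftrace (curvature_power
    (fun u v => fibre_end (fun s => ev (iota s))
                          (fun s => ev (curvature br D u v (iota s)))) a).

End Chern.

Section ChernSimons.
Context {R : realType} {n : nat} {M : manifold R n} {rA rE : nat}.
Variables (A : lie_algebroid M rA) (E : vbundle M rE).

Definition flat (D : section A -> section E -> section E) :=
  forall a b s, curvature (@bracket _ _ _ _ A) D a b s = 0.

(* Sections of pr_2^* E over R x M are presented as families R -> Gamma(E),
   nu o pr_2 being a constant family, and the pair (c, a) : R * Gamma(A) stands
   for the section c d/dt + a of TR x A. *)
Definition fibre_derive (V : vectType R) (g : R -> V) (t : R) : V :=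
  \sum_(i < \dim {:V})
    derive1 (fun u => coord (vbasis {:V}) i (g u)) t *: (vbasis {:V})`_i.

Definition family_derive (s : R -> section E) (t : R) : section E :=
  section_of (fun x => fibre_derive (fun u => s u x) t).

Definition product_bracket (u v : R * section A) : R * section A :=
  (0, bracket u.2 v.2).

(* On a general family the Leibniz rule makes d/dt act by differentiation in t,
   and a, which has no component along R, act at each fixed t. *)
Definition aff_conn (D0 D1 : section A -> section E -> section E)
    (u : R * section A) (s : R -> section E) : R -> section E :=
  fun t => u.1 *: family_derive s t
           + ((1 - t) *: D0 u.2 (s t) + t *: D1 u.2 (s t)).

(* ch_p(D^aff_1)(u_1, ..., u_2p) at (t, x). *)
Definition chern_aff (D0 D1 : section A -> section E -> section E) (p : nat)
    (u : 'I_p.*2 -> R * section A) (t : R) (x : M) : R :=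
  chern product_bracket (aff_conn D0 D1)
    (fun (nu : section E) (_ : R) => nu) (fun s => s t x) u.

Definition form (k : nat) := ('I_k -> section A) -> M -> R.

Definition chern_simons (p : nat) (D0 D1 : section A -> section E -> section E) :
    form p.*2.-1 :=
  fun a x =>
    let u (i : 'I_p.*2) :=
      nth 0 ((1, 0) :: [seq (0, a k) | k <- enum 'I_p.*2.-1]) i in
    Rintegral lebesgue_measure `[0, 1] (fun t => chern_aff D0 D1 u t x).

End ChernSimons.

Arguments chern_simons {R n M rA rE A E} p D0 D1.

Section Forms.
Context {R : realType} {n : nat} {M : manifold R n} {rA : nat}.
Variable (A : lie_algebroid M rA).

Definition alt_form (k : nat) (eta : form A k) :=
  [/\ forall a, smooth_in setT (eta a),
      forall (a : 'I_k -> section A) i (c : R) (u v : section A) x,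
        eta [eta a with i |-> c *: u + v] x =
          c * eta [eta a with i |-> u] x + eta [eta a with i |-> v] x &
      forall (a : 'I_k -> section A) (tau : 'S_k) x,
        eta (a \o tau) x = (-1) ^+ tau * eta a x].

(* Indices start from 0, hence the sign (-1) ^+ i in the first sum; the sign in
   the second one is not affected. *)
Definition dform (k : nat) (eta : form A k) : form A k.+1 :=
  fun a x =>
    \sum_(i < k.+1) (-1) ^+ i *
      vfield_app (anchor_sec (a i)) (eta (fun l => a (lift i l))) x
    + \sum_(i < k.+1) \sum_(j < k.+1 | (i < j)%N) (-1) ^+ (i + j) *
      eta (fun l => nth 0 (bracket (a i) (a j) ::
             [seq a m | m <- enum 'I_k.+1 & (m != i) && (m != j)]) l) x.

Definition closed_form (k : nat) (eta : form A k) :=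
  alt_form eta /\ forall a x, dform eta a x = 0.

Definition exact_form (k : nat) : form A k -> Prop :=
  match k with
  | 0 => fun eta => forall a x, eta a x = 0
  | k'.+1 => fun eta => exists xi : form A k',
      alt_form xi /\ forall a x, eta a x = dform xi a x
  end.

(* The class of eta in the cohomology of the complex, as a coset of the space
   of exact forms. *)
Definition cohomology_class (k : nat) (eta : form A k) : set (form A k) :=
  [set omega | closed_form omega /\ exact_form (fun a x => omega a x - eta a x)].

End Forms.

(* Main.v *)
(* For a metric h put theta(a) = nabla^h_a - nabla_a, which is an endomorphism of E.
   Both connections are flat, hence theta satisfies the Maurer-Cartan equation
   d theta = - theta /\ theta, where d is twisted by nabla.  The affine combination has
   curvature dt /\ theta + (t^2 - t) theta /\ theta, so that cs_p(nabla, nabla^h) is a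
   constant, independent of h, times eta_h = Tr (theta /\ ... /\ theta) (2p - 1 factors).
   By Maurer-Cartan d eta_h is a multiple of Tr theta^(2p), which vanishes by the graded
   cyclicity of the trace.

   Two metrics h, h' are joined by h_t = (1 - t)^2 h + t^2 h'.  With
   psi_t = h_t^-1 (d h_t / dt) one gets d theta_t / dt = [nabla^(h_t), psi_t], i.e. the
   form c d/dt + a |-> c psi_t + theta_t(a) is again Maurer-Cartan, now over TR x A.
   The same trace identity on (d/dt, a_1, ..., a_(2p-1)) reads d eta_t / dt = d xi_t with
   xi_t the contraction with d/dt, so eta_h' - eta_h is d of the integral of xi_t over
   [0, 1].

   The connections are not local in the section a of A, but each nabla_a is local in the
   section of E, so everything can be computed in matrices over a trivialisation of E. *)

Require Import Defs.
From HB Require Import structures.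
From mathcomp Require Import all_boot all_order all_algebra all_fingroup.
From mathcomp Require Import all_classical all_reals all_analysis.
From mathcomp Require Import ring lra zify.

Set Implicit Arguments.
Unset Strict Implicit.
Unset Printing Implicit Defensive.

Import Order.TTheory GRing.Theory Num.Theory.
Import numFieldNormedType.Exports.

Local Open Scope classical_set_scope.
Local Open Scope ring_scope.

Lemma linear_map0 (R : pzRingType) (U V : lmodType R) (f : U -> V) : linear f -> f 0 = 0.
Proof. by move=> lf; have := lf (-1) 0 0; rewrite scaler0 addr0 scaleN1r addNr. Qed.

Lemma linear_mapN (R : pzRingType) (U V : lmodType R) (f : U -> V) u :
  linear f -> f (- u) = - f u.
Proof.
by move=> lf; have := lf (-1) u 0; rewrite (linear_map0 lf) !addr0 !scaleN1r.
Qed.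

Lemma prod_eq0 (W : pzRingType) (I : eqType) (l : seq I) k (B : I -> W) : k \in l -> B k = 0 ->
  \prod_(i <- l) B i = 0.
Proof.
move=> + Bk; elim: l => // i l IH; rewrite inE big_cons => /orP[/eqP <-|/IH ->].
  by rewrite Bk mul0r.
by rewrite mulr0.
Qed.

(** * Alternating sums of traces *)

Section AlternatingSums.
Variable R : numDomainType.

Definition altsum n (F : 'S_n -> R) : R := \sum_(s : 'S_n) (-1) ^+ s * F s.

Lemma eq_altsum n (F G : 'S_n -> R) : F =1 G -> altsum F = altsum G.
Proof. by move=> FG; apply: eq_bigr => s _; rewrite FG. Qed.

Lemma altsumD n (F G : 'S_n -> R) :
  altsum (fun s => F s + G s) = altsum F + altsum G.
Proof. by rewrite -big_split; apply: eq_bigr => s _; rewrite mulrDr. Qed.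

Lemma altsumZ n c (F : 'S_n -> R) : altsum (fun s => c * F s) = c * altsum F.
Proof. by rewrite mulr_sumr; apply: eq_bigr => s _; rewrite mulrCA. Qed.

Lemma altsumN n (F : 'S_n -> R) : altsum (fun s => - F s) = - altsum F.
Proof. by rewrite -sumrN; apply: eq_bigr => s _; rewrite mulrN. Qed.

Lemma altsum_mull n (c : 'S_n) (F : 'S_n -> R) :
  altsum F = (-1) ^+ c * altsum (fun s => F (c * s)%g).
Proof.
rewrite mulr_sumr [LHS](reindex_inj (mulgI c)) /=; apply: eq_bigr => s _.
by rewrite odd_permM signr_addb mulrA.
Qed.

Lemma altsum_mulr n (c : 'S_n) (F : 'S_n -> R) :
  altsum F = (-1) ^+ c * altsum (fun s => F (s * c)%g).
Proof.
rewrite mulr_sumr [LHS](reindex_inj (mulIg c)) /=; apply: eq_bigr => s _.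
by rewrite odd_permM addbC signr_addb mulrA.
Qed.

Lemma altsum_tperm n (i j : 'I_n) (F : 'S_n -> R) : i != j ->
  altsum (fun s => F (tperm i j * s)%g) = - altsum F.
Proof.
by move=> ij; rewrite [in RHS](altsum_mull (tperm i j)) odd_tperm ij expr1 mulN1r opprK.
Qed.

Lemma lift_perm_bij n (i : 'I_n.+1) :
  bijective (fun js : 'I_n.+1 * 'S_n => lift_perm i js.1 js.2).
Proof.
apply: inj_card_bij; last first.
  by rewrite card_prod card_ord !card_Sn factS.
move=> [j s] [k t] /= /permP e; have := e i; rewrite !lift_perm_id => jk.
rewrite -{}jk in e *; congr (_, _); apply/permP => l.
by apply: (@lift_inj _ j); have := e (lift i l); rewrite !lift_perm_lift.
Qed.

Lemma altsum_lift n (i : 'I_n.+1) (F : 'S_n.+1 -> R) :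
  altsum F = \sum_(j < n.+1) (-1) ^+ (i + j) * altsum (fun s => F (lift_perm i j s)).
Proof.
rewrite /altsum (reindex _ (onW_bij _ (lift_perm_bij i))) /=.
rewrite -(pair_bigA _ (fun j s => (-1) ^+ lift_perm i j s * F (lift_perm i j s))) /=.
apply: eq_bigr => j _; rewrite mulr_sumr; apply: eq_bigr => s _.
by rewrite odd_lift_perm !signr_addb !signr_odd exprD !mulrA.
Qed.

Lemma altsumV n (F : 'S_n -> R) : altsum (fun s => F (s^-1)%g) = altsum F.
Proof.
rewrite /altsum [RHS](reindex_inj invg_inj) /=.
by apply: eq_bigr => s _; rewrite odd_permV.
Qed.

Lemma altsum_liftr n (i : 'I_n.+1) (F : 'S_n.+1 -> R) :
  altsum F = \sum_(j < n.+1) (-1) ^+ (i + j) * altsum (fun s => F (lift_perm j i s)).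
Proof.
rewrite -altsumV (altsum_lift i); apply: eq_bigr => j _; congr (_ * _).
by rewrite -altsumV; apply: eq_altsum => s; rewrite lift_permV invgK.
Qed.

Let double_eq0 (x : R) : x *+ 2 = 0 -> x = 0.
Proof. by move/eqP; rewrite mulrn_eq0 => /eqP. Qed.

Section Trace.
Variables (W : pzRingType) (T : {additive W -> R}).
Lemma altsum_antisym p (kap : 'I_p.*2 -> 'I_p.*2 -> W) :
  altsum (fun s : 'S_p.*2 => T (\prod_(k < p)
    (kap (s (ord_double k)) (s (ord_doubleS k)) - kap (s (ord_doubleS k)) (s (ord_double k))))) =
  2 ^+ p * altsum (fun s : 'S_p.*2 => T (\prod_(k < p)
    kap (s (ord_double k)) (s (ord_doubleS k)))).
Proof.
pose x (s : 'S_p.*2) k := kap (s (ord_double k)) (s (ord_doubleS k)).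
pose y (s : 'S_p.*2) k := kap (s (ord_doubleS k)) (s (ord_double k)).
pose F j (s : 'S_p.*2) (k : 'I_p) := if (k < j)%N then x s k else x s k - y s k.
suff H j : (j <= p)%N -> altsum (fun s : 'S_p.*2 => T (\prod_(k < p) F 0%N s k)) =
    2 ^+ j * altsum (fun s : 'S_p.*2 => T (\prod_(k < p) F j s k)).
  have := H p (leqnn p); rewrite /F /= => ->; congr (_ * _).
  by apply: eq_altsum => s; congr (T _); apply: eq_bigr => k _; rewrite ltn_ord.
elim: j => [|j IH] jp; first by rewrite mul1r.
rewrite (IH (ltnW jp)) exprSr -mulrA; congr (_ * _) => {IH}.
pose j' := Ordinal jp.
have ltS (k : 'I_p) : k != j' -> (k < j.+1)%N = (k < j)%N.
  by rewrite -(inj_eq val_inj) /= => kj; rewrite ltnS leq_eqVlt (negbTE kj).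
pose G (s : 'S_p.*2) (k : 'I_p) := if (k == j') then y s k else F j s k.
have e1 : altsum (fun s : 'S_p.*2 => T (\prod_(k < p) F j s k)) =
   altsum (fun s : 'S_p.*2 => T (\prod_(k < p) F j.+1 s k)) -
   altsum (fun s : 'S_p.*2 => T (\prod_(k < p) G s k)).
  rewrite -altsumN -altsumD; apply: eq_altsum => s; rewrite -raddfB; congr (T _).
  have : uniq (index_enum 'I_p) by exact: index_enum_uniq.
  have : j' \in index_enum 'I_p by rewrite mem_index_enum.
  elim: (index_enum _) => // k r IH; rewrite inE !big_cons /= => jr /andP[kr ur].
  have [jk|jk] := eqVneq j' k; last first.
    rewrite (negbTE jk) /= in jr; rewrite (IH jr ur) mulrBr; congr (_ * _ - _ * _).
      by rewrite /F ltS // eq_sym.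
    by rewrite /G eq_sym (negbTE jk).
  rewrite -{}jk in kr jr *; have -> : F j s j' = x s j' - y s j' by rewrite /F /= ltnn.
  have -> : F j.+1 s j' = x s j' by rewrite /F /= ltnSn.
  have -> : G s j' = y s j' by rewrite /G eqxx.
  rewrite mulrBl.
  congr (_ * _ - _ * _); rewrite !big_seq; apply: eq_bigr => l lr.
    have : l != j' by apply: contraNneq kr => <-.
    by move=> lj; rewrite /F ltS.
  by rewrite /G ifF //; apply/negbTE; apply: contraNneq kr => <-.
have e2 : altsum (fun s : 'S_p.*2 => T (\prod_(k < p) G s k)) =
   - altsum (fun s : 'S_p.*2 => T (\prod_(k < p) F j.+1 s k)).
  rewrite -(@altsum_tperm _ (ord_double j') (ord_doubleS j')); last first.
    by rewrite -(inj_eq val_inj) /= neq_ltn ltnSn.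
  apply: eq_altsum => s; congr (T _); apply: eq_bigr => k _.
  rewrite /G /F /x /y !permM; case: eqP => [->|/eqP kj].
    by rewrite tpermL tpermR ltnSn.
  have kj' : k != j :> nat by [].
  by rewrite !tpermD ?ltS // -(inj_eq val_inj) /=; apply/eqP; move: kj'; lia.
by rewrite e1 e2 opprK mulrDl mul1r.
Qed.

Lemma prod_pairs (c : W) (f : nat -> W) m : (forall x, c * x = x * c) ->
  \prod_(0 <= l < m) (c * (f l.*2 * f l.*2.+1)) = c ^+ m * \prod_(0 <= i < m.*2) f i.
Proof.
move=> cC; elim: m => [|m IH]; first by rewrite !big_nil mulr1.
rewrite big_nat_recr //= IH doubleS !(big_nat_recr _ _ _ (leq0n _)) /=.
rewrite exprSr -!mulrA; congr (_ * _); rewrite [LHS]mulrA -cC -!mulrA; congr (_ * _).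
Qed.

Lemma altsum_chern q (c : W) (th : 'I_q.*2.+1 -> W) : (forall x, c * x = x * c) ->
  altsum (fun s : 'S_q.+1.*2 => T (\prod_(k < q.+1)
    (match unlift ord0 (s (ord_double k)), unlift ord0 (s (ord_doubleS k)) with
     | None, Some j => th j | Some i, Some j => c * (th i * th j) | _, None => 0 end))) =
  q.+1%:R * altsum (fun s : 'S_q.*2.+1 => T (c ^+ q * \prod_i th (s i))).
Proof.
move=> cC; rewrite [LHS](@altsum_liftr q.*2.+1 ord0).
rewrite (bigID (fun j : 'I_q.*2.+2 => odd j)) /= big1 ?add0r; last first.
  move=> j oj; rewrite /altsum big1 ?mulr0 // => s _.
  suff -> : \prod_(k < q.+1) (match unlift ord0 (lift_perm j ord0 s (ord_double k)),
     unlift ord0 (lift_perm j ord0 s (ord_doubleS k)) with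
     | None, Some j => th j | Some i, Some j => c * (th i * th j) | _, None => 0 end) = 0.
    by rewrite raddf0 mulr0.
  have jk : (j./2 < q.+1)%N by have := ltn_ord j; lia.
  have ej : j = ord_doubleS (Ordinal jk).
    by apply: val_inj; rewrite /=; move: oj; lia.
  apply: (prod_eq0 (mem_index_enum (Ordinal jk))).
  by rewrite -ej lift_perm_id unlift_none; case: (unlift _ _).
rewrite (reindex_onto (fun k : 'I_q.+1 => ord_double k : 'I_q.*2.+2)
  (fun j => inord j./2)) /=; last first.
  move=> j oj; apply: val_inj; rewrite /= inordK; last by have := ltn_ord j; lia.
  by move: oj; lia.
rewrite (eq_bigr (fun=> altsum (fun s : 'S_q.*2.+1 => T (c ^+ q * \prod_i th (s i))))).
  rewrite (eq_bigl predT) ?sumr_const ?card_ord ?mulr_natl // => k.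
  by rewrite odd_double doubleK inord_val eqxx.
move=> k _; rewrite add0n -signr_odd odd_double expr0 mul1r.
apply: eq_altsum => s; congr (T _).
pose f i := th (s (inord i)).
have uE (i : 'I_q.+1.*2) : unlift ord0 (lift_perm (ord_double k) ord0 s i) =
   if i == ord_double k then None else Some (s (inord (unbump k.*2 i))).
  case: eqP => [->|/eqP]; first by rewrite lift_perm_id unlift_none.
  rewrite eq_sym => /unlift_some[i' -> _]; rewrite lift_perm_lift liftK /= bumpK.
  by rewrite inord_val.
pose g l := if (l < k)%N then c * (f l.*2 * f l.*2.+1) else
            if l == k then f l.*2 else c * (f l.*2.-1 * f l.*2).
transitivity (\prod_(0 <= l < q.+1) g l).
  rewrite big_mkord; apply: eq_bigr => l _; rewrite !uE -!(inj_eq val_inj) /=.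
  have -> : (l.*2.+1 == k.*2) = false by apply/eqP; lia.
  rewrite /g; case: ltngtP => lk.
  - rewrite ifF; last by apply/eqP; lia.
    by congr (_ * (th (s (inord _)) * th (s (inord _)))); rewrite /unbump; lia.
  - rewrite ifF; last by apply/eqP; lia.
    by congr (_ * (th (s (inord _)) * th (s (inord _)))); rewrite /unbump; lia.
  - by rewrite lk eqxx; congr (th (s (inord _))); rewrite /unbump; lia.
rewrite (@big_cat_nat _ _ _ k) //=; last exact/ltnW/ltn_ord.
rewrite (@big_ltn_cond _ _ _ k) ?ltn_ord //= {2}/g ltnn eqxx.
rewrite (eq_big_nat _ _ (F2 := fun l => c * (f l.*2 * f l.*2.+1))); last first.
  by move=> l /andP[_ lk]; rewrite /g lk.
rewrite prod_pairs //.
have -> : \prod_(k.+1 <= l < q.+1) g l =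
    c ^+ (q - k) * \prod_(k.*2.+1 <= i < q.*2.+1) f i.
  rewrite -[k.+1]add0n -[k.*2.+1]add0n !big_addn subSS.
  have -> : (q.*2.+1 - k.*2.+1 = (q - k).*2)%N by lia.
  rewrite -(prod_pairs (fun i => f (i + k.*2.+1)%N)) //; apply: eq_big_nat => l _.
  rewrite /g ifF; last by apply/negbTE; lia.
  rewrite ifF; last by apply/eqP; lia.
  by congr (_ * (f _ * f _)); lia.
have cX m x : c ^+ m * x = x * c ^+ m.
  elim: m => [|m IH]; first by rewrite mul1r mulr1.
  by rewrite exprSr -mulrA cC mulrA IH mulrA.
have kq : (k <= q)%N by rewrite -ltnS.
rewrite [f _ * _]mulrA -cX -!mulrA [X in _ * X]mulrA -cX -mulrA mulrA -exprD subnKC //.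
congr (_ * _); rewrite -big_ltn; last by lia.
rewrite -big_cat_nat //=; last by lia.
by rewrite big_mkord; apply: eq_bigr => i _; rewrite /f inord_val.
Qed.

Hypothesis TC : forall x y, T (x * y) = T (y * x).

Let rotp n : 'S_n.+1 := lift_perm ord_max ord0 1%g.

Let rotp_max n : rotp n ord_max = ord0. Proof. exact: lift_perm_id. Qed.

Let rotp_widen n (i : 'I_n) : rotp n (widen_ord (leqnSn n) i) = lift ord0 i.
Proof.
have -> : widen_ord (leqnSn n) i = lift ord_max i.
  by apply: val_inj; rewrite /= /bump leqNgt ltn_ord.
by rewrite lift_perm_lift perm1.
Qed.

Let odd_rotp n : odd_perm (rotp n) = odd n.
Proof. by rewrite odd_lift_perm odd_perm1 /= !addbF. Qed.

Lemma altsum_rot n (Y : 'I_n.+1 -> 'I_n.+1 -> W) :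
  altsum (fun s => T (\prod_i Y i (s i))) =
  (-1) ^+ n * altsum (fun s => T (\prod_i Y ((rotp n)^-1%g i) (s i))).
Proof.
rewrite (altsum_mull (rotp n)) odd_rotp signr_odd; congr (_ * _).
apply: eq_altsum => s; rewrite big_ord_recr /= TC big_ord_recl /=.
have -> : (rotp n)^-1%g ord0 = ord_max by rewrite -(rotp_max n) permK.
rewrite permM rotp_max; congr (T (_ * _)).
by apply: eq_bigr => i _; rewrite -rotp_widen permK permM.
Qed.

Lemma altsum_trace_even n (th : 'I_n.+1 -> W) : odd n ->
  altsum (fun s => T (\prod_i th (s i))) = 0.
Proof.
move=> on; apply: double_eq0; rewrite mulr2n {1}(altsum_rot (fun=> th)).
by rewrite -signr_odd on expr1 mulN1r addNr.
Qed.

Variables (n : nat) (n_even : ~~ odd n).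

Lemma altsum_special (X th : 'I_n.+1 -> W) :
  altsum (fun s => \sum_k T (\prod_i (if i == k then X (s i) else th (s i)))) =
  n.+1%:R * altsum (fun s => T (X (s ord0) * \prod_i th (s (lift ord0 i)))).
Proof.
pose Y k (i : 'I_n.+1) := if i == k then X else th.
pose S k := altsum (fun s => T (\prod_i Y k i (s i))).
have Srot k : S k = S (rotp n k).
  rewrite /S (altsum_rot (Y k)) -signr_odd (negbTE n_even) expr0 mul1r.
  apply: eq_altsum => s; congr (T _); apply: eq_bigr => i _.
  by rewrite /Y (can2_eq (permKV _) (permK _)).
have S0 k : S k = S ord0.
  have [l] := ubnP (val k); elim: l k => // l IH k kl.
  have [k' ek|->//] := unliftP ord0 k.
  rewrite ek -[lift _ _](rotp_widen k') -Srot; apply: IH => /=.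
  by move: kl; rewrite ek.
transitivity (\sum_k S k).
  rewrite /S /altsum [RHS]exchange_big /=; apply: eq_bigr => s _; rewrite mulr_sumr.
  by apply: eq_bigr => k _; congr (_ * T _); apply: eq_bigr => i _; rewrite /Y; case: ifP.
rewrite (eq_bigr (fun=> S ord0)); last by move=> k _; exact: S0.
rewrite sumr_const card_ord -[LHS]mulr_natl; congr (_ * _).
by apply: eq_altsum => s; rewrite big_ord_recl.
Qed.

Lemma altsum_first (b : 'I_n.+1 -> W) :
  altsum (fun s => T (\prod_i b (s i))) =
  n.+1%:R * altsum (fun s : 'S_n => T (b ord0 * \prod_i b (lift ord0 (s i)))).
Proof.
pose X (j : 'I_n.+1) := if j == ord0 then b j else 0.
transitivity (altsum (fun s : 'S_n.+1 =>
    \sum_k T (\prod_i (if i == k then X (s i) else b (s i))))).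
  apply: eq_altsum => s; rewrite [RHS](bigD1 (s^-1 ord0)%g) //= [X in _ + X]big1 ?addr0.
    by congr (T _); apply: eq_bigr => i _; case: eqP => // ->; rewrite /X permKV eqxx.
  move=> k; rewrite eq_sym (can2_eq (permKV _) (permK _)) => /negbTE sk.
  suff -> : \prod_i (if i == k then X (s i) else b (s i)) = 0 by rewrite raddf0.
  by apply: (prod_eq0 (mem_index_enum k)); rewrite eqxx /X eq_sym sk.
rewrite altsum_special; congr (_ * _); rewrite (altsum_lift ord0) big_ord_recl big1.
  rewrite expr0 mul1r addr0; apply: eq_altsum => s.
  rewrite lift_perm_id /X eqxx; congr (T (_ * _)).
  by apply: eq_bigr => i _; rewrite lift_perm_lift.
move=> j _; suff -> : altsum (fun s => T (X (lift_perm ord0 (lift ord0 j) s ord0) *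
    \prod_i b (lift_perm ord0 (lift ord0 j) s (lift ord0 i)))) = 0 by rewrite mulr0.
by rewrite /altsum big1 // => s _; rewrite lift_perm_id /X mul0r raddf0 mulr0.
Qed.

Lemma enum_neq2 m (i : 'I_m.+2) (j : 'I_m.+1) :
  [seq k <- enum 'I_m.+2 | (k != i) && (k != lift i j)] =
  [seq lift i (lift j l) | l <- enum 'I_m].
Proof.
pose e k := relpre (@nat_of_ord k) ltn.
have es k : sorted (e k) (enum 'I_k).
  by rewrite -sorted_map val_enum_ord iota_ltn_sorted.
have bump_lt h k l : (bump h k < bump h l)%N = (k < l)%N.
  by rewrite ltnNge leq_bump2 -ltnNge.
apply: (@irr_sorted_eq _ (e _)).
- by move=> x y z; exact: ltn_trans.
- by move=> x; exact: ltnn.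
- by apply: sorted_filter; [move=> x y z; exact: ltn_trans | exact: es].
- rewrite sorted_map; apply: sub_sorted (es m) => x y /=.
  by rewrite /e /= !bump_lt.
move=> k; rewrite mem_filter mem_enum andbT; apply/idP/mapP => [|[l _ ->]].
  case/andP; case: (unliftP i k) => [k' ->|->]; last by rewrite eqxx.
  move=> _; rewrite (inj_eq (@lift_inj _ i)).
  case: (unliftP j k') => [l ->|->]; last by rewrite eqxx.
  by exists l => //; rewrite mem_enum.
by rewrite (inj_eq (@lift_inj _ i)) [_ == i]eq_sym [_ == j]eq_sym !neq_lift.
Qed.

Section MaurerCartan.
Variables (L : Type) (br : L -> L -> L) (th : L -> W) (dth : L -> L -> W).
Hypothesis th_brC : forall u v, th (br v u) = - th (br u v).
Hypothesis th_flat : forall u v,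
  dth u v - dth v u - th (br u v) = - (th u * th v - th v * th u).
Variables (z : L) (a : 'I_n.+2 -> L).

Let rest (i j : 'I_n.+2) := [seq a m | m <- enum 'I_n.+2 & (m != i) && (m != j)].

Let restE i (j : 'I_n.+1) (l : 'I_n) : nth z (rest i (lift i j)) l = a (lift i (lift j l)).
Proof.
rewrite /rest enum_neq2 -map_comp (nth_map l) ?size_enum_ord //=.
by rewrite nth_ord_enum.
Qed.

Let restC i j : rest i j = rest j i.
Proof. by rewrite /rest; under eq_filter do rewrite andbC. Qed.

Lemma altsum_lift2 m (G : 'I_m.+2 -> 'I_m.+2 -> ('I_m -> 'I_m.+2) -> R) :
  (forall i j f g, f =1 g -> G i j f = G i j g) ->
  altsum (fun s : 'S_m.+2 => G (s ord0) (s (lift ord0 ord0))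
      (fun l => s (lift ord0 (lift ord0 l)))) =
  \sum_(i < m.+2) \sum_(j < m.+1) (-1) ^+ (i + j) *
     altsum (fun s : 'S_m => G i (lift i j) (fun l => lift i (lift j (s l)))).
Proof.
move=> Gext; rewrite (altsum_lift ord0); apply: eq_bigr => i _.
rewrite (altsum_lift ord0) mulr_sumr; apply: eq_bigr => j _.
rewrite !add0n mulrA -exprD; congr (_ * _); apply: eq_altsum => s.
rewrite lift_perm_id lift_perm_lift lift_perm_id; apply: Gext => l.
by rewrite !lift_perm_lift.
Qed.

Let P (f : 'I_n -> 'I_n.+2) := \prod_(l < n) th (a (f l)).

(* An abstract form of d Tr th^(n+1) = 0 for d th = - th /\ th: dth u v stands for
   the derivative of th v along u. *)
Lemma altsum_maurer_cartan :
  \sum_(i < n.+2) (-1) ^+ i * altsum (fun s : 'S_n.+1 =>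
      \sum_k T (\prod_l (if l == k then dth (a i) (a (lift i (s l)))
                         else th (a (lift i (s l)))))) +
  \sum_(i < n.+2) \sum_(j < n.+2 | (i < j)%N) (-1) ^+ (i + j) *
      altsum (fun s : 'S_n.+1 =>
        T (\prod_l th (nth z (br (a i) (a j) :: rest i j) (s l)))) = 0.
Proof.
pose A (G : 'I_n.+2 -> 'I_n.+2 -> W) := altsum (fun s : 'S_n.+2 =>
  T (G (s ord0) (s (lift ord0 ord0)) * P (fun l => s (lift ord0 (lift ord0 l))))).
have AD G H : A (fun i j => G i j + H i j) = A G + A H.
  by rewrite /A -altsumD; apply: eq_altsum => s; rewrite mulrDl raddfD.
have AN G : A (fun i j => - G i j) = - A G.
  by rewrite /A -altsumN; apply: eq_altsum => s; rewrite mulNr raddfN.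
have AC G : A (fun i j => G j i) = - A G.
  rewrite /A -(@altsum_tperm _ ord0 (lift ord0 ord0)) //; apply: eq_altsum => s.
  rewrite !permM tpermL tpermR; congr (T (_ * _)); apply: eq_bigr => l _.
  by rewrite permM tpermD.
have AE G : A G = \sum_(i < n.+2) \sum_(j < n.+1) (-1) ^+ (i + j) *
     altsum (fun s : 'S_n => T (G i (lift i j) * P (fun l => lift i (lift j (s l))))).
  rewrite /A (@altsum_lift2 _ (fun i j f => T (G i j * P f))) // => i j f g fg.
  by congr (T (_ * _)); apply: eq_bigr => l _; rewrite fg.
pose S1 := A (fun i j => dth (a i) (a j)).
pose S2 := A (fun i j => th (br (a i) (a j))).
have e1 : \sum_(i < n.+2) (-1) ^+ i * altsum (fun s : 'S_n.+1 =>
      \sum_k T (\prod_l (if l == k then dth (a i) (a (lift i (s l)))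
                         else th (a (lift i (s l)))))) = n.+1%:R * S1.
  rewrite /S1 AE mulr_sumr; apply: eq_bigr => i _.
  rewrite (altsum_special (fun k => dth (a i) (a (lift i k))) (fun k => th (a (lift i k)))).
  rewrite mulrCA; congr (_ * _); rewrite (altsum_lift ord0) mulr_sumr.
  apply: eq_bigr => j _; rewrite add0n mulrA -exprD; congr (_ * _).
  apply: eq_altsum => s; rewrite lift_perm_id; congr (T (_ * _)).
  by apply: eq_bigr => l _; rewrite lift_perm_lift.
pose B i j := altsum (fun s : 'S_n =>
  T (th (br (a i) (a j)) * \prod_l th (nth z (rest i j) (s l)))).
have BC i j : B j i = - B i j.
  rewrite /B -altsumN; apply: eq_altsum => s.
  by rewrite th_brC restC mulNr raddfN.
pose S3 := \sum_(i < n.+2) \sum_(j < n.+2 | (i < j)%N) (-1) ^+ (i + j) * B i j.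
have e2 : \sum_(i < n.+2) \sum_(j < n.+2 | (i < j)%N) (-1) ^+ (i + j) *
      altsum (fun s : 'S_n.+1 =>
        T (\prod_l th (nth z (br (a i) (a j) :: rest i j) (s l)))) = n.+1%:R * S3.
  rewrite /S3 mulr_sumr; apply: eq_bigr => i _; rewrite mulr_sumr.
  apply: eq_bigr => j _; rewrite mulrCA; congr (_ * _).
  exact: (altsum_first (fun l => th (nth z (br (a i) (a j) :: rest i j) l))).
have e3 : S2 = - S3 *+ 2.
  have -> : S2 = \sum_(i < n.+2) \sum_(j < n.+1) (-1) ^+ (i + j) * B i (lift i j).
    rewrite /S2 AE; apply: eq_bigr => i _; apply: eq_bigr => j _.
    congr (_ * _); apply: eq_altsum => s; congr (T (_ * _)).
    by apply: eq_bigr => l _; rewrite restE.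
  have -> : \sum_(i < n.+2) \sum_(j < n.+1) (-1) ^+ (i + j) * B i (lift i j) =
     \sum_(i < n.+2) \sum_(j < n.+2 | j != i)
        (if (i < j)%N then - ((-1) ^+ (i + j) * B i j) else (-1) ^+ (i + j) * B i j).
    apply: eq_bigr => i _.
    rewrite [RHS](reindex_onto (lift i) (fun k => odflt ord0 (unlift i k))) /=.
      apply: eq_big => j; first by rewrite liftK eqxx eq_sym neq_lift.
      move=> _; rewrite /bump; case: (leqP i j) => ij.
        by rewrite ifT // addnS exprS mulN1r mulNr opprK.
      by rewrite add0n ifF //; apply/negbTE; rewrite -leqNgt ltnW.
    by move=> j; rewrite eq_sym => /unlift_some[k jk ->]; rewrite jk.
  have -> : \sum_(i < n.+2) \sum_(j < n.+2 | j != i)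
        (if (i < j)%N then - ((-1) ^+ (i + j) * B i j) else (-1) ^+ (i + j) * B i j) =
     - S3 + \sum_(i < n.+2) \sum_(j < n.+2 | (j < i)%N) (-1) ^+ (i + j) * B i j.
    rewrite /S3 -sumrN -big_split; apply: eq_bigr => i _ /=.
    rewrite (bigID (fun j : 'I_n.+2 => (i < j)%N)) /= -sumrN; congr (_ + _).
      apply: eq_big => j; last by case/andP => _ ->.
      by rewrite andb_idl // => ij; rewrite -val_eqE /= gtn_eqF.
    apply: eq_big => j; last by case/andP => _ /negbTE ->.
    by rewrite -leqNgt ltn_neqAle -val_eqE.
  rewrite mulr2n; congr (_ + _); rewrite (exchange_big_dep xpredT) //= /S3 -sumrN.
  apply: eq_bigr => i _; rewrite -sumrN; apply: eq_bigr => j _.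
  by rewrite BC mulrN addnC.
have e4 : S1 *+ 2 - S2 = - (A (fun i j => th (a i) * th (a j)) *+ 2).
  have <- : A (fun i j => dth (a i) (a j) - dth (a j) (a i) - th (br (a i) (a j))) =
      S1 *+ 2 - S2.
    by rewrite !AD !AN (AC (fun i j => dth (a i) (a j))) opprK.
  have <- : A (fun i j => - (th (a i) * th (a j) - th (a j) * th (a i))) =
      - (A (fun i j => th (a i) * th (a j)) *+ 2).
    by rewrite AN AD AN (AC (fun i j => th (a i) * th (a j))) opprK.
  by apply: eq_altsum => s; rewrite th_flat.
have e5 : A (fun i j => th (a i) * th (a j)) = 0.
  rewrite -(@altsum_trace_even _ (fun i => th (a i))) /= ?n_even //.
  by apply: eq_altsum => s; rewrite 2!big_ord_recl mulrA.
rewrite e1 e2 -mulrDr.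
suff -> : S1 + S3 = 0 by rewrite mulr0.
apply: double_eq0; rewrite mulrnDl.
by move: e4; rewrite e3 e5 mul0rn oppr0 mulNrn opprK.
Qed.

End MaurerCartan.

End Trace.
End AlternatingSums.

(** * Families of smooth functions depending on a parameter *)

Section JointSmooth.
Context {R : realType} {n : nat}.
Implicit Types (D : set 'rV[R]_n) (F G : R -> 'rV[R]_n -> R).

Fixpoint jCk (k : nat) D F : Prop :=
  (forall t y, D y -> {for (t, y), continuous (fun p : R * 'rV[R]_n => F p.1 p.2)}) /\
  (if k is k'.+1 then
     (forall t y v, D y -> derivable (F t) y v) /\
     forall v, jCk k' D (fun t => 'D_v (F t))
   else True).

Lemma jCk_cont k D F t y : jCk k D F -> D y ->
  {for (t, y), continuous (fun p : R * 'rV[R]_n => F p.1 p.2)}.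
Proof. by case: k => [|k] [+ _]; apply. Qed.

Lemma jCk_le k D F : jCk k.+1 D F -> jCk k D F.
Proof.
elim: k F => [|k IH] F; first by case.
by move=> [cf [df Df]]; split=> //; split=> // v; apply/IH/Df.
Qed.

Lemma jCk_ext k D F G : open D -> (forall t y, D y -> F t y = G t y) ->
  jCk k D F -> jCk k D G.
Proof.
move=> oD; elim: k F G => [|k IH] F G FG.
all: have cFG : (forall t y, D y -> {for (t, y), continuous (fun p : R * 'rV[R]_n => F p.1 p.2)}) ->
  (forall t y, D y -> {for (t, y), continuous (fun p : R * 'rV[R]_n => G p.1 p.2)}).
1,3: move=> cF t y Dy; rewrite /prop_for /continuous_at /= -(FG t y Dy);
  apply: cvg_trans (cF t y Dy); apply: near_eq_cvg;
  near=> p; apply: FG; near: p;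
  exact: (@cvg_snd _ _ (nbhs t) (nbhs y) _ D (open_nbhs_nbhs (conj oD Dy))).
- by move=> [cF _]; split=> //; exact: cFG.
- move=> [cF [dF DF]]; split; first exact: cFG.
  split=> [t y v Dy|v].
    by apply: near_eq_derivable (dF t y v Dy); exact: (open_near_eq oD Dy (FG t)).
  apply: (IH _ _ _ (DF v)) => t y Dy.
  by apply: near_eq_derive; exact: (open_near_eq oD Dy (FG t)).
Unshelve. all: by end_near. Qed.

Lemma jCk_sub k D D' F : D' `<=` D -> jCk k D F -> jCk k D' F.
Proof.
move=> DD; elim: k F => [|k IH] F.
  by move=> [cF _]; split=> // t y /DD; exact: cF.
move=> [cF [dF DF]]; split; first by move=> t y /DD; exact: cF.
by split=> [t y v /DD|v]; [exact: dF | exact: IH (DF v)].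
Qed.

Lemma jCk_local k D F : (forall y, D y -> exists2 D', D' y & jCk k D' F) -> jCk k D F.
Proof.
elim: k F => [|k IH] F H.
  by split=> // t y /H[D' D'y [cF _]]; exact: cF.
split; first by move=> t y /H[D' D'y [cF _]]; exact: cF.
split=> [t y v /H[D' D'y [_ [dF _]]]|v]; first exact: dF.
by apply: IH => y /H[D' D'y [_ [_ DF]]]; exists D' => //; exact: DF.
Qed.

Lemma jCk_time k D (phi : R -> R) : continuous phi -> jCk k D (fun t _ => phi t).
Proof.
have jC psi : continuous psi -> forall t y, D y ->
    {for (t, y), continuous (fun p : R * 'rV[R]_n => psi p.1)}.
  move=> cpsi t y _; rewrite /prop_for /continuous_at /=.
  by apply: (@cvg_comp _ _ _ fst psi (nbhs (t, y)) (nbhs t)); [exact: cvg_fst | exact: cpsi].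
elim: k phi => [|k IH] phi cphi; first by split=> //; exact: jC.
split; first exact: jC.
split=> [t y v _|v]; first exact: derivable_cst.
suff -> : (fun t => 'D_v (fun=> phi t)) = (fun (_ : R) (_ : 'rV[R]_n) => 0 : R).
  by apply: (IH (fun=> 0)); exact: cst_continuous.
by apply/funext => t; apply/funext => y; rewrite derive_cst.
Qed.

Lemma jCk_of_Ck k D f : Ck k D f -> jCk k D (fun _ => f).
Proof.
have jC g : (forall y, D y -> {for y, continuous g}) -> forall t y, D y ->
    {for (t, y), continuous (fun p : R * 'rV[R]_n => g p.2)}.
  move=> cg t y Dy; rewrite /prop_for /continuous_at /=.
  by apply: (@cvg_comp _ _ _ snd g (nbhs (t, y)) (nbhs y)); [exact: cvg_snd | exact: cg].
elim: k f => [|k IH] f; first by move=> [cf _]; split=> //; exact: jC.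
move=> [cf [df Df]]; split; first exact: jC.
by split=> [t|v]; [exact: df | exact: IH (Df v)].
Qed.

Lemma Ck_of_jCk k D F t : jCk k D F -> Ck k D (F t).
Proof.
have Cj G y : {for (t, y), continuous (fun p : R * 'rV[R]_n => G p.1 p.2)} ->
    {for y, continuous (G t)}.
  move=> cG; rewrite /prop_for /continuous_at.
  apply: (@cvg_comp _ _ _ (fun z : 'rV[R]_n => (t, z)) (fun p => G p.1 p.2) _ (nbhs (t, y))) => //.
  exact: (@cvg_pair _ _ _ (nbhs y) (nbhs t) (nbhs y) _ _ _ (fun=> t) id (cvg_cst t) cvg_id).
elim: k F => [|k IH] F; first by move=> [cF _]; split=> // y Dy; exact/Cj/cF.
move=> [cF [dF DF]]; split; first by move=> y Dy; exact/Cj/cF.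
by split=> [y v|v]; [exact: dF | exact: IH (DF v)].
Qed.

Lemma jCk_add k D F G : open D -> jCk k D F -> jCk k D G ->
  jCk k D (fun t y => F t y + G t y).
Proof.
move=> oD; elim: k F G => [|k IH] F G.
  by move=> [cf _] [cg _]; split=> // t y Dy; exact: cvgD (cf t y Dy) (cg t y Dy).
move=> [cf [df Df]] [cg [dg Dg]].
split; first by move=> t y Dy; exact: cvgD (cf t y Dy) (cg t y Dy).
split=> [t y v Dy|v]; first by have := derivableD (df t y v Dy) (dg t y v Dy).
apply: jCk_ext (IH _ _ (Df v) (Dg v)) => // t y Dy.
by rewrite -(deriveD (df t y v Dy) (dg t y v Dy)).
Qed.

Lemma jCk_mul k D F G : open D -> jCk k D F -> jCk k D G ->
  jCk k D (fun t y => F t y * G t y).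
Proof.
move=> oD; elim: k F G => [|k IH] F G.
  by move=> [cf _] [cg _]; split=> // t y Dy; exact: cvgM (cf t y Dy) (cg t y Dy).
move=> ff gg; have [cf [df Df]] := ff; have [cg [dg Dg]] := gg.
split; first by move=> t y Dy; exact: cvgM (cf t y Dy) (cg t y Dy).
split=> [t y v Dy|v]; first by have := derivableM (df t y v Dy) (dg t y v Dy).
apply: (@jCk_ext _ _ (fun t y => F t y * 'D_v (G t) y + G t y * 'D_v (F t) y)) => //.
  by move=> t y Dy; have := deriveM (df t y v Dy) (dg t y v Dy).
by apply: jCk_add => //; apply: IH;
  by [exact: (jCk_le ff) | exact: (jCk_le gg) | exact: Df | exact: Dg].
Qed.

Lemma is_derive_line (f : 'rV[R]_n -> R) (y v : 'rV[R]_n) (x : R) :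
  (fun h : R => h^-1 *: (f (h *: v + (x *: v + y)) - f (x *: v + y))) =
  (fun h : R => h^-1 *: (f ((h *: 1 + x) *: v + y) - f (x *: v + y))).
Proof. by apply/funext => h; rewrite [h *: 1]mulr1 scalerDl -addrA. Qed.

Lemma derivable_line (f : 'rV[R]_n -> R) (y v : 'rV[R]_n) (x : R) :
  derivable (fun x : R => f (x *: v + y)) x 1 = derivable f (x *: v + y) v.
Proof. by rewrite /derivable -is_derive_line. Qed.

Lemma derive_line (f : 'rV[R]_n -> R) (y v : 'rV[R]_n) (x : R) :
  'D_1 (fun x : R => f (x *: v + y)) x = 'D_v f (x *: v + y).
Proof. by rewrite /derive -is_derive_line. Qed.

Lemma is_derive_comp_line (phi phi' : R -> R) (f : 'rV[R]_n -> R) (y v : 'rV[R]_n) :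
  is_derive (f y) 1 phi (phi' (f y)) -> derivable f y v ->
  derivable (fun z => phi (f z)) y v /\
  'D_v (fun z => phi (f z)) y = phi' (f y) * 'D_v f y.
Proof.
move=> dphi df; have y0 : y = 0 *: v + y by rewrite scale0r add0r.
pose g x := f (x *: v + y).
have dg : is_derive (0 : R) (1 : R) g ('D_v f y).
  apply: DeriveDef; first by rewrite /g derivable_line -y0.
  by rewrite /g derive_line -y0.
have dphig : is_derive (g 0) 1 phi (phi' (f y)) by rewrite /g -y0.
have [H1 H2] := is_derive1_comp dphig dg.
split; first by rewrite y0 -(derivable_line (fun z => phi (f z))).
by rewrite [in LHS]y0 -(derive_line (fun z => phi (f z))) H2 mulrC.
Qed.

(* [phi 0] composed with F, where [phi k.+1] is the derivative of [phi k] *)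
Lemma jCk_comp (phi : nat -> R -> R) (O : set R) k D F : open D ->
  (forall k x, O x -> is_derive x 1 (phi k) (phi k.+1 x)) ->
  (forall t y, D y -> O (F t y)) ->
  jCk k D F -> jCk k D (fun t y => phi 0%N (F t y)).
Proof.
move=> oD dphi FO jF.
suff H j : jCk k D (fun t y => phi j (F t y)) by exact: H.
have cj i t y : D y -> {for (t, y), continuous (fun p : R * 'rV[R]_n => phi i (F p.1 p.2))}.
  move=> Dy; rewrite /prop_for /continuous_at /=.
  apply: (@cvg_comp _ _ _ (fun p : R * 'rV[R]_n => F p.1 p.2) (phi i) _ (nbhs (F t y))).
    exact: (jCk_cont jF Dy).
  have [d _] := dphi i _ (FO t y Dy).
  by move/derivable1_diffP: d => /differentiable_continuous.
elim: k F jF FO j cj => [|k IH] F jF FO j cj; first by split=> // t y; exact: cj.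
have [cF [dF DF]] := jF.
have dj t y v : D y -> derivable (fun z => phi j (F t z)) y v /\
    'D_v (fun z => phi j (F t z)) y = phi j.+1 (F t y) * 'D_v (F t) y.
  move=> Dy; apply: (@is_derive_comp_line _ (phi j.+1)); last exact: dF.
  exact/dphi/FO.
split; first by move=> t y; exact: cj.
split=> [t y v /(dj t y v)[]//|v].
apply: (@jCk_ext _ _ (fun t y => phi j.+1 (F t y) * 'D_v (F t) y)) => //.
  by move=> t y /(dj t y v)[].
by apply: jCk_mul => //; [apply: IH => //; exact: jCk_le jF | exact: DF].
Qed.

Lemma jCk_inv k D F : open D -> (forall t y, D y -> F t y != 0) ->
  jCk k D F -> jCk k D (fun t y => (F t y)^-1).
Proof.
move=> oD F0.
pose phi (k : nat) (x : R) := (-1) ^+ k * k`!%:R * (x^-1) ^+ k.+1.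
move=> /(@jCk_comp phi [set x | x != 0] k D F oD _ F0) H.
apply: jCk_ext (H _) => //; first by move=> t y _; rewrite /phi expr0 !mul1r.
move=> j x x0.
have dV : is_derive x 1 (fun x : R => x^-1) (- x ^- 2).
  have := is_deriveV x0 (is_derive_id x 1); rewrite /= => d.
  by apply: is_derive_eq d _; rewrite scaler1.
have dX := @is_deriveZ _ _ _ _ ((-1) ^+ j * j`!%:R) x 1 _ (is_deriveX j.+1 dV).
have -> : phi j = ((-1) ^+ j * j`!%:R) \*: ((fun x : R => x^-1) ^+ j.+1).
  by apply/funext => z; rewrite /phi /= fctE.
apply: is_derive_eq dX _; rewrite /phi factS natrM.
rewrite -![_ *: _]/(_ * _) /= -!exprVn !exprS expr0.
by ring.
Qed.

End JointSmooth.

Section UnitIntegral.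
Context {R : realType}.
Local Notation mu := (@lebesgue_measure R).

Definition int01 (f : R -> R) : R := Rintegral mu `[0, 1] f.

Lemma continuous_integrable01 (f : R -> R) : continuous f ->
  mu.-integrable `[0, 1] (EFin \o f).
Proof.
move=> cf; apply: continuous_compact_integrable; first exact: segment_compact.
exact: continuous_subspaceT.
Qed.

Lemma eq_int01 (f g : R -> R) : f =1 g -> int01 f = int01 g.
Proof. by move=> /funext ->. Qed.

Lemma int01_cst (c : R) : int01 (fun=> c) = c.
Proof.
by rewrite /int01 Rintegral_cst //= lebesgue_measure_itv /= lte_fin ltr01 sube0 mulr1.
Qed.

Lemma int01D (f g : R -> R) : continuous f -> continuous g ->
  int01 (fun t => f t + g t) = int01 f + int01 g.
Proof. by move=> cf cg; apply: RintegralD => //; exact: continuous_integrable01. Qed.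

Lemma int01Z (c : R) (f : R -> R) : continuous f ->
  int01 (fun t => c * f t) = c * int01 f.
Proof. by move=> cf; apply: RintegralZl => //; exact: continuous_integrable01. Qed.

Lemma int01_sum (I : Type) (r : seq I) (P : pred I) (f : I -> R -> R) :
  (forall i, continuous (f i)) ->
  int01 (fun t => \sum_(i <- r | P i) f i t) = \sum_(i <- r | P i) int01 (f i).
Proof.
move=> cf; elim: r => [|i r IH].
  by rewrite big_nil -[RHS](int01_cst 0); apply: eq_int01 => t; rewrite big_nil.
rewrite big_cons; case: ifP => Pi.
  rewrite -IH -int01D //; first by apply: eq_int01 => t; rewrite big_cons Pi.
  by move=> x; apply: cvg_big => [|j _]; [exact: add_continuous | exact: cf].
by rewrite -IH; apply: eq_int01 => t; rewrite big_cons Pi.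
Qed.

Lemma int01_derive (F f : R -> R) : continuous f ->
  (forall t : R, is_derive t (1 : R) F (f t)) -> int01 f = F 1 - F 0.
Proof.
move=> cf dF.
have cF : continuous F.
  by move=> t; have [/derivable1_diffP/differentiable_continuous] := dF t.
rewrite /int01 /Rintegral (@continuous_FTC2 _ f F) //.
- exact: continuous_subspaceT.
- split=> [x _||]; first by have [] := dF x.
  + exact/cvg_at_right_filter/cF.
  + exact/cvg_at_left_filter/cF.
- by move=> x _; rewrite derive1E; have [_ ->] := dF x.
Qed.

Context {n : nat}.
Implicit Types (D : set 'rV[R]_n) (F : R -> 'rV[R]_n -> R).

Lemma continuous_section F y :
  (forall t, {for (t, y), continuous (fun p : R * 'rV[R]_n => F p.1 p.2)}) ->
  continuous (F^~ y).
Proof.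
move=> cF t; rewrite /continuous_at.
apply: (@cvg_comp _ _ _ (fun t : R => (t, y)) (fun p => F p.1 p.2) _ (nbhs (t, y))).
  exact: (@cvg_pair _ _ _ (nbhs t) (nbhs t) (nbhs y) _ _ _ id (fun=> y) cvg_id (cvg_cst y)).
exact: cF.
Qed.

Lemma near_uniform01 F y (e : R) : 0 < e ->
  (forall t, {for (t, y), continuous (fun p : R * 'rV[R]_n => F p.1 p.2)}) ->
  \forall z \near y, forall t, `[0, 1]%classic t -> `|F t z - F t y| < e.
Proof.
move=> e0 cF.
have /compact_near_coveringP H := @segment_compact R 0 1.
apply: (H _ (nbhs y) (fun z t => `|F t z - F t y| < e) _) => t _.
have e20 : 0 < e / 2 by rewrite divr_gt0.
have /cvgrPdist_lt/(_ _ e20) Ft := cF t.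
have /cvgrPdist_lt/(_ _ e20) Gt := @continuous_section F y cF t.
have {}Gt : \forall p \near (t, y), `|F t y - F p.1 y| < e / 2.
  exact: (cvg_fst Gt).
apply: filterS2 Ft Gt => -[s z] /= h1 h2.
rewrite [X in `|X|](_ : _ = (F t y - F s y) - (F t y - F s z)); last by ring.
by rewrite (le_lt_trans (ler_normB _ _)) // [e]splitr ltrD.
Qed.

Lemma int01_continuous D F y : open D -> D y ->
  (forall t z, D z -> {for (t, z), continuous (fun p : R * 'rV[R]_n => F p.1 p.2)}) ->
  {for y, continuous (fun z => int01 (F^~ z))}.
Proof.
move=> oD Dy cF; rewrite /prop_for /continuous_at; apply/(@cvgrPdist_le _ _ _ (nbhs y)) => e e0.
have cFt z : D z -> continuous (F^~ z) by move=> Dz; apply: continuous_section => t; exact: cF.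
have nD : \forall z \near y, D z by exact: open_nbhs_nbhs.
have nF : \forall z \near y, forall t, `[0, 1]%classic t -> `|F t z - F t y| < e.
  by apply: near_uniform01 => // t; exact: cF.
apply: filterS2 nD nF => z Dz Fz.
have cB : continuous (fun t => F t y - F t z).
  by move=> t; apply: cvgB; exact: cFt.
rewrite /int01 -RintegralB //=; try exact/continuous_integrable01/cFt.
apply: le_trans (le_normr_Rintegral _ _) _ => //; first exact: continuous_integrable01.
rewrite -[leRHS](int01_cst e); apply: le_Rintegral => //.
- apply: continuous_integrable01 => t; apply: cvg_norm; exact: cB.
- by apply: continuous_integrable01; exact: cst_continuous.
- by move=> t t01; rewrite distrC ltW //; exact: Fz.
Qed.

Lemma int01_derive_under D F y v : open D -> D y -> jCk 1 D F ->
  derivable (fun z => int01 (F^~ z)) y v /\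
  'D_v (fun z => int01 (F^~ z)) y = int01 (fun t => 'D_v (F t) y).
Proof.
move=> oD Dy jF; have [cF [dF DF]] := jF.
have cFt z : D z -> continuous (F^~ z) by move=> Dz; apply: continuous_section => t; exact: cF.
have cdF t z : D z -> {for (t, z), continuous (fun p : R * 'rV[R]_n => 'D_v (F p.1) p.2)}.
  by move=> Dz; exact: (@jCk_cont _ _ 0 D (fun t => 'D_v (F t)) t z (DF v) Dz).
have cdFt z : D z -> continuous (fun t => 'D_v (F t) z).
  by move=> Dz; apply: (@continuous_section (fun t => 'D_v (F t))) => t; exact: cdF.
have y0 : 0 *: v + y = y by rewrite scale0r add0r.
have cline : {for 0 : R, continuous (fun x : R => x *: v + y)}.
  by apply: cvgD; [apply: cvgZr_tmp; exact: cvg_id | exact: cvg_cst].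
have [d /= d0 Hd] : exists2 d : R, 0 < d & forall x, `|x| < d -> D (x *: v + y) /\
    forall t, `[0, 1]%classic t -> `|'D_v (F t) (x *: v + y) - 'D_v (F t) y| < 1.
  have /cline : nbhs (0 *: v + y) (D `&` [set z | forall t, `[0, 1]%classic t ->
      `|'D_v (F t) z - 'D_v (F t) y| < 1]).
    rewrite y0; apply: filterI; first exact: open_nbhs_nbhs.
    apply: (@near_uniform01 (fun t => 'D_v (F t))) => // t; exact: cdF.
  move=> /nbhs_ballP[d /= d0 Hd]; exists d => // x xd.
  by apply: Hd; rewrite /ball /= sub0r normrN.
pose f (x t : R) := F t (x *: v + y).
pose G (t : R) := `|'D_v (F t) y| + 1.
have IE x : `]-d, d[%classic x -> `|x| < d by rewrite /= in_itv /= ltr_norml.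
have I0 : `]-d, d[%classic (0 : R) by rewrite /= in_itv /= oppr_lt0 d0.
have intf x : `]-d, d[%classic x -> mu.-integrable `[0, 1] (EFin \o f x).
  by move=> /IE /Hd[Dx _]; apply: continuous_integrable01; exact: cFt.
have derf x t : `]-d, d[%classic x -> `[0, 1]%classic t -> derivable (f ^~ t) x 1.
  by move=> /IE /Hd[Dx _] _; rewrite /f derivable_line; exact: dF.
have G0 t : 0 <= G t by rewrite addr_ge0.
have intG : mu.-integrable `[0, 1] (EFin \o G).
  apply: continuous_integrable01 => t; apply: cvgD; last exact: cvg_cst.
  by apply: cvg_norm; exact: cdFt.
have Gub x t : `]-d, d[%classic x -> `[0, 1]%classic t -> `|partial1of2 f x t| <= G t.
  move=> /IE /Hd[Dx Hx] t01; rewrite partial1of2E /f derive_line /G.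
  by rewrite -lerBlDl (le_trans (lerB_dist _ _)) // ltW // Hx.
have m01 : measurable (`[0, 1]%classic : set R) by [].
pose I z := int01 (F^~ z).
have dl : derivable (fun x : R => I (x *: v + y)) 0 1.
  exact: (@derivable_under_integral _ _ _ mu f _ m01 0 (-d) d I0 intf derf G G0 intG Gub).
have de : 'D_1 (fun x : R => I (x *: v + y)) 0 =
    Rintegral mu `[0, 1] (fun t => partial1of2 f 0 t).
  rewrite -derive1E.
  exact: (@differentiation_under_integral _ _ _ mu f _ m01 0 (-d) d I0 intf derf G G0 intG Gub).
rewrite (derivable_line I) y0 in dl; rewrite (derive_line I) y0 in de; split; first exact: dl.
rewrite -/I de; apply: eq_Rintegral => t _.
by rewrite partial1of2E /f derive_line y0.
Qed.

Lemma Ck_int01 k D F : open D -> jCk k D F -> Ck k D (fun z => int01 (F^~ z)).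
Proof.
move=> oD; elim: k F => [|k IH] F jF.
  by split=> // y Dy; apply: (int01_continuous oD Dy); have [] := jF.
split; first by move=> y Dy; apply: (int01_continuous oD Dy); have [] := jF.
have dI y v : D y -> derivable (fun z => int01 (F^~ z)) y v /\
    'D_v (fun z => int01 (F^~ z)) y = int01 (fun t => 'D_v (F t) y).
  move=> Dy; apply: (int01_derive_under _ oD Dy).
  by case: jF => cF [dF DF]; split=> //; split=> // w; split=> // t z; exact: (jCk_cont (DF w)).
split=> [y v /dI-/(_ v)[]//|v].
apply: (@Ck_ext _ _ _ _ (fun z => int01 (fun t => 'D_v (F t) z))) => //.
  by move=> y /dI-/(_ v)[].
by apply: (IH (fun t => 'D_v (F t))); case: jF => _ [_]; exact.
Qed.

End UnitIntegral.

(** * Bump functions *)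

Section FlatFunctions.
Context {R : realType}.
Implicit Types (p : {poly R}) (x : R).

Definition flat_fun p x : R := if 0 < x then p.[x^-1] * expR (- x^-1) else 0.

Definition flat_deriv p : {poly R} := 'X^2 * (p - p^`()).

Lemma flat_fun_le p : exists2 C, 0 <= C & forall x, `|flat_fun p x| <= C * `|x|.
Proof.
exists (\sum_(i < size p) `|p`_i| * i.+1`!%:R).
  by apply: sumr_ge0 => i _; rewrite mulr_ge0.
move=> x; rewrite /flat_fun; case: ifP => x0; last first.
  by rewrite normr0 mulr_ge0 // sumr_ge0 // => i _; rewrite mulr_ge0.
have u0 : 0 < x^-1 by rewrite invr_gt0.
rewrite horner_coef mulr_suml mulr_suml; apply: le_trans (ler_norm_sum _ _ _) _.
apply: ler_sum => i _; rewrite !normrM -!mulrA ler_wpM2l //.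
rewrite (gtr0_norm x0) normrX (gtr0_norm u0) ger0_norm ?expR_ge0 // expRN.
rewrite ler_pdivrMr ?expR_gt0 //.
have := expR_ge1Dxn i (ltW u0); set u := x^-1 in u0 * => H.
have {}H : u ^+ i.+1 / i.+1`!%:R <= expR u by apply: le_trans H; rewrite lerDr.
rewrite ler_pdivrMr ?ltr0n ?fact_gt0 // in H.
have -> : u ^+ i = x * u ^+ i.+1 by rewrite exprS mulrA mulfV ?mul1r // gt_eqF.
by rewrite mulrAC [_ * expR u]mulrC [leRHS]mulrC ler_wpM2l // ltW.
Qed.

Lemma is_derive_flat p x : is_derive x (1 : R) (flat_fun p) (flat_fun (flat_deriv p) x).
Proof.
have [x0|x0|->] := ltrgtP x 0.
- have e : {near x, cst 0 =1 flat_fun p}.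
    near=> z; have z0 : z < 0 by near: z; exact: lt_nbhsl.
    by rewrite /flat_fun ltNge (ltW z0).
  rewrite {2}/flat_fun ltNge (ltW x0) /=; apply: DeriveDef.
    by apply: near_eq_derivable e _; exact: derivable_cst.
  by rewrite -(near_eq_derive _ e) derive_cst.
- have e : {near x, (fun z => p.[z^-1] * expR (- z^-1)) =1 flat_fun p}.
    near=> z; have z0 : 0 < z by near: z; exact: lt_nbhsr.
    by rewrite /flat_fun z0.
  rewrite {2}/flat_fun x0.
  have dV : is_derive x (1 : R) (fun z => z^-1) (- x ^- 2).
    have := is_deriveV (lt0r_neq0 x0) (is_derive_id x 1); rewrite /= => d.
    by apply: is_derive_eq d _; rewrite scaler1.
  have dp : is_derive (x^-1) (1 : R) (horner p) (p^`().[x^-1]).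
    by apply: DeriveDef; [exact: derivable_horner | rewrite derivE derive1E].
  have d1 := is_derive1_comp dp dV.
  have dN : is_derive x (1 : R) (fun z => - z^-1) (- - x ^- 2) by exact: is_deriveN dV.
  have d2 : is_derive x (1 : R) (expR \o (fun z => - z^-1)) (expR (- x^-1) * - - x ^- 2).
    by apply: (@is_derive1_comp _ expR (fun z => - z^-1) x).
  have := is_deriveM d1 d2; rewrite /= => -[h1 h2].
  apply: DeriveDef; first by apply: near_eq_derivable e _; exact: h1.
  rewrite -(near_eq_derive _ e) [LHS]h2 /flat_deriv !hornerE -!exprVn -![_ *: _]/(_ * _).
  by ring.
- have [C C0 HC] := flat_fun_le ('X * p).
  suff H : h^-1 *: (flat_fun p (h *: 1 + 0) - flat_fun p 0) @[h --> 0^'] --> (0 : R).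
    rewrite [X in is_derive _ _ _ X](_ : _ = 0); last by rewrite /flat_fun ltxx.
    by apply: DeriveDef; [apply/cvg_ex; exists 0 | exact/cvg_lim].
  apply/cvgr0Pnorm_le => e e0.
  near=> h.
  have h0 : h != 0 by near: h; exact: nbhs_dnbhs_neq.
  rewrite addr0 [h *: 1]mulr1 {2}/flat_fun ltxx subr0.
  have -> : h^-1 *: flat_fun p h = flat_fun ('X * p) h.
    rewrite /flat_fun; case: ifP => _; last by rewrite scaler0.
    by rewrite hornerM hornerX -mulrA.
  apply: le_trans (HC h) _.
  apply: (@le_trans _ _ ((C + 1) * `|h|)); first by rewrite ler_wpM2r // lerDl.
  rewrite -ler_pdivlMl ?ltr_wpDl //.
  near: h; apply: dnbhs0_le; by rewrite mulr_gt0 // invr_gt0 ltr_wpDl.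
Unshelve. all: by end_near. Qed.

Lemma flat_continuous p : continuous (flat_fun p).
Proof.
by move=> x; have [/derivable1_diffP/differentiable_continuous] := is_derive_flat p x.
Qed.

Lemma flat_fun1_gt0 x : 0 < x -> 0 < flat_fun 1 x.
Proof. by move=> x0; rewrite /flat_fun x0 hornerC mul1r expR_gt0. Qed.

Lemma flat_fun_le0 p x : x <= 0 -> flat_fun p x = 0.
Proof. by move=> x0; rewrite /flat_fun ltNge x0. Qed.

Context {n : nat}.

Lemma Ck_flat k (D : set 'rV[R]_n) (f : 'rV[R]_n -> R) : open D -> Ck k D f ->
  Ck k D (fun y => flat_fun 1 (f y)).
Proof.
move=> oD /jCk_of_Ck jf; apply: (@Ck_of_jCk _ _ _ _ (fun _ y => flat_fun 1 (f y)) 0).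
apply: (@jCk_comp _ _ (fun k => flat_fun (iter k flat_deriv 1)) setT) => //.
by move=> j x _ /=; exact: is_derive_flat.
Qed.

Lemma Ck_opp k (D : set 'rV[R]_n) (f : 'rV[R]_n -> R) : open D -> Ck k D f ->
  Ck k D (fun y => - f y).
Proof.
move=> oD /(Ck_mul oD (Ck_cst k D (-1))); apply: Ck_ext => // y _.
by rewrite mulN1r.
Qed.

End FlatFunctions.

Section SmoothFamilies.
Context {R : realType} {n : nat} {M : manifold R n}.
Implicit Types (U V : set M) (f g : M -> R) (F G : R -> M -> R).

Definition jsmooth_in U F := forall c, atlas c -> forall k,
  jCk k (c @` (U `&` cdom c)) (fun t y => F t (cinv c y)).

Lemma jsmooth_in_of U f : smooth_in U f -> jsmooth_in U (fun _ => f).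
Proof. by move=> sf c ac k; apply: jCk_of_Ck; exact: sf. Qed.

Lemma smooth_in_of U F t : jsmooth_in U F -> smooth_in U (F t).
Proof. by move=> sF c ac k; exact: Ck_of_jCk (sF c ac k). Qed.

Lemma jsmooth_in_ext U F G : open U -> (forall t x, U x -> F t x = G t x) ->
  jsmooth_in U F -> jsmooth_in U G.
Proof.
move=> oU FG sF c ac k; apply: jCk_ext (sF c ac k); first exact: cimg_setI_open.
by move=> t _ [x [Ux cx] <-]; rewrite cmapK //; exact: FG.
Qed.

Lemma jsmooth_in_add U F G : open U -> jsmooth_in U F -> jsmooth_in U G ->
  jsmooth_in U (fun t x => F t x + G t x).
Proof.
by move=> oU sF sG c ac k; apply: jCk_add (sF c ac k) (sG c ac k); exact: cimg_setI_open.
Qed.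

Lemma jsmooth_in_mul U F G : open U -> jsmooth_in U F -> jsmooth_in U G ->
  jsmooth_in U (fun t x => F t x * G t x).
Proof.
by move=> oU sF sG c ac k; apply: jCk_mul (sF c ac k) (sG c ac k); exact: cimg_setI_open.
Qed.

Lemma jsmooth_in_inv U F : open U -> (forall t x, U x -> F t x != 0) ->
  jsmooth_in U F -> jsmooth_in U (fun t x => (F t x)^-1).
Proof.
move=> oU F0 sF c ac k; apply: jCk_inv (sF c ac k); first exact: cimg_setI_open.
by move=> t _ [x [Ux cx] <-]; rewrite cmapK //; exact: F0.
Qed.

Lemma jsmooth_in_time U (phi : R -> R) : continuous phi ->
  jsmooth_in U (fun t _ => phi t).
Proof. by move=> cphi c ac k; exact: (@jCk_time _ _ k _ phi). Qed.

Lemma jsmooth_in_sub U V F : V `<=` U -> jsmooth_in U F -> jsmooth_in V F.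
Proof.
move=> VU sF c ac k; apply: jCk_sub (sF c ac k).
by apply: image_subset => x [/VU].
Qed.

Lemma jsmooth_in_local U F : (forall x, U x -> exists2 V, V x & jsmooth_in V F) ->
  jsmooth_in U F.
Proof.
move=> H c ac k; apply: jCk_local => _ [x [/H[V Vx sF] cx] <-].
by exists (c @` (V `&` cdom c)); [exists x | exact: sF].
Qed.

Lemma smooth_in_local U f : (forall x, U x -> exists2 V, V x & smooth_in V f) ->
  smooth_in U f.
Proof.
move=> H; apply: (@smooth_in_of _ (fun=> f) 0); apply: jsmooth_in_local => x /H[V Vx sf].
by exists V => //; exact: jsmooth_in_of.
Qed.

Lemma smooth_in_subW U V f : V `<=` U -> smooth_in U f -> smooth_in V f.
Proof.
move=> VU sf; apply: (@smooth_in_of _ (fun=> f) 0).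
exact: jsmooth_in_sub VU (jsmooth_in_of sf).
Qed.

Lemma smooth_in_opp U f : open U -> smooth_in U f -> smooth_in U (fun x => - f x).
Proof. by move=> oU sf c ac k; apply: Ck_opp (sf c ac k); exact: cimg_setI_open. Qed.

Lemma smooth_in_flat U f : open U -> smooth_in U f ->
  smooth_in U (fun x => flat_fun 1 (f x)).
Proof. by move=> oU sf c ac k; apply: Ck_flat (sf c ac k); exact: cimg_setI_open. Qed.

Lemma smooth_in_sum (I : Type) (r : seq I) (P : pred I) U (f : I -> M -> R) : open U ->
  (forall i, P i -> smooth_in U (f i)) -> smooth_in U (fun x => \sum_(i <- r | P i) f i x).
Proof.
move=> oU sf; elim: r => [|i r IH].
  by apply: smooth_in_ext (smooth_in_cst U 0) => // x _; rewrite big_nil.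
case Pi : (P i); last by apply: smooth_in_ext IH => // x _; rewrite big_cons Pi.
by apply: smooth_in_ext (smooth_in_add oU (sf i Pi) IH) => // x _; rewrite big_cons Pi.
Qed.

Lemma smooth_in_chart (c : chart R n M) i : atlas c ->
  smooth_in (cdom c) (fun z => c z 0 i).
Proof. by move=> ac d ad; rewrite setIC; exact: atlas_compat. Qed.

Lemma smooth_in_int01 F : jsmooth_in setT F -> smooth_in setT (fun x => int01 (F^~ x)).
Proof.
move=> sF c ac k; apply: (@Ck_int01 _ _ k _ (fun t y => F t (cinv c y))).
  exact: cimg_setI_open openT.
exact: sF.
Qed.

Lemma jsmooth_in_continuous U F x : jsmooth_in U F -> U x -> continuous (F^~ x).
Proof.
move=> sF Ux; have [c ac cx] := @atlas_cover _ _ M x.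
have := @continuous_section _ _ (fun t y => F t (cinv c y)) (c x).
rewrite /= cmapK //; apply=> t.
apply: (@jCk_cont R n 0 _ (fun t y => F t (cinv c y)) t (c x) (sF c ac 0%N)).
by exists x.
Qed.

End SmoothFamilies.

Section Tangent.
Context {R : realType} {n : nat} {M : manifold R n} (x : M).
Implicit Types (v : tangent x) (f g : M -> R).

Lemma chart_at_atlas : atlas (chart_at x).
Proof. by rewrite /chart_at; case: cid2. Qed.

Lemma chart_at_dom : cdom (chart_at x) x.
Proof. by rewrite /chart_at; case: cid2. Qed.

Lemma cinv_chart_at : cinv (chart_at x) (chart_at x x) = x.
Proof. exact: cmapK chart_at_dom. Qed.

Definition smooth_near f := exists2 U : set M, open U /\ U x & smooth_in U f.

Lemma tangent_app_near v f g U : open U -> U x -> (forall z, U z -> f z = g z) ->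
  tangent_app v f = tangent_app v g.
Proof.
move=> oU Ux fg; apply: near_eq_derive.
apply: (@open_near_eq _ _ (chart_at x @` (U `&` cdom (chart_at x)))).
- exact: cimg_setI_open.
- by exists x => //; split=> //; exact: chart_at_dom.
- by move=> _ [z [Uz cz] <-]; rewrite cmapK // fg.
Qed.

Lemma smooth_near_derivable v f : smooth_near f ->
  derivable (fun y => f (cinv (chart_at x) y)) (chart_at x x) v.
Proof.
move=> [U [oU Ux] sf]; have [_ [df _]] := sf _ chart_at_atlas 1%N.
by apply: df; exists x => //; split=> //; exact: chart_at_dom.
Qed.

Lemma tangent_appD v f g : smooth_near f -> smooth_near g ->
  tangent_app v (fun z => f z + g z) = tangent_app v f + tangent_app v g.
Proof.
by move=> /(smooth_near_derivable (v := v)) df /(smooth_near_derivable (v := v)) dg;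
  exact: deriveD df dg.
Qed.

Lemma tangent_appM v f g : smooth_near f -> smooth_near g ->
  tangent_app v (fun z => f z * g z) =
  f x * tangent_app v g + g x * tangent_app v f.
Proof.
move=> /(smooth_near_derivable (v := v)) df /(smooth_near_derivable (v := v)) dg.
by have := deriveM df dg; rewrite /= cinv_chart_at.
Qed.

Lemma tangent_app_cst v (c : R) : tangent_app v (fun _ => c) = 0.
Proof. exact: derive_cst. Qed.

Lemma smooth_near_cst (c : R) : smooth_near (fun _ => c).
Proof. by exists setT; [split=> //; exact: openT | exact: smooth_in_cst]. Qed.

Lemma smooth_nearD f g : smooth_near f -> smooth_near g ->
  smooth_near (fun z => f z + g z).
Proof.
move=> [U [oU Ux] sf] [V [oV Vx] sg]; exists (U `&` V); first by split=> //; exact: openI.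
apply: smooth_in_add; first exact: openI.
  by apply: smooth_in_subW sf => z [].
by apply: smooth_in_subW sg => z [].
Qed.

Lemma smooth_nearM f g : smooth_near f -> smooth_near g ->
  smooth_near (fun z => f z * g z).
Proof.
move=> [U [oU Ux] sf] [V [oV Vx] sg]; exists (U `&` V); first by split=> //; exact: openI.
apply: smooth_in_mul; first exact: openI.
  by apply: smooth_in_subW sf => z [].
by apply: smooth_in_subW sg => z [].
Qed.

Lemma tangent_appZ v (c : R) f : smooth_near f ->
  tangent_app v (fun z => c * f z) = c * tangent_app v f.
Proof.
move=> sf; rewrite tangent_appM //; last exact: smooth_near_cst.
by rewrite tangent_app_cst mulr0 addr0.
Qed.

Lemma tangent_app_int01 v (F : R -> M -> R) : jsmooth_in setT F ->
  tangent_app v (fun z => int01 (F^~ z)) = int01 (fun t => tangent_app v (F t)).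
Proof.
move=> sF; rewrite /tangent_app.
have := @int01_derive_under _ _ _ (fun t y => F t (cinv (chart_at x) y)) (chart_at x x) v.
move=> /(_ _ (@cimg_setI_open _ _ _ setT (chart_at x) openT)).
case=> //; last exact: sF chart_at_atlas 1%N.
by exists x => //; split=> //; exact: chart_at_dom.
Qed.

Lemma tangent_app_continuous v (F : R -> M -> R) : jsmooth_in setT F ->
  continuous (fun t => tangent_app v (F t)).
Proof.
move=> sF; rewrite /tangent_app.
apply: (@continuous_section _ _ (fun t => 'D_v (fun y => F t (cinv (chart_at x) y)))) => t.
have [_ [_ /(_ v) DF]] := sF _ chart_at_atlas 1%N.
apply: (@jCk_cont _ _ 0 _ (fun t => 'D_v (fun y => F t (cinv (chart_at x) y))) _ _ DF).
by exists x => //; split=> //; exact: chart_at_dom.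
Qed.

End Tangent.

Section Bump.
Context {R : realType} {n : nat} {M : manifold R n}.

Lemma chart_preimage_open (c : chart R n M) (D : set 'rV[R]_n) : open D ->
  open (cdom c `&` c @^-1` D).
Proof.
move=> oD; rewrite openE => x [cx Dx]; rewrite /interior.
have := @cmap_cont _ _ _ c; rewrite continuous_open_subspace; last exact: cdom_open.
move=> /(_ x (mem_set cx)) h.
apply: filterI; first by apply: open_nbhs_nbhs; split=> //; exact: cdom_open.
by apply: h; apply: open_nbhs_nbhs.
Qed.

Lemma bump_exists (U : set M) (x : M) : open U -> U x ->
  exists chi : smooth_fun M,
    (exists V : set M, [/\ open V, V x & forall z, V z -> chi z = 1]) /\
    (exists W : set M, [/\ open W, W `|` U = setT & forall z, W z -> chi z = 0]).
Proof.
move=> oU Ux; have [c ac cx] := @atlas_cover _ _ M x.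
have oD := @cimg_setI_open _ _ _ U c oU.
have /nbhs_ballP[e /= e0 He] : nbhs (c x) (c @` (U `&` cdom c)).
  by apply: open_nbhs_nbhs; split=> //; exists x.
pose rho := e / 2.
have rho0 : 0 < rho by rewrite divr_gt0.
pose q (y : 'rV[R]_n) := \sum_i (y 0 i - c x 0 i) ^+ 2.
have cq : continuous q.
  move=> y; apply: (@cvg_big _ _ _ _ _ _ _ (nbhs y)) => [|i _]; first exact: add_continuous.
  have ci : {for y, continuous (fun y : 'rV[R]_n => y 0 i - c x 0 i)}.
    have c1 : {for y, continuous (fun z : 'rV[R]_n => z 0 i)}.
      exact: (@coord_continuous R 1 n 0 i y).
    exact: (cvgB c1 (cvg_cst _)).
  exact: (cvgM ci ci).
have qle y i : q y <= rho ^+ 2 -> `|y 0 i - c x 0 i| <= rho.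
  move=> qy; have rhon : rho \is Num.nneg by rewrite nnegrE ltW.
  rewrite -(@ler_pXn2r _ 2) ?nnegrE ?normr_ge0 // real_normK ?num_real //.
  apply: le_trans qy; rewrite /q (bigD1 i) //= lerDl.
  by apply: sumr_ge0 => j _; exact: sqr_ge0.
have nle (z : 'rV[R]_n) : (forall i, `|z 0 i| <= rho) -> `|z| <= rho.
  move=> zr; rewrite /Num.norm /= mx_normrE; apply/bigmax_leP; split; first exact: ltW.
  by move=> [i j] _ /=; rewrite (ord1 i).
pose K := [set y | q y <= rho ^+ 2].
have KD : K `<=` c @` (U `&` cdom c).
  move=> y Ky; apply: He; rewrite -ball_normE /ball_ /= -normrN opprB.
  apply/(le_lt_trans (y := rho)); last by rewrite /rho ltr_pdivrMr // ltr_pMr // ltr1n.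
  by apply: nle => i; rewrite !mxE; exact: qle.
have cK : compact K.
  apply: bounded_closed_compact.
    exists (`|c x| + rho); split; first exact: num_real.
    move=> b Hb y Ky; apply: le_trans (ltW Hb).
    rewrite -[y](subrK (c x)) addrC (le_trans (ler_normD _ _)) // lerD2l.
    by apply: nle => i; rewrite !mxE; exact: qle.
  exact: (closed_comp (f := q) (D := [set t | t <= rho ^+ 2])).
have clK : closed (cinv c @` K).
  apply: compact_closed; first exact: mspace_hausdorff.
  apply: continuous_compact => //.
  by apply: continuous_subspaceW (@cinv_cont _ _ _ c) => y /KD[z [_ cz] <-]; exists z.
pose W := ~` (cinv c @` K).
pose u y := flat_fun 1 (rho ^+ 2 - q y).
pose beta := u (c x) / 2.
have qcx : q (c x) = 0 by rewrite /q big1 // => i _; rewrite subrr expr0n.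
have beta0 : 0 < beta.
  by rewrite divr_gt0 // /u qcx subr0 flat_fun1_gt0 // exprn_gt0.
pose B y := 1 - flat_fun 1 (beta - u y) / flat_fun 1 beta.
have B0 y : ~ K y -> B y = 0.
  move=> /negP; rewrite -ltNge => qy.
  have -> : B y = 1 - flat_fun 1 (beta - 0) / flat_fun 1 beta.
    by rewrite /B /u [flat_fun 1 (rho ^+ 2 - q y)]flat_fun_le0 // subr_le0 ltW.
  rewrite subr0 divff ?subrr //.
  by rewrite gt_eqF // flat_fun1_gt0.
have B1 y : beta < u y -> B y = 1.
  by move=> uy; rewrite /B flat_fun_le0 ?mul0r ?subr0 // subr_le0 ltW.
pose chi (z : M) := if asbool (cdom c z) then B (c z) else 0.
have chiW z : W z -> chi z = 0.
  move=> Wz; rewrite /chi; case: asboolP => // cz; apply: B0 => Kz.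
  by apply: Wz; exists (c z) => //; rewrite cmapK.
have oW : open W by exact: closed_openC.
have sc : smooth_in (cdom c) chi.
  have oc := cdom_open c.
  apply: (@smooth_in_ext _ _ _ _ (fun z => B (c z))) => //.
    by move=> z cz; rewrite /chi asboolT.
  have sq : smooth_in (cdom c) (fun z => q (c z)).
    apply: smooth_in_sum => // i _.
    have s1 : smooth_in (cdom c) (fun z => c z 0 i - c x 0 i).
      by apply: smooth_in_add => //; [exact: smooth_in_chart | exact: smooth_in_cst].
    exact: smooth_in_mul.
  have su : smooth_in (cdom c) (fun z => u (c z)).
    apply: smooth_in_flat => //; apply: smooth_in_add => //; first exact: smooth_in_cst.
    exact: smooth_in_opp.
  apply: smooth_in_add => //; first exact: smooth_in_cst.
  apply: smooth_in_opp => //; apply: smooth_in_mul => //; last exact: smooth_in_cst.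
  apply: smooth_in_flat => //; apply: smooth_in_add => //; first exact: smooth_in_cst.
  exact: smooth_in_opp.
have WU : W `|` (U `&` cdom c) = setT.
  apply/seteqP; split=> // z _; have [Kz|] := pselect ((cinv c @` K) z); last by left.
  by right; case: Kz => _ /KD[y [Uy cy] <-] <-; rewrite cmapK.
have schi : smooth_in setT chi.
  apply: smooth_in_local => z _; have : (W `|` (U `&` cdom c)) z by rewrite WU.
  case=> [Wz|[_ cz]]; last by exists (cdom c).
  exists W => //; apply: smooth_in_ext (smooth_in_cst W 0) => // w Ww.
  by rewrite chiW.
exists (SmoothFun schi); split; last first.
  exists W; split=> //; apply/seteqP; split=> // z _.
  have : (W `|` (U `&` cdom c)) z by rewrite WU.
  by case=> [|[]]; [left | right].
have cu : continuous u.
  move=> y; have c1 : {for y, continuous (fun y => rho ^+ 2 - q y)}.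
    exact: (cvgB (cvg_cst (rho ^+ 2)) (cq y)).
  exact: (@cvg_comp _ _ _ (fun y => rho ^+ 2 - q y) (flat_fun 1) (nbhs y)
    (nbhs (rho ^+ 2 - q y)) _ c1 (@flat_continuous R 1 _)).
exists (cdom c `&` c @^-1` (u @^-1` [set t | beta < t])); split.
- apply: chart_preimage_open; apply: open_comp; last exact: open_gt.
  by move=> y _; exact: cu.
- split=> //=; rewrite /beta ltr_pdivrMr // ltr_pMr ?ltr1n //.
  by rewrite /u qcx subr0 flat_fun1_gt0 // exprn_gt0.
- by move=> z [cz uz] /=; rewrite /chi asboolT // B1.
Qed.

End Bump.

(** * Matrix calculus in a trivialisation *)

Section FibreMatrices.
Context {R : realType} {n : nat} {M : manifold R n} {r : nat} {E : vbundle M r}.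
Implicit Types (T : local_triv r E) (x : M).

Definition tcol T x (v : E x) : 'cV[R]_r := (tmap T x v)^T.

Lemma tcolE T x (v : E x) i : tcol T v i 0 = tmap T x v 0 i.
Proof. by rewrite mxE. Qed.

Fact tcol_linear T x : linear (tcol T (x := x)).
Proof. by move=> c u v; rewrite /tcol linearP linearD linearZ. Qed.

HB.instance Definition _ T x := GRing.isLinear.Build R (E x) 'cV[R]_r *:%R
  (tcol T (x := x)) (tcol_linear T (x := x)).

Lemma tcolK T x (c : 'cV[R]_r) : tdom T x -> tcol T (tinv T x c^T) = c.
Proof. by move=> Tx; rewrite /tcol tinvK // trmxK. Qed.

Lemma tcol_inj T x : tdom T x -> injective (tcol T (x := x)).
Proof. by move=> Tx u v /trmx_inj /(can_inj (tmapK Tx)). Qed.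

Definition tmx T x (phi : 'End(E x)) : 'M[R]_r :=
  \matrix_(i, j) tmap T x (phi (tinv T x (delta_mx 0 j))) 0 i.

Lemma mulmx_col_inj (A B : 'M[R]_r) : (forall c : 'cV[R]_r, A *m c = B *m c) -> A = B.
Proof.
by move=> AB; apply/matrixP => i j; have /colP/(_ i) := AB (delta_mx j 0); rewrite -!colE !mxE.
Qed.

Lemma tmx_mul T x (phi : 'End(E x)) v : tdom T x ->
  tcol T (phi v) = tmx T phi *m tcol T v.
Proof.
move=> Tx; rewrite -{1}[v](tmapK Tx) (row_sum_delta (tmap T x v)) !linear_sum /=.
apply/colP => i; rewrite mxE summxE; apply: eq_bigr => j _.
by rewrite !linearZ /= !mxE mulrC.
Qed.

Lemma tmx_unique T x (phi : 'End(E x)) A : tdom T x ->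
  (forall v, tcol T (phi v) = A *m tcol T v) -> tmx T phi = A.
Proof.
move=> Tx H; apply: mulmx_col_inj => c.
by rewrite -(tcolK c Tx) -tmx_mul // H.
Qed.

Lemma tmx_comp T x (phi psi : 'End(E x)) : tdom T x ->
  tmx T (phi \o psi)%VF = tmx T phi *m tmx T psi.
Proof.
by move=> Tx; apply: tmx_unique => // v; rewrite comp_lfunE !tmx_mul // mulmxA.
Qed.

Lemma tmx_id T x : tdom T x -> tmx T (\1%VF : 'End(E x)) = 1%:M.
Proof. by move=> Tx; apply: tmx_unique => // v; rewrite id_lfunE mul1mx. Qed.

Lemma tmx_prod T x (I : Type) (s : seq I) (phi : I -> 'End(E x)) : tdom T x ->
  tmx T (\big[(@comp_lfun _ _ _ _) / \1%VF]_(i <- s) phi i) = \prod_(i <- s) tmx T (phi i).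
Proof.
move=> Tx; elim: s => [|i s IH]; first by rewrite !big_nil tmx_id.
by rewrite !big_cons tmx_comp // IH.
Qed.

Lemma lftrace_tmx T x (phi : 'End(E x)) : tdom T x -> lftrace phi = \tr (tmx T phi).
Proof.
move=> Tx; set e := vbasis {: E x}.
have coordE v : v = \sum_i coord e i v *: e`_i by apply: coord_vbasis; exact: memvf.
have mxE1 i : passmx.mxof e e phi i i = coord e i (phi e`_i).
  have := passmx.mul_mxof e e phi (delta_mx 0 i).
  by rewrite -rowE passmx.vecof_delta => /rowP/(_ i); rewrite !mxE.
rewrite /lftrace /mxtrace -/e (eq_bigr _ (fun i _ => mxE1 i)).
have phiE v : phi v = \sum_j tmap T x (phi v) 0 j *: tinv T x (delta_mx 0 j).
  by rewrite -{1}[phi v](tmapK Tx) [X in tinv T x X]row_sum_delta linear_sum;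
    apply: eq_bigr => j _; rewrite linearZ.
transitivity (\sum_(i < \dim {: E x}) \sum_(j < r)
    tmap T x (phi e`_i) 0 j * coord e i (tinv T x (delta_mx 0 j))).
  apply: eq_bigr => i _; rewrite {1}phiE linear_sum; apply: eq_bigr => j _.
  by rewrite linearZ.
rewrite exchange_big; apply: eq_bigr => j _; rewrite mxE.
rewrite [X in _ = tmap T x (phi X) 0 j]coordE !linear_sum summxE; apply: eq_bigr => i _.
by rewrite !linearZ mxE mulrC.
Qed.

End FibreMatrices.

Section ProductRules.
Context {R : realType} {r : nat} {I : eqType}.
Implicit Types (l : seq I) (k : I) (B : I -> 'M[R]_r).

Lemma prod_if_notin l k (X B : I -> 'M[R]_r) : k \notin l ->
  \prod_(i <- l) (if i == k then X i else B i) = \prod_(i <- l) B i.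
Proof.
move=> kl; rewrite !big_seq; apply: eq_bigr => i il.
by rewrite ifF //; apply/negbTE; apply: contraNneq kl => <-.
Qed.

Lemma prod_if_linear l k c (X Y B : I -> 'M[R]_r) : uniq l -> k \in l ->
  \prod_(i <- l) (if i == k then c *: X i + Y i else B i) =
  c *: \prod_(i <- l) (if i == k then X i else B i) +
  \prod_(i <- l) (if i == k then Y i else B i).
Proof.
elim: l => // i l IH /= /andP[il ul]; rewrite inE !big_cons eq_sym.
have [ik _|ik /= kl] := eqVneq i k.
  rewrite -ik (prod_if_notin (fun i => c *: X i + Y i) _ il) !(prod_if_notin _ _ il).
  by rewrite -!mulmxE mulmxDl -scalemxAl.
by rewrite IH // -!mulmxE mulmxDr -scalemxAr.
Qed.

Lemma prod_commutator l (G : 'M[R]_r) B : uniq l ->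
  \sum_(k <- l) \prod_(i <- l) (if i == k then G *m B i - B i *m G else B i) =
  G *m \prod_(i <- l) B i - (\prod_(i <- l) B i) *m G.
Proof.
elim: l => [|i l IH] /=; first by rewrite !big_nil mulmx1 mul1mx subrr.
move=> /andP[il ul]; rewrite !big_cons eqxx (prod_if_notin (fun i => G *m B i - B i *m G) _ il).
have -> : \sum_(k <- l) \prod_(j <- i :: l) (if j == k then G *m B j - B j *m G else B j) =
    B i * \sum_(k <- l) \prod_(j <- l) (if j == k then G *m B j - B j *m G else B j).
  rewrite mulr_sumr !big_seq; apply: eq_bigr => k kl; rewrite big_cons ifF //.
  by apply/negbTE; apply: contraNneq il => ->.
by rewrite IH // mulrBl mulrBr -!mulmxE !mulmxA addrA subrK.
Qed.

End ProductRules.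

Section FunctionAlgebras.
Context {R : realType} {n : nat} {M : manifold R n}.

Record funalg (U : set M) (P : (R -> M -> R) -> Prop) : Prop := FunAlg {
  funalg_ext : forall F G, (forall t x, U x -> F t x = G t x) -> P F -> P G;
  funalg_cst : forall c, P (fun _ _ => c);
  funalg_add : forall F G, P F -> P G -> P (fun t x => F t x + G t x);
  funalg_mul : forall F G, P F -> P G -> P (fun t x => F t x * G t x);
  funalg_inv : forall F, (forall t x, U x -> F t x != 0) -> P F ->
    P (fun t x => (F t x)^-1) }.

Lemma funalg_jsmooth (U : set M) : open U -> funalg U (jsmooth_in U).
Proof.
move=> oU; split.
- by move=> F G; exact: jsmooth_in_ext.
- by move=> c; apply: jsmooth_in_of; exact: smooth_in_cst.
- by move=> F G; exact: jsmooth_in_add.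
- by move=> F G; exact: jsmooth_in_mul.
- by move=> F; exact: jsmooth_in_inv.
Qed.

Lemma funalg_derivable (x : M) :
  funalg [set x] (fun F => forall t, derivable (F^~ x) t 1).
Proof.
split.
- by move=> F G FG dF t; have -> : G^~ x = F^~ x; [apply/funext => s; rewrite FG | exact: dF].
- by move=> c t; exact: derivable_cst.
- by move=> F G dF dG t; exact: derivableD (dF t) (dG t).
- by move=> F G dF dG t; exact: derivableM (dF t) (dG t).
- by move=> F F0 dF t; apply: derivableV => //; exact: F0.
Qed.

Section Closure.
Variables (U : set M) (P : (R -> M -> R) -> Prop) (HP : funalg U P).

Lemma funalg_sum (I : Type) (s : seq I) (Q : pred I) (F : I -> R -> M -> R) :
  (forall i, Q i -> P (F i)) -> P (fun t x => \sum_(i <- s | Q i) F i t x).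
Proof.
move=> PF; elim: s => [|i s IH].
  by apply: (funalg_ext HP) (funalg_cst HP 0) => t x _; rewrite big_nil.
case Qi : (Q i); last by apply: (funalg_ext HP) IH => t x _; rewrite big_cons Qi.
by apply: (funalg_ext HP) (funalg_add HP (PF i Qi) IH) => t x _; rewrite big_cons Qi.
Qed.

Lemma funalg_prod (I : Type) (s : seq I) (Q : pred I) (F : I -> R -> M -> R) :
  (forall i, Q i -> P (F i)) -> P (fun t x => \prod_(i <- s | Q i) F i t x).
Proof.
move=> PF; elim: s => [|i s IH].
  by apply: (funalg_ext HP) (funalg_cst HP 1) => t x _; rewrite big_nil.
case Qi : (Q i); last by apply: (funalg_ext HP) IH => t x _; rewrite big_cons Qi.
by apply: (funalg_ext HP) (funalg_mul HP (PF i Qi) IH) => t x _; rewrite big_cons Qi.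
Qed.

Definition mxfun p q (A : R -> M -> 'M[R]_(p, q)) := forall i j, P (fun t x => A t x i j).

Lemma mxfun_ext p q (A B : R -> M -> 'M[R]_(p, q)) :
  (forall t x, U x -> A t x = B t x) -> mxfun A -> mxfun B.
Proof. by move=> AB PA i j; apply: (funalg_ext HP) (PA i j) => t x Ux; rewrite AB. Qed.

Lemma mxfun_cst p q (A : 'M[R]_(p, q)) : mxfun (fun _ _ => A).
Proof. by move=> i j; exact: (funalg_cst HP). Qed.

Lemma mxfun_mul p q s (A : R -> M -> 'M[R]_(p, q)) (B : R -> M -> 'M[R]_(q, s)) :
  mxfun A -> mxfun B -> mxfun (fun t x => A t x *m B t x).
Proof.
move=> PA PB i j.
apply: (@funalg_ext _ _ HP (fun t x => \sum_k A t x i k * B t x k j)).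
  by move=> t x _; rewrite mxE.
by apply: funalg_sum => k _; apply: (funalg_mul HP); [exact: PA | exact: PB].
Qed.

Lemma mxfun_add p q (A B : R -> M -> 'M[R]_(p, q)) :
  mxfun A -> mxfun B -> mxfun (fun t x => A t x + B t x).
Proof.
move=> PA PB i j; apply: (funalg_ext HP) (funalg_add HP (PA i j) (PB i j)).
by move=> t x _; rewrite mxE.
Qed.

Lemma mxfun_scale p q (f : R -> M -> R) (A : R -> M -> 'M[R]_(p, q)) :
  P f -> mxfun A -> mxfun (fun t x => f t x *: A t x).
Proof.
move=> Pf PA i j; apply: (funalg_ext HP) (funalg_mul HP Pf (PA i j)).
by move=> t x _; rewrite mxE.
Qed.

Lemma mxfun_prod p (I : Type) (s : seq I) (A : I -> R -> M -> 'M[R]_p) :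
  (forall i, mxfun (A i)) -> mxfun (fun t x => \prod_(i <- s) A i t x).
Proof.
move=> PA; elim: s => [|i s IH].
  by apply: mxfun_ext (mxfun_cst 1) => t x _; rewrite big_nil.
by apply: mxfun_ext (mxfun_mul (PA i) IH) => t x _; rewrite big_cons.
Qed.

Lemma funalg_tr p (A : R -> M -> 'M[R]_p) : mxfun A -> P (fun t x => \tr (A t x)).
Proof. by move=> PA; apply: funalg_sum => i _; exact: PA. Qed.

Lemma funalg_det p (A : R -> M -> 'M[R]_p) : mxfun A -> P (fun t x => \det (A t x)).
Proof.
move=> PA; apply: funalg_sum => s _; apply: (funalg_mul HP); first exact: (funalg_cst HP).
by apply: funalg_prod => i _; exact: PA.
Qed.

Lemma mxfun_inv p (A : R -> M -> 'M[R]_p) : (forall t x, U x -> A t x \in unitmx) ->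
  mxfun A -> mxfun (fun t x => invmx (A t x)).
Proof.
move=> uA PA; apply: (@mxfun_ext _ _ (fun t x => (\det (A t x))^-1 *: \adj (A t x))).
  by move=> t x Ux; rewrite /invmx uA.
apply: mxfun_scale.
  apply: (funalg_inv HP); last exact: funalg_det.
  by move=> t x Ux; rewrite -unitfE -unitmxE uA.
move=> i j; apply: (@funalg_ext _ _ HP (fun t x => cofactor (A t x) j i)).
  by move=> t x _; rewrite mxE.
apply: (funalg_mul HP); first exact: (funalg_cst HP).
apply: funalg_det => k l.
by apply: (funalg_ext HP) (PA (lift j k) (lift i l)) => t x _; rewrite !mxE.
Qed.

End Closure.
End FunctionAlgebras.

Record derivation (R : realType) (X : Type) (x : X) (S : (X -> R) -> Prop)
    (d : (X -> R) -> R) : Prop := Derivation {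
  der_smooth_cst : forall c, S (fun _ => c);
  der_smoothD : forall f g, S f -> S g -> S (fun y => f y + g y);
  der_smoothM : forall f g, S f -> S g -> S (fun y => f y * g y);
  der_cst : forall c, d (fun _ => c) = 0;
  derD : forall f g, S f -> S g -> d (fun y => f y + g y) = d f + d g;
  derM : forall f g, S f -> S g -> d (fun y => f y * g y) = f x * d g + g x * d f }.

Section DerivationMatrices.
Context {R : realType} {X : Type} (x : X) (S : (X -> R) -> Prop) (d : (X -> R) -> R).
Hypothesis Hd : derivation x S d.

Definition mder p q (A : X -> 'M[R]_(p, q)) : 'M[R]_(p, q) :=
  \matrix_(i, j) d (fun y => A y i j).

Definition msmooth p q (A : X -> 'M[R]_(p, q)) := forall i j, S (fun y => A y i j).

Lemma der_smooth_sum (I : Type) (s : seq I) (f : I -> X -> R) :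
  (forall i, S (f i)) -> S (fun y => \sum_(i <- s) f i y).
Proof.
move=> Sf; elim: s => [|i s IH].
  have -> : (fun y => \sum_(i <- [::]) f i y) = (fun=> 0).
    by apply/funext => y; rewrite big_nil.
  exact: (der_smooth_cst Hd).
have -> : (fun y => \sum_(j <- i :: s) f j y) = (fun y => f i y + \sum_(j <- s) f j y).
  by apply/funext => y; rewrite big_cons.
exact: (der_smoothD Hd).
Qed.

Lemma der_sum (I : Type) (s : seq I) (f : I -> X -> R) :
  (forall i, S (f i)) -> d (fun y => \sum_(i <- s) f i y) = \sum_(i <- s) d (f i).
Proof.
move=> Sf; elim: s => [|i s IH].
  rewrite [RHS]big_nil -[RHS](der_cst Hd 0); congr d.
  by apply/funext => y; rewrite big_nil.
have -> : (fun y => \sum_(j <- i :: s) f j y) = (fun y => f i y + \sum_(j <- s) f j y).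
  by apply/funext => y; rewrite big_cons.
by rewrite (derD Hd) // ?IH ?big_cons //; exact: der_smooth_sum.
Qed.

Lemma derZ c f : S f -> d (fun y => c * f y) = c * d f.
Proof.
by move=> Sf; rewrite (derM Hd) ?(der_cst Hd) ?mulr0 ?addr0 //; exact: (der_smooth_cst Hd).
Qed.

Lemma msmooth_mul p q s (A : X -> 'M[R]_(p, q)) (B : X -> 'M[R]_(q, s)) :
  msmooth A -> msmooth B -> msmooth (fun y => A y *m B y).
Proof.
move=> sA sB i j; have -> : (fun y => (A y *m B y) i j) = (fun y => \sum_k A y i k * B y k j).
  by apply/funext => y; rewrite mxE.
by apply: der_smooth_sum => k; apply: (der_smoothM Hd); [exact: sA | exact: sB].
Qed.

Lemma mder_mul p q s (A : X -> 'M[R]_(p, q)) (B : X -> 'M[R]_(q, s)) :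
  msmooth A -> msmooth B -> mder (fun y => A y *m B y) = mder A *m B x + A x *m mder B.
Proof.
move=> sA sB; apply/matrixP => i j; rewrite !mxE.
have -> : (fun y => (A y *m B y) i j) = (fun y => \sum_k A y i k * B y k j).
  by apply/funext => y; rewrite mxE.
rewrite der_sum; last by move=> k; apply: (der_smoothM Hd); [exact: sA | exact: sB].
rewrite -big_split; apply: eq_bigr => k _ /=.
by rewrite (derM Hd) ?mxE 1?addrC 1?[B x k j * _]mulrC; [|exact: sA|exact: sB].
Qed.

Lemma mder_tr p q (A : X -> 'M[R]_(p, q)) : mder (fun y => (A y)^T) = (mder A)^T.
Proof.
by apply/matrixP => i j; rewrite !mxE; congr d; apply/funext => y; rewrite mxE.
Qed.

Lemma msmooth_tr p q (A : X -> 'M[R]_(p, q)) : msmooth A -> msmooth (fun y => (A y)^T).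
Proof.
by move=> sA i j; have -> : (fun y => (A y)^T i j) = (fun y => A y j i);
  [apply/funext => y; rewrite mxE | exact: sA].
Qed.

Lemma mderD p q (A B : X -> 'M[R]_(p, q)) : msmooth A -> msmooth B ->
  mder (fun y => A y + B y) = mder A + mder B.
Proof.
move=> sA sB; apply/matrixP => i j; rewrite !mxE -(derD Hd) //.
by congr d; apply/funext => y; rewrite mxE.
Qed.

Lemma msmoothZ p q (c : R) (A : X -> 'M[R]_(p, q)) :
  msmooth A -> msmooth (fun y => c *: A y).
Proof.
move=> sA i j; have -> : (fun y => (c *: A y) i j) = (fun y => c * A y i j).
  by apply/funext => y; rewrite mxE.
by apply: (der_smoothM Hd); [exact: (der_smooth_cst Hd) | exact: sA].
Qed.

Lemma mderZ p q (c : R) (A : X -> 'M[R]_(p, q)) : msmooth A ->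
  mder (fun y => c *: A y) = c *: mder A.
Proof.
move=> sA; apply/matrixP => i j; rewrite !mxE -derZ //.
by congr d; apply/funext => y; rewrite mxE.
Qed.

Lemma msmooth_prod p (I : Type) (s : seq I) (A : I -> X -> 'M[R]_p) :
  (forall i, msmooth (A i)) -> msmooth (fun y => \prod_(i <- s) A i y).
Proof.
move=> sA; elim: s => [|i s IH].
  have -> : (fun y => \prod_(i <- [::]) A i y) = (fun=> 1).
    by apply/funext => y; rewrite big_nil.
  by move=> i j; exact: (der_smooth_cst Hd).
have -> : (fun y => \prod_(j <- i :: s) A j y) = (fun y => A i y *m \prod_(j <- s) A j y).
  by apply/funext => y; rewrite big_cons.
exact: msmooth_mul.
Qed.

Lemma mder_prod p (I : eqType) (s : seq I) (A : I -> X -> 'M[R]_p) :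
  uniq s -> (forall i, msmooth (A i)) ->
  mder (fun y => \prod_(i <- s) A i y) =
  \sum_(k <- s) \prod_(i <- s) (if i == k then mder (A i) else A i x).
Proof.
move=> + sA; elim: s => [|i s IH] /=.
  move=> _; rewrite big_nil; apply/matrixP => i j; rewrite !mxE.
  have -> : (fun y => (\prod_(i <- [::]) A i y) i j) = (fun=> (1 : 'M[R]_p) i j).
    by apply/funext => y; rewrite big_nil.
  exact: (der_cst Hd).
move=> /andP[si us].
have -> : (fun y => \prod_(j <- i :: s) A j y) = (fun y => A i y *m \prod_(j <- s) A j y).
  by apply/funext => y; rewrite big_cons.
rewrite mder_mul //; last exact: msmooth_prod.
rewrite big_cons IH // big_cons eqxx mulmx_sumr; congr (_ + _).
  congr (_ *m _); rewrite !big_seq; apply: eq_bigr => j js.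
  by rewrite ifF //; apply/negbTE; apply: contraNneq si => <-.
rewrite !big_seq; apply: eq_bigr => k ks; rewrite big_cons ifF //.
by apply/negbTE; apply: contraNneq si => ->.
Qed.

Lemma der_smooth_trace p (A : X -> 'M[R]_p) : msmooth A -> S (fun y => \tr (A y)).
Proof. by move=> sA; apply: der_smooth_sum => i; exact: sA. Qed.

Lemma der_trace p (A : X -> 'M[R]_p) : msmooth A -> d (fun y => \tr (A y)) = \tr (mder A).
Proof.
move=> sA; rewrite /mxtrace der_sum; last by move=> i; exact: sA.
by apply: eq_bigr => i _; rewrite mxE.
Qed.

(* The commutators with G add up to the commutator of G with the whole product,
   which has trace zero. *)
Lemma der_trace_prod p m (B : 'I_m -> X -> 'M[R]_p) (G : 'M[R]_p) :
  (forall i, msmooth (B i)) ->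
  d (fun y => \tr (\prod_(i < m) B i y)) =
  \sum_k \tr (\prod_(i < m)
    (if i == k then mder (B i) + (G *m B i x - B i x *m G) else B i x)).
Proof.
move=> sB; rewrite der_trace; last exact: msmooth_prod.
have us := index_enum_uniq 'I_m.
have comm0 : \sum_(k < m) \tr (\prod_(i < m)
    (if i == k then G *m B i x - B i x *m G else B i x)) = 0.
  by rewrite -raddf_sum prod_commutator // raddfB /= mxtrace_mulC subrr.
rewrite mder_prod // raddf_sum /=.
rewrite [RHS](eq_bigr (fun k => \tr (\prod_(i < m) (if i == k then mder (B i) else B i x)) +
    \tr (\prod_(i < m) (if i == k then G *m B i x - B i x *m G else B i x)))).
  by rewrite big_split /= comm0 addr0.
move=> k _; rewrite -linearD /=; congr (\tr _).
have := @prod_if_linear _ _ _ (index_enum 'I_m) k 1 (fun i => mder (B i))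
  (fun i => G *m B i x - B i x *m G) (fun i => B i x) us (mem_index_enum _).
rewrite scale1r => <-; apply: eq_bigr => i _.
by rewrite scale1r.
Qed.

End DerivationMatrices.

Lemma derivation_tangent (R : realType) n (M : manifold R n) (x : M) (v : tangent x) :
  derivation x (smooth_near x) (tangent_app v).
Proof.
split; [exact: smooth_near_cst | exact: smooth_nearD | exact: smooth_nearM |
        exact: tangent_app_cst | exact: tangent_appD | exact: tangent_appM].
Qed.

Lemma derivation_time (R : realType) (t : R) :
  derivation t (fun f : R -> R => derivable f t 1) (fun f => 'D_1 f t).
Proof.
split.
- by move=> c; exact: derivable_cst.
- by move=> f g; exact: derivableD.
- by move=> f g; exact: derivableM.
- by move=> c; exact: derive_cst.
- by move=> f g df dg; exact: deriveD.
- by move=> f g df dg; exact: deriveM.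
Qed.

Notation dmx v := (mder (tangent_app v)).
Notation smx x := (msmooth (smooth_near x)).

Lemma dmx_near (R : realType) n (M : manifold R n) (x : M) (v : tangent x) p q
    (A B : M -> 'M[R]_(p, q)) U : open U -> U x ->
  (forall y, U y -> A y = B y) -> dmx v A = dmx v B.
Proof.
move=> oU Ux AB; apply/matrixP => i j; rewrite !mxE.
by apply: tangent_app_near oU Ux _ => z /AB ->.
Qed.

(** * Metrics and adjoint connections *)

Section LocalFrames.
Context {R : realType} {n : nat} {M : manifold R n} {r : nat} {E : vbundle M r}.
Implicit Types (T : local_triv r E) (x : M) (s : section E).

Lemma section_sum x (I : Type) (l : seq I) (s : I -> section E) :
  (\sum_(i <- l) s i : section E) x = \sum_(i <- l) s i x.
Proof. by elim: l => [|i l IH]; rewrite ?big_nil ?big_cons //= -IH. Qed.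

Lemma sectionDE s t x : (s + t : section E) x = s x + t x.
Proof. by []. Qed.

Lemma sectionZE (c : R) s x : (c *: s : section E) x = c *: s x.
Proof. by []. Qed.

Lemma sectionB s t x : (s - t : section E) x = s x - t x.
Proof.
by apply/eqP; rewrite -(inj_eq (addIr (t x))) -sectionDE !subrK.
Qed.

Lemma smx_tcol T x s : trivs T -> tdom T x -> smx x (fun y => tcol T (s y)).
Proof.
move=> tT Tx i j; exists (tdom T); first by split=> //; exact: tdom_open.
apply: smooth_in_ext (section_smooth s i tT); first exact: tdom_open.
by move=> y _; rewrite mxE (ord1 j).
Qed.

Lemma smooth_cutoff (U W : set M) (chi : smooth_fun M) (f : M -> R) : open U -> open W ->
  W `|` U = setT -> (forall y, W y -> chi y = 0) -> smooth_in U f ->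
  smooth_in setT (fun y => chi y * f y).
Proof.
move=> oU oW WU chi0 sf; apply: smooth_in_local => y _.
have : (W `|` U) y by rewrite WU.
case=> [Wy|Uy].
  exists W => //; apply: smooth_in_ext (smooth_in_cst W 0) => // z Wz.
  by rewrite chi0 ?mul0r.
exists U => //; apply: smooth_in_mul => //.
by apply: smooth_in_subW (sfun_smooth chi).
Qed.

(* The frame of T near x, extended to global sections by a bump function, with the
   coordinates of s in it extended to global functions. *)
Lemma local_frame T x : trivs T -> tdom T x ->
  exists (eps : 'I_r -> section E) (V : set M), [/\ open V, V x, V `<=` tdom T,
    forall y j, V y -> eps j y = tinv T y (delta_mx 0 j) &
    forall s, exists f : 'I_r -> smooth_fun M, forall y j, V y -> f j y = tmap T y (s y) 0 j].
Proof.
move=> tT Tx; have oT := tdom_open T.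
have [chi [[V [oV Vx V1]] [W [oW WT W0]]]] := bump_exists oT Tx.
have VT : V `<=` tdom T.
  move=> y Vy; have : (W `|` tdom T) y by rewrite WT.
  by case=> // /W0; rewrite V1 // => /eqP; rewrite oner_eq0.
have sm j : smooth_section (fun y => chi y *: tinv T y (delta_mx 0 j) : E y).
  move=> S i tS; apply: smooth_in_local => y Sy.
  have : (W `|` tdom T) y by rewrite WT.
  case=> [Wy|Ty].
    exists W => //; apply: smooth_in_ext (smooth_in_cst W 0) => // z Wz.
    by rewrite W0 // scale0r linear0 mxE.
  exists (tdom T `&` tdom S) => //; have oTS := openI oT (tdom_open S).
  apply: (smooth_in_ext oTS _ (smooth_in_mul oTS _ (trivs_compat (delta_mx 0 j) i tT tS))).
    by move=> z _; rewrite linearZ mxE.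
  by apply: smooth_in_subW (sfun_smooth chi).
exists (fun j => Section (sm j)), V; split=> //.
  by move=> y j Vy /=; rewrite V1 // scale1r.
move=> s; exists (fun j => SmoothFun (smooth_cutoff oT oW WT W0 (section_smooth s j tT))).
by move=> y j Vy /=; rewrite V1 // mul1r.
Qed.

Lemma section_through x (v : E x) : exists s, s x = v.
Proof.
have [T tT Tx] := @trivs_cover _ _ _ _ E x.
have [eps [V [oV Vx VT epsE _]]] := local_frame tT Tx.
exists (\sum_j (tmap T x v 0 j) *: eps j); rewrite section_sum.
rewrite -[RHS](tmapK Tx) [X in tinv T x X]row_sum_delta linear_sum.
by apply: eq_bigr => j _; rewrite linearZ sectionZE epsE //.
Qed.

End LocalFrames.

Section LeibnizOperators.
Context {R : realType} {n : nat} {M : manifold R n} {r : nat} {E : vbundle M r}.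
Implicit Types (T : local_triv r E) (x : M) (s t : section E).

Definition leibniz (l : section E -> section E) (X : forall x : M, tangent x) :=
  linear l /\ forall (f : smooth_fun M) s x,
    l (sectionM f s) x = f x *: l s x + vfield_app X f x *: s x.

Variables (l : section E -> section E) (X : forall x : M, tangent x).
Hypothesis lX : leibniz l X.

Lemma leibniz_sub s t : l (s - t) = l s - l t.
Proof.
have [ll _] := lX; have := ll (-1) t s.
by rewrite !scaleN1r (addrC (- t)) (addrC (- l t)).
Qed.

Lemma leibniz_sum (I : Type) (q : seq I) (s : I -> section E) :
  l (\sum_(i <- q) s i) = \sum_(i <- q) l (s i).
Proof.
have l0 : l 0 = 0 by have := leibniz_sub 0 0; rewrite !subrr.
have lD u v : l (u + v) = l u + l v by have [ll _] := lX; have := ll 1 u v; rewrite !scale1r.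
by elim: q => [|i q IH]; rewrite ?big_nil ?big_cons // lD IH.
Qed.

Lemma leibniz_local (V : set M) x s t : open V -> V x -> (forall y, V y -> s y = t y) ->
  l s x = l t x.
Proof.
move=> oV Vx st; apply/eqP; rewrite -subr_eq0 -sectionB -leibniz_sub; apply/eqP.
have [chi [[V' [_ V'x V1]] [W [_ WV W0]]]] := bump_exists oV Vx.
have [ll lM] := lX.
have e : sectionM chi (s - t) = 0.
  apply: section_ext => y; rewrite -[LHS]/(chi y *: (s - t : section E) y) -[RHS]/(0 : E y).
  have : (W `|` V) y by rewrite WV.
  case=> [Wy|Vy]; first by rewrite W0 ?scale0r.
  by rewrite sectionB st // subrr scaler0.
have := lM chi (s - t) x.
rewrite e sectionB (st x) // subrr scaler0 addr0 (V1 x) // scale1r => <-.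
by have := leibniz_sub 0 0; rewrite !subrr => ->.
Qed.

Lemma leibniz_coord T x : trivs T -> tdom T x -> exists Gam : 'M[R]_r, forall s,
  tcol T (l s x) = dmx (X x) (fun y => tcol T (s y)) + Gam *m tcol T (s x).
Proof.
move=> tT Tx; have [eps [V [oV Vx VT epsE coordE]]] := local_frame tT Tx.
exists (\matrix_(i, j) tcol T (l (eps j) x) i 0) => s.
have [f fE] := coordE s.
rewrite (@leibniz_local V x s (\sum_j sectionM (f j) (eps j))) //; last first.
  move=> y Vy; rewrite section_sum /= -[LHS](tmapK (VT _ Vy)) [X in tinv T y X]row_sum_delta.
  by rewrite linear_sum; apply: eq_bigr => j _; rewrite linearZ /= fE // epsE.
rewrite leibniz_sum section_sum linear_sum; apply/colP => i; rewrite summxE.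
rewrite [RHS]mxE [X in _ = _ + X]mxE [X in _ = X + _]mxE.
have -> : tangent_app (X x) (fun y => tcol T (s y) i 0) =
    \sum_j tangent_app (X x) (f j) * (delta_mx 0 j : 'rV[R]_r) 0 i.
  rewrite (bigD1 i) //= mxE !eqxx mulr1 big1 ?addr0.
    by apply: tangent_app_near oV Vx _ => y Vy; rewrite fE // mxE.
  by move=> j ji; rewrite mxE eqxx eq_sym (negbTE ji) mulr0.
rewrite -big_split; apply: eq_bigr => j _ /=.
have [_ lM] := lX; rewrite lM linearD !linearZ [LHS]mxE.
rewrite [X in X + _ = _]mxE [X in _ + X = _]mxE [RHS]addrC [X in _ = X * _ + _]mxE; congr (_ + _).
  by rewrite fE // [tcol T (s x) j 0]tcolE mulrC.
by rewrite epsE // tcolE tinvK.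
Qed.

Lemma leibniz_smooth T x (f : smooth_fun M) : trivs T -> tdom T x -> 'I_r ->
  smooth_near x (fun y => tangent_app (X y) f).
Proof.
move=> tT Tx j; have [eps [V [oV Vx VT epsE _]]] := local_frame tT Tx.
exists V => //; have [_ lM] := lX.
pose c s y := tmap T y (s y) 0 j.
have sc s : smooth_in V (c s) by apply: smooth_in_subW VT (section_smooth s j tT).
have sf : smooth_in V f by apply: smooth_in_subW (sfun_smooth f).
apply: (smooth_in_ext oV _ (smooth_in_add oV (sc (l (sectionM f (eps j))))
  (smooth_in_opp oV (smooth_in_mul oV sf (sc (l (eps j))))))).
move=> y Vy; rewrite /c lM linearD !linearZ !mxE /= epsE // tinvK; last exact: VT.
by rewrite mxE !eqxx mulr1 -[_ *: _]/(_ * _) mulrN addrAC subrr add0r.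
Qed.

End LeibnizOperators.

Section Gram.
Context {R : realType} {n : nat} {M : manifold R n} {r : nat} {E : vbundle M r}.
Implicit Types (T : local_triv r E) (x : M) (s t : section E) (h : metric E).

Definition gram h T x : 'M[R]_r :=
  \matrix_(i, j) h x (tinv T x (delta_mx 0 i)) (tinv T x (delta_mx 0 j)).

Lemma hmet0l h x (w : E x) : h x 0 w = 0.
Proof. by have := hmet_linearl h w (-1) 0 0; rewrite scaler0 addr0 mulN1r addNr. Qed.

Lemma hmet0r h x (w : E x) : h x w 0 = 0.
Proof. by rewrite hmet_sym hmet0l. Qed.

Lemma hmet_suml h x (w : E x) (I : Type) (q : seq I) (v : I -> E x) :
  h x (\sum_(i <- q) v i) w = \sum_(i <- q) h x (v i) w.
Proof.
elim: q => [|i q IH]; first by rewrite !big_nil hmet0l.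
by rewrite !big_cons -{1}[v i]scale1r hmet_linearl IH mul1r.
Qed.

Lemma hmetZl h x (w v : E x) c : h x (c *: v) w = c * h x v w.
Proof. by rewrite -[c *: v]addr0 hmet_linearl hmet0l addr0. Qed.

Lemma hmetDl h x (w u v : E x) : h x (u + v) w = h x u w + h x v w.
Proof. by rewrite -[u]scale1r hmet_linearl mul1r scale1r. Qed.

Lemma hmetDr h x (w u v : E x) : h x w (u + v) = h x w u + h x w v.
Proof. by rewrite !(hmet_sym h w) hmetDl. Qed.

Lemma hmetZr h x (w v : E x) c : h x w (c *: v) = c * h x w v.
Proof. by rewrite !(hmet_sym h w) hmetZl. Qed.

Lemma hmetBl h x (w u v : E x) : h x (u - v) w = h x u w - h x v w.
Proof. by rewrite hmetDl -scaleN1r hmetZl mulN1r. Qed.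

Lemma hmetBr h x (w u v : E x) : h x w (u - v) = h x w u - h x w v.
Proof. by rewrite !(hmet_sym h w) hmetBl. Qed.

Lemma hmet_nondeg h x (u w : E x) : (forall v, h x v u = h x v w) -> u = w.
Proof.
move=> H; apply/eqP; rewrite -subr_eq0; apply/negP => /negP /(hmet_pos h).
suff -> : h x (u - w) (u - w) = 0 by rewrite ltxx.
by rewrite hmetBr H subrr.
Qed.

Lemma hmetE h T x (v w : E x) : tdom T x ->
  h x v w = ((tcol T v)^T *m gram h T x *m tcol T w) 0 0.
Proof.
move=> Tx; rewrite -{1}[v](tmapK Tx) -{1}[w](tmapK Tx).
rewrite (row_sum_delta (tmap T x v)) (row_sum_delta (tmap T x w)) !linear_sum hmet_suml.
rewrite -mulmxA !mxE; apply: eq_bigr => i _; rewrite linearZ hmetZl !mxE; congr (_ * _).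
rewrite hmet_sym hmet_suml; apply: eq_bigr => j _.
by rewrite linearZ hmetZl hmet_sym !mxE mulrC.
Qed.

Lemma gram_unit h T x : tdom T x -> gram h T x \in unitmx.
Proof.
move=> Tx; rewrite -row_free_unit -kermx_eq0; apply/eqP/row_matrixP => i.
rewrite row0; set c := row i _.
have c0 : c *m gram h T x = 0 by apply/sub_kermxP; exact: row_sub.
apply/(can_inj (tinvK Tx)); rewrite linear0; apply: (@hmet_nondeg h) => v.
by rewrite !(hmet_sym h v) !(hmetE h _ _ Tx) /tcol tinvK // trmxK c0 !linear0 !mul0mx.
Qed.

Lemma gram_smooth_in h T : trivs T -> forall i j,
  smooth_in (tdom T) (fun y => gram h T y i j).
Proof.
move=> tT i j; apply: smooth_in_ext (hmet_smooth h (delta_mx 0 i) (delta_mx 0 j) tT).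
  exact: tdom_open.
by move=> y _; rewrite mxE.
Qed.

Lemma smx_gram h T x : trivs T -> tdom T x -> smx x (gram h T).
Proof.
by move=> tT Tx i j; exists (tdom T); [split=> //; exact: tdom_open | exact: gram_smooth_in].
Qed.

Lemma hmet_sec_smooth h s t : smooth_in setT (hmet_sec h s t).
Proof.
apply: smooth_in_local => x _; have [T tT Tx] := @trivs_cover _ _ _ _ E x.
exists (tdom T) => //; have oT := tdom_open T.
apply: (@smooth_in_ext _ _ _ _ (fun y => \sum_i \sum_j
    tmap T y (s y) 0 i * (gram h T y i j * tmap T y (t y) 0 j))) => //.
  move=> y Ty; rewrite /hmet_sec (hmetE h _ _ Ty) -mulmxA !mxE; apply: eq_bigr => i _.
  by rewrite !mxE mulr_sumr; apply: eq_bigr => j _; rewrite !mxE.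
apply: smooth_in_sum => // i _; apply: smooth_in_sum => // j _.
apply: smooth_in_mul => //; first exact: section_smooth.
by apply: smooth_in_mul => //; [exact: gram_smooth_in | exact: section_smooth].
Qed.

Lemma tangent_app_hmet h T x (v : tangent x) s t : trivs T -> tdom T x ->
  tangent_app v (hmet_sec h s t) =
  ((dmx v (fun y => tcol T (s y)))^T *m gram h T x *m tcol T (t x) +
   (tcol T (s x))^T *m (dmx v (gram h T) *m tcol T (t x) +
                        gram h T x *m dmx v (fun y => tcol T (t y)))) 0 0.
Proof.
move=> tT Tx; have ss := smx_tcol s tT Tx; have st := smx_tcol t tT Tx.
have sG := smx_gram h tT Tx; have oT := tdom_open T.
have -> : tangent_app v (hmet_sec h s t) =
   dmx v (fun y => (tcol T (s y))^T *m (gram h T y *m tcol T (t y))) 0 0.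
  rewrite mxE; apply: tangent_app_near oT Tx _ => y Ty.
  by rewrite mulmxA /hmet_sec -hmetE.
have Hd := derivation_tangent v.
rewrite (mder_mul Hd); [|exact: msmooth_tr|exact: (msmooth_mul Hd)].
by rewrite (mder_tr _ (fun y => tcol T (s y))) (mder_mul Hd) // mulmxA.
Qed.

End Gram.

Section Adjoint.
Context {R : realType} {n : nat} {M : manifold R n} {r : nat} {E : vbundle M r}.
Implicit Types (T : local_triv r E) (x : M) (s t : section E).
Variables (h : metric E) (l : section E -> section E) (X : forall x : M, tangent x).
Hypothesis lX : leibniz l X.

Let adjoint_at x t : exists u : E x, forall s,
  vfield_app X (hmet_sec h s t) x = hmet_sec h (l s) t x + h x (s x) u.
Proof.
have [T tT Tx] := @trivs_cover _ _ _ _ E x.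
have [Gam HGam] := leibniz_coord lX tT Tx.
pose G := gram h T x.
pose b := dmx (X x) (gram h T) *m tcol T (t x) + G *m dmx (X x) (fun y => tcol T (t y))
          - Gam^T *m G *m tcol T (t x).
exists (tinv T x (invmx G *m b)^T) => s.
rewrite /vfield_app (tangent_app_hmet _ _ _ _ tT Tx) /hmet_sec !(hmetE h _ _ Tx) tcolK // HGam.
rewrite -/G; set c := tcol T (s x); set d := dmx _ (fun y => tcol T (s y)).
have -> : c^T *m G *m (invmx G *m b) = c^T *m b.
  by rewrite -mulmxA mulKVmx // gram_unit.
have addE (P Q : 'M[R]_1) : P 0 0 + Q 0 0 = (P + Q) 0 0 by rewrite mxE.
rewrite addE; congr (fun_of_matrix _ 0 0).
rewrite [(d + _)^T]linearD /= trmx_mul !mulmxDl -addrA; congr (_ + _).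
by rewrite /b mulmxBr !mulmxA addrC subrK.
Qed.

Lemma adjoint_exists t : exists u : section E, forall s x,
  vfield_app X (hmet_sec h s t) x = hmet_sec h (l s) t x + hmet_sec h s u x.
Proof.
pose u x : E x := projT1 (cid (adjoint_at x t)).
have uP s x : vfield_app X (hmet_sec h s t) x = hmet_sec h (l s) t x + h x (s x) (u x).
  by rewrite /u; case: cid.
suff su : smooth_section u by exists (Section su).
move=> T i tT; apply: smooth_in_local => x Tx.
have [eps [V [oV Vx VT epsE _]]] := local_frame tT Tx.
pose L j y := vfield_app X (hmet_sec h (eps j) t) y - hmet_sec h (l (eps j)) t y.
have sLx j y : V y -> smooth_near y (L j).
  move=> Vy; have sf := hmet_sec_smooth h (eps j) t.
  have [U [oU Uy] sU] := leibniz_smooth lX (SmoothFun sf) tT (VT _ Vy) j.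
  exists U => //; apply: smooth_in_add => //; apply: smooth_in_opp => //.
  by apply: smooth_in_subW (hmet_sec_smooth h (l (eps j)) t).
have sL j : smooth_in V (L j).
  by apply: smooth_in_local => y /(sLx j)[U [_ Uy] sU]; exists U.
exists V => //.
have alg := funalg_jsmooth oV.
have jG : mxfun (jsmooth_in V) (fun _ => gram h T).
  move=> k j; apply: jsmooth_in_of; apply: smooth_in_subW VT _; exact: gram_smooth_in.
have jL : mxfun (jsmooth_in V) (fun _ y => \col_j L j y).
  move=> k j; apply: jsmooth_in_ext (jsmooth_in_of (sL k)) => // _ y _.
  by rewrite mxE.
have uG (tau : R) y : V y -> gram h T y \in unitmx by move=> Vy; apply/gram_unit/VT.
have := mxfun_mul alg (mxfun_inv alg uG jG) jL.
move=> /(_ i 0)/(smooth_in_of 0); apply: smooth_in_ext => // y Vy.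
rewrite -tcolE; congr (fun_of_matrix _ i 0).
apply: (canLR (mulKmx (uG 0 y Vy))); apply/colP => j.
rewrite !mxE [LHS]/L uP addrAC subrr add0r epsE // (hmetE h _ _ (VT _ Vy)).
rewrite /tcol tinvK ?trmxK; last exact: VT.
by rewrite -mulmxA -rowE !mxE; apply: eq_bigr => k _; rewrite !mxE.
Qed.

End Adjoint.

Section AdjointConnection.
Context {R : realType} {n : nat} {M : manifold R n} {rA r : nat}.
Context {A : lie_algebroid M rA} {E : vbundle M r}.
Variables (D : connection A E) (h : metric E).
Implicit Types (x : M) (a b : section A) (s t : section E).

Lemma conn_leibniz a : leibniz (D a) (anchor_sec a).
Proof. by have [ll _] := nabla_cdo D a; have [_ lM] := nabla_symbol D a. Qed.

Local Notation adj := (adjoint_conn D h).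

Lemma adjoint_connP a s t x :
  vfield_app (anchor_sec a) (hmet_sec h s t) x =
  hmet_sec h (D a s) t x + hmet_sec h s (adj a t) x.
Proof.
have [u uP] := adjoint_exists h (conn_leibniz a) t.
rewrite /adjoint_conn; set P := [set u | _].
have /(_ (ex_intro _ u uP))/(_ s x) := @xgetPex _ 0 P; exact.
Qed.

Lemma adjoint_conn_unique a t (u : section E) : (forall s x,
  vfield_app (anchor_sec a) (hmet_sec h s t) x =
  hmet_sec h (D a s) t x + hmet_sec h s u x) -> adj a t = u.
Proof.
move=> uP; apply: section_ext => x; apply: (@hmet_nondeg _ _ _ _ _ h) => v.
have [s <-] := section_through v.
have := uP s x; rewrite adjoint_connP => /addrI; exact.
Qed.

Let near_hmet s t x : smooth_near x (hmet_sec h s t).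
Proof. by exists setT; [split=> //; exact: openT | exact: hmet_sec_smooth]. Qed.

Lemma adjoint_conn_leibniz a : leibniz (adj a) (anchor_sec a).
Proof.
split.
  move=> c t u; apply: adjoint_conn_unique => s x.
  have -> : hmet_sec h s (c *: t + u) = (fun y => c * hmet_sec h s t y + hmet_sec h s u y).
    by apply/funext => y; rewrite /hmet_sec hmetDr hmetZr.
  rewrite /vfield_app tangent_appD //; last by apply: smooth_nearM => //; exact: smooth_near_cst.
  rewrite tangent_appZ // -!/(vfield_app _ _ _) !adjoint_connP /hmet_sec.
  by rewrite !sectionDE !sectionZE !hmetDr !hmetZr; ring.
move=> f t x.
have -> : adj a (sectionM f t) = sectionM f (adj a t) +
    (adj a (sectionM f t) - sectionM f (adj a t)) by rewrite addrC subrK.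
rewrite sectionDE -[sectionM f _ x]/(f x *: adj a t x) sectionB; congr (_ + _).
apply: (@hmet_nondeg _ _ _ _ _ h) => v; have [s <-] := section_through v.
have := adjoint_connP a s (sectionM f t) x.
have -> : hmet_sec h s (sectionM f t) = (fun y => f y * hmet_sec h s t y).
  by apply/funext => y; rewrite /hmet_sec /= hmetZr.
have nf : smooth_near x f by exists setT; [split=> //; exact: openT | exact: sfun_smooth].
rewrite {1}/vfield_app tangent_appM // -!/(vfield_app _ _ _) adjoint_connP /hmet_sec /=.
by rewrite hmetBr !hmetZr => e; lra.
Qed.

Lemma anchor_linear_mul a b (c : R) (f : smooth_fun M) s x :
  vfield_app (anchor_sec (c *: a + b)) f x *: s x =
  (c * vfield_app (anchor_sec a) f x + vfield_app (anchor_sec b) f x) *: s x.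
Proof.
have symb a' : vfield_app (anchor_sec a') f x *: s x = D a' (sectionM f s) x - f x *: D a' s x.
  by have [_ ->] := conn_leibniz a'; rewrite addrAC subrr add0r.
have Dlin s' : D (c *: a + b) s' x = c *: D a s' x + D b s' x.
  by rewrite (nabla_linear D s') sectionDE sectionZE.
rewrite scalerDl -scalerA !symb !Dlin !scalerDr !scalerN !scalerA opprD.
by rewrite [f x * c]mulrC addrACA.
Qed.

Lemma adjoint_conn_linear t : linear (adj^~ t).
Proof.
move=> c a b; apply/eqP; rewrite -subr_eq0; apply/eqP; set w := (_ - _ : section E).
have wP s x : hmet_sec h s w x = vfield_app (anchor_sec (c *: a + b)) (hmet_sec h s t) x -
   (c * vfield_app (anchor_sec a) (hmet_sec h s t) x +
    vfield_app (anchor_sec b) (hmet_sec h s t) x).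
  rewrite !adjoint_connP /w /hmet_sec sectionB !sectionDE sectionZE.
  rewrite hmetBr hmetDr hmetZr (nabla_linear D s).
  rewrite sectionDE sectionZE hmetDl hmetZl.
  ring.
apply: section_ext => x; apply: (@hmet_nondeg _ _ _ _ _ h) => v; have [s <-] := section_through v.
rewrite [RHS](_ : _ = 0); last exact: hmet0r.
rewrite -[LHS]/(hmet_sec h s w x).
have := anchor_linear_mul a b c (SmoothFun (hmet_sec_smooth h s t)) s x.
move=> /eqP; rewrite -subr_eq0 -scalerBl scaler_eq0 => /orP[/eqP <-|/eqP sx0].
  exact: wP.
by rewrite /hmet_sec sx0 hmet0l.
Qed.

Hypothesis flatD : flat D.

Lemma flat_commutator a b s : D a (D b s) - D b (D a s) = D (bracket a b) s.
Proof. by apply/eqP; rewrite -subr_eq0; apply/eqP; exact: flatD. Qed.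

Lemma anchor_bracket_mul a b (f gA gB : smooth_fun M) s x :
  (forall y, gA y = vfield_app (anchor_sec a) f y) ->
  (forall y, gB y = vfield_app (anchor_sec b) f y) ->
  (vfield_app (anchor_sec a) gB x - vfield_app (anchor_sec b) gA x
    - vfield_app (anchor_sec (bracket a b)) f x) *: s x = 0.
Proof.
move=> gAE gBE.
have DM c (g gC : smooth_fun M) : (forall y, gC y = vfield_app (anchor_sec c) g y) ->
    D c (sectionM g s) = sectionM g (D c s) + sectionM gC s.
  move=> gCE; apply: section_ext => y; have [_ ->] := conn_leibniz c.
  by rewrite -gCE.
have DMx c (g : smooth_fun M) s' : D c (sectionM g s') x =
    g x *: D c s' x + vfield_app (anchor_sec c) g x *: s' x by have [_ ->] := conn_leibniz c.
have DD c u v : D c (u + v) x = D c u x + D c v x.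
  by have [ll _] := conn_leibniz c; have := ll 1 u v; rewrite !scale1r => ->.
have := congr1 (fun u : section E => u x) (flat_commutator a b (sectionM f s)).
rewrite sectionB (DM _ _ _ gAE) (DM _ _ _ gBE) !DD !DMx.
have := congr1 (fun u : section E => u x) (flat_commutator a b s).
rewrite sectionB => <-; rewrite gAE gBE scalerBr.
move=> e; rewrite !scalerBl; move: e.
have cancel_id (V : zmodType) (p q u v y z w : V) :
    p + u + (v + y) - (q + v + (u + z)) = p - q + w -> y - z - w = 0.
  rewrite (addrACA p) opprD (addrACA (p + v)) (addrC q) addrKA (addrC u y) addrKA.
  by move=> /addrI ->; rewrite subrr.
exact: cancel_id.
Qed.

Lemma adjoint_conn_flat a b t : adj a (adj b t) - adj b (adj a t) = adj (bracket a b) t.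
Proof.
apply/eqP; rewrite -subr_eq0; apply/eqP; apply: section_ext => x.
have aF (c : section A) s' t' : vfield_app (anchor_sec c) (hmet_sec h s' t') =
   (fun y => hmet_sec h (D c s') t' y + hmet_sec h s' (adj c t') y).
  by apply/funext => y; exact: adjoint_connP.
have smF (c : section A) s' t' : smooth_in setT (vfield_app (anchor_sec c) (hmet_sec h s' t')).
  by rewrite aF; apply: smooth_in_add; [exact: openT | exact: hmet_sec_smooth..].
pose w := adj a (adj b t) - adj b (adj a t) - adj (bracket a b) t.
have wP s' : hmet_sec h s' w x =
    vfield_app (anchor_sec a) (vfield_app (anchor_sec b) (hmet_sec h s' t)) x -
    vfield_app (anchor_sec b) (vfield_app (anchor_sec a) (hmet_sec h s' t)) x -
    vfield_app (anchor_sec (bracket a b)) (hmet_sec h s' t) x.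
  rewrite !aF /vfield_app !tangent_appD // -!/(vfield_app _ _ _) !aF.
  rewrite /w /hmet_sec !sectionB !hmetBr.
  have : h x (D a (D b s') x) (t x) = h x (D b (D a s') x) (t x) + h x (D (bracket a b) s' x) (t x).
    by rewrite -flat_commutator sectionB hmetBl; ring.
  by move=> ->; ring.
have := @anchor_bracket_mul a b (SmoothFun (hmet_sec_smooth h w t))
  (SmoothFun (smF a w t)) (SmoothFun (smF b w t)) w x (fun=> erefl) (fun=> erefl).
move/eqP; rewrite scaler_eq0 => /orP[/eqP e|/eqP//].
have [//|/(hmet_pos h)] := eqVneq (w x) 0.
by have := wP w; rewrite /hmet_sec e => ->; rewrite ltxx.
Qed.

End AdjointConnection.

(** * The Maurer-Cartan form of a metric *)

Section FibreEnd.
Context {R : realType} {n : nat} {M : manifold R n} {r : nat} {E : vbundle M r}.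
Implicit Types (T : local_triv r E) (x : M) (s t : section E).

Lemma fibre_end_unique x (phi psi : 'End(E x)) :
  (forall s, phi (s x) = psi (s x)) -> phi = psi.
Proof.
by move=> H; apply/lfunP => v; have [s <-] := section_through v; exact: H.
Qed.

Lemma fibre_end_eq x (ev' : section E -> E x) (phi : 'End(E x)) :
  (forall s, phi (s x) = ev' s) -> fibre_end (fun s : section E => s x) ev' = phi.
Proof.
move=> H; apply: fibre_end_unique => s; rewrite H /fibre_end.
set P := [set phi | _].
by have /(_ (ex_intro _ phi H))/(_ s) := @xgetPex _ 0 P.
Qed.

Definition endmx T x (B : 'M[R]_r) : 'End(E x) :=
  (tinv T x \o linfun (mulmxr B^T) \o tmap T x)%VF.

Lemma endmxE T x B v : tdom T x -> tcol T (endmx T x B v) = B *m tcol T v.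
Proof.
by move=> Tx; rewrite /endmx !comp_lfunE lfunE /= /tcol tinvK // trmx_mul trmxK.
Qed.

Lemma fibre_endP x (ev' : section E -> E x) T B : tdom T x ->
  (forall s, tcol T (ev' s) = B *m tcol T (s x)) ->
  forall s, fibre_end (fun s : section E => s x) ev' (s x) = ev' s.
Proof.
move=> Tx H s; rewrite (@fibre_end_eq _ _ (endmx T x B)) => [|t]; apply: (tcol_inj Tx);
  by rewrite endmxE // H.
Qed.

End FibreEnd.

Section Theta.
Context {R : realType} {n : nat} {M : manifold R n} {rA r : nat}.
Context {A : lie_algebroid M rA} {E : vbundle M r}.
Variables (D : connection A E) (h : metric E).
Implicit Types (T : local_triv r E) (x : M) (a b : section A) (s : section E).

Local Notation adj := (adjoint_conn D h).

Definition theta a x : 'End(E x) :=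
  fibre_end (fun s : section E => s x) (fun s => (adj a s - D a s) x).

Lemma thetaP a x s : theta a x (s x) = (adj a s - D a s) x.
Proof.
have [T tT Tx] := @trivs_cover _ _ _ _ E x.
have [G0 HG0] := leibniz_coord (conn_leibniz D a) tT Tx.
have [G1 HG1] := leibniz_coord (adjoint_conn_leibniz D h a) tT Tx.
apply: (@fibre_endP _ _ _ _ _ _ _ T (G1 - G0)) => // t.
by rewrite sectionB linearB /= HG0 HG1 opprD addrACA subrr add0r mulmxBl.
Qed.

Lemma theta_linear x : linear (theta^~ x).
Proof.
move=> c a b; apply: fibre_end_unique => s.
rewrite add_lfunE scale_lfunE !thetaP !sectionB.
rewrite (nabla_linear D s) (adjoint_conn_linear D h s) !sectionDE !sectionZE.
by rewrite scalerBr opprD addrACA.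
Qed.

Lemma tcol_theta T a x s : tdom T x ->
  tcol T ((adj a s - D a s) x) = tmx T (theta a x) *m tcol T (s x).
Proof. by move=> Tx; rewrite -thetaP tmx_mul. Qed.

Lemma theta_smooth_in T a i j : trivs T ->
  smooth_in (tdom T) (fun y => tmx T (theta a y) i j).
Proof.
move=> tT; apply: smooth_in_local => x Tx.
have [eps [V [oV Vx VT epsE _]]] := local_frame tT Tx; exists V => //.
apply: smooth_in_ext (smooth_in_subW VT (section_smooth (adj a (eps j) - D a (eps j)) i tT)) => //.
by move=> y Vy; rewrite mxE -epsE // thetaP.
Qed.

Lemma smx_theta T a x : trivs T -> tdom T x -> smx x (fun y => tmx T (theta a y)).
Proof.
move=> tT Tx i j; exists (tdom T); first by split=> //; exact: tdom_open.
exact: theta_smooth_in.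
Qed.

Lemma gram_theta T x a (Gam : 'M[R]_r) : trivs T -> tdom T x ->
  (forall s, tcol T (D a s x) = dmx (anchor (a x)) (fun y => tcol T (s y)) + Gam *m tcol T (s x)) ->
  dmx (anchor (a x)) (gram h T) =
    Gam^T *m gram h T x + gram h T x *m Gam + gram h T x *m tmx T (theta a x).
Proof.
move=> tT Tx HG; set G := gram h T x; set dG := dmx _ (gram h T).
apply: mulmx_col_inj => c; apply: (can_inj (@trmxK _ _ _)); apply/eqP; rewrite -subr_eq0.
have bil (B : 'M[R]_r) : (forall s t : section E, (tcol T (s x))^T *m B *m tcol T (t x) = 0) ->
   forall c : 'cV[R]_r, B *m c = 0.
  move=> H d; apply/colP => i.
  have [s sE] := section_through (tinv T x (delta_mx i 0 : 'cV[R]_r)^T).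
  have [t tE] := section_through (tinv T x d^T).
  have := H s t; rewrite sE tE !tcolK // trmx_delta -mulmxA -rowE => /rowP/(_ 0).
  by rewrite !mxE.
rewrite -linearB -mulmxBl /= bil ?linear0 // => s t.
have addE (P Q : 'M[R]_1) : P 0 0 + Q 0 0 = (P + Q) 0 0 by rewrite mxE.
have := adjoint_connP D h a s t x.
have adjE : tcol T (adj a t x) = tcol T (D a t x) + tmx T (theta a x) *m tcol T (t x).
  by rewrite -tcol_theta // -linearD sectionB addrC subrK.
rewrite /vfield_app (tangent_app_hmet _ _ _ _ tT Tx) /hmet_sec !(hmetE h _ _ Tx) adjE !HG.
rewrite addE; set cs := tcol T (s x); set ct := tcol T (t x).
set ds := dmx _ (fun y => tcol T (s y)); set dt := dmx _ (fun y => tcol T (t y)).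
have mx11 (P Q : 'M[R]_1) : P 0 0 = Q 0 0 -> P = Q.
  by move=> PQ; apply/matrixP => i j; rewrite !ord1.
move=> /mx11 e; rewrite [(ds + _)^T]linearD /= trmx_mul !(mulmxDl, mulmxDr) !mulmxA -!addrA in e.
have {}e := @addrI _ _ _ _ e.
rewrite mulmxBr mulmxBl !(mulmxDr, mulmxDl) !mulmxA; apply/eqP; rewrite subr_eq0; apply/eqP.
apply: (@addIr _ (cs^T *m G *m dt)); rewrite e -!addrA; congr (_ + _).
by rewrite addrC -addrA.
Qed.

Section Flat.
Hypothesis flatD : flat D.
Variables (T : local_triv r E) (x : M) (tT : trivs T) (Tx : tdom T x).
Variable Gam : section A -> 'M[R]_r.
Hypothesis HGam : forall a s,
  tcol T (D a s x) = dmx (anchor (a x)) (fun y => tcol T (s y)) + Gam a *m tcol T (s x).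

Definition dtheta a b : 'M[R]_r :=
  dmx (anchor (a x)) (fun y => tmx T (theta b y)) +
  (Gam a *m tmx T (theta b x) - tmx T (theta b x) *m Gam a).

Lemma dthetaP a b s : tcol T (D a (adj b s - D b s) x) -
  tmx T (theta b x) *m tcol T (D a s x) = dtheta a b *m tcol T (s x).
Proof.
have e : dmx (anchor (a x)) (fun y => tcol T ((adj b s - D b s) y)) =
    dmx (anchor (a x)) (fun y => tmx T (theta b y) *m tcol T (s y)).
  by apply: dmx_near (tdom_open T) Tx _ => y Ty; rewrite tcol_theta.
rewrite !HGam e (mder_mul (derivation_tangent _)); [|exact: smx_theta|exact: smx_tcol].
rewrite tcol_theta // /dtheta !(mulmxDl, mulmxDr) mulNmx !mulmxA opprD.
by rewrite [X in X + _]addrAC !addrA addrK.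
Qed.

Lemma theta_maurer_cartan a b :
  dtheta a b - dtheta b a - tmx T (theta (bracket a b) x) =
  - (tmx T (theta a x) *m tmx T (theta b x) - tmx T (theta b x) *m tmx T (theta a x)).
Proof.
apply: mulmx_col_inj => c; have [s sE] := section_through (tinv T x c^T).
have {}sE : c = tcol T (s x) by rewrite sE tcolK.
have DB a' u v : D a' (u - v) = D a' u - D a' v by exact: leibniz_sub (conn_leibniz D a') u v.
have adjB a' u v : adj a' (u - v) = adj a' u - adj a' v.
  exact: leibniz_sub (adjoint_conn_leibniz D h a') u v.
rewrite {}sE !(mulmxBl, mulNmx) -!dthetaP -!mulmxA -!tmx_mul // !thetaP !DB !adjB.
rewrite -(adjoint_conn_flat h flatD) -(flat_commutator flatD).
rewrite !sectionB !linearB /=; apply/colP => i; rewrite !mxE.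
by ring.
Qed.

End Flat.

End Theta.

Section TraceForms.
Context {R : realType} {n : nat} {M : manifold R n} {r : nat} {E : vbundle M r}.
Implicit Types (T : local_triv r E) (x : M).

Definition trace_form (V : vectType R) (L : Type) (phi : L -> 'End(V)) m (a : 'I_m -> L) : R :=
  altsum (fun s : 'S_m =>
    lftrace (\big[(@comp_lfun _ _ _ _) / \1%VF]_(i < m) phi (a (s i)))).

Lemma trace_formE T x (L : Type) (phi : L -> 'End(E x)) m (a : 'I_m -> L) : tdom T x ->
  trace_form phi a = altsum (fun s : 'S_m => \tr (\prod_(i < m) tmx T (phi (a (s i))))).
Proof.
by move=> Tx; apply: eq_altsum => s; rewrite (lftrace_tmx _ Tx) tmx_prod.
Qed.

Lemma trace_form_perm (V : vectType R) (L : Type) (phi : L -> 'End(V)) m (a : 'I_m -> L)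
  (tau : 'S_m) : trace_form phi (a \o tau) = (-1) ^+ tau * trace_form phi a.
Proof.
rewrite /trace_form [in RHS](altsum_mulr tau) mulrA -signr_addb addbb mul1r.
apply: eq_altsum => s; congr lftrace; apply: eq_bigr => i _.
by rewrite permM.
Qed.

Lemma tmx_linear T x : linear (tmx T (x := x)).
Proof.
move=> c phi psi; apply/matrixP => i j.
by rewrite !mxE add_lfunE scale_lfunE linearP !mxE.
Qed.

Lemma trace_form_linear x (L : lmodType R) (phi : L -> 'End(E x)) m (a : 'I_m -> L)
    i c u v : linear phi ->
  trace_form phi [eta a with i |-> c *: u + v] =
  c * trace_form phi [eta a with i |-> u] + trace_form phi [eta a with i |-> v].
Proof.
move=> lphi; have [T tT Tx] := @trivs_cover _ _ _ _ E x.
rewrite !(trace_formE _ _ Tx) -altsumZ -altsumD; apply: eq_altsum => s.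
pose k := (s^-1 i)%g.
have e w : \prod_(j < m) tmx T (phi ([eta a with i |-> w] (s j))) =
    \prod_(j < m) (if j == k then tmx T (phi w) else tmx T (phi (a (s j)))).
  apply: eq_bigr => j _; rewrite /= /k -[j == _](inj_eq (@perm_inj _ s)) permKV.
  by case: eqP.
rewrite !e lphi tmx_linear (prod_if_linear _ (fun=> tmx T (phi u)) (fun=> tmx T (phi v))).
- by rewrite linearP.
- exact: index_enum_uniq.
- exact: mem_index_enum.
Qed.

End TraceForms.

Lemma bracketC (R : realType) (n : nat) (M : manifold R n) (rA : nat)
    (A : lie_algebroid M rA) (a b : section A) : bracket b a = - bracket a b.
Proof.
have := bracket_alt (a + b).
have bDr (u v w : section A) : bracket u (v + w) = bracket u v + bracket u w.
  by have := @bracket_linearr _ _ _ _ _ u 1 v w; rewrite !scale1r.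
have bDl (u v w : section A) : bracket (v + w) u = bracket v u + bracket w u.
  by have := @bracket_linearl _ _ _ _ _ u 1 v w; rewrite !scale1r.
rewrite bDr !bDl !bracket_alt add0r addr0 => e.
by apply/eqP; rewrite -addr_eq0 e.
Qed.

Section EtaForm.
Context {R : realType} {n : nat} {M : manifold R n} {rA r : nat}.
Context {A : lie_algebroid M rA} {E : vbundle M r}.
Variables (D : connection A E) (h : metric E).
Implicit Types (T : local_triv r E) (x : M) (a b : section A) (s : section E).

Definition eta_form m : Defs.form A m :=
  fun (u : 'I_m -> section A) x => trace_form (fun b => theta D h b x) u.

Lemma eta_formE T m (a : 'I_m -> section A) x : tdom T x ->
  eta_form a x = \sum_(s : 'S_m) (-1) ^+ s * \tr (\prod_(i < m) tmx T (theta D h (a (s i)) x)).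
Proof. by move=> Tx; rewrite /eta_form (trace_formE _ _ Tx). Qed.

Lemma alt_eta_form m : alt_form (eta_form (m := m)).
Proof.
split.
- move=> a; apply: smooth_in_local => x _; have [T tT Tx] := @trivs_cover _ _ _ _ E x.
  exists (tdom T) => //; have oT := tdom_open T.
  apply: (smooth_in_ext oT (fun y Ty => esym (eta_formE a Ty))).
  apply: smooth_in_sum => // s _; apply: smooth_in_mul => //; first exact: smooth_in_cst.
  apply: (@smooth_in_of _ _ _ _ (fun _ y => \tr (\prod_(i < m) tmx T (theta D h (a (s i)) y))) 0).
  apply: (funalg_tr (funalg_jsmooth oT)); apply: (mxfun_prod (funalg_jsmooth oT)) => i j k.
  by apply: jsmooth_in_of; exact: theta_smooth_in.
- by move=> a i c u v x; apply: trace_form_linear; exact: theta_linear.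
- by move=> a tau x; exact: trace_form_perm.
Qed.

Hypothesis flatD : flat D.

Lemma tangent_app_eta T x (G : 'M[R]_r) m (v : tangent x) (u : 'I_m -> section A) :
  trivs T -> tdom T x ->
  tangent_app v (eta_form u) = altsum (fun s : 'S_m => \sum_k \tr (\prod_(i < m)
    (if i == k then dmx v (fun y => tmx T (theta D h (u (s i)) y)) +
       (G *m tmx T (theta D h (u (s i)) x) - tmx T (theta D h (u (s i)) x) *m G)
     else tmx T (theta D h (u (s i)) x)))).
Proof.
move=> tT Tx; have sm (s : 'S_m) i := smx_theta D h (u (s i)) tT Tx.
rewrite (tangent_app_near _ (tdom_open T) Tx (fun y => @eta_formE T m u y)).
have Hd := derivation_tangent v.
have sP (s : 'S_m) : smooth_near x (fun y => \tr (\prod_(i < m) tmx T (theta D h (u (s i)) y))).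
  exact/(der_smooth_trace Hd)/(msmooth_prod Hd).
rewrite (der_sum Hd) => [|s]; last by apply: smooth_nearM => //; exact: smooth_near_cst.
by apply: eq_bigr => s _; rewrite (derZ Hd) // (der_trace_prod Hd G).
Qed.

Lemma dform_eta q (u : 'I_q.+2 -> section A) x : ~~ odd q ->
  dform (eta_form (m := q.+1)) u x = 0.
Proof.
move=> oq; have [T tT Tx] := @trivs_cover _ _ _ _ E x.
have /choice[Gam HGam] : forall a : section A, exists G : 'M[R]_r, forall s : section E,
    tcol T (D a s x) = dmx (anchor (a x)) (fun y => tcol T (s y)) + G *m tcol T (s x).
  by move=> b; exact: (leibniz_coord (conn_leibniz D b) tT Tx).
rewrite -(@altsum_maurer_cartan _ _ mxtrace (@mxtrace_mulC _ _ _) q oq _ (@bracket _ _ _ _ A)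
  (fun b => tmx T (theta D h b x)) (dtheta D h T x Gam) _ _ 0 u).
- rewrite /dform; congr (_ + _).
    apply: eq_bigr => i _; congr (_ * _).
    exact: (tangent_app_eta (Gam (u i))).
  apply: eq_bigr => i _; apply: eq_bigr => j _; congr (_ * _).
  by rewrite (eta_formE _ Tx).
- move=> b c; rewrite bracketC (linear_mapN _ (theta_linear D h x)).
  exact: linear_mapN (@tmx_linear _ _ _ _ E T x).
- by move=> b c; exact: theta_maurer_cartan.
Qed.

End EtaForm.

(** * The Chern-Simons form *)

Section ChernSimonsForm.
Context {R : realType} {n : nat} {M : manifold R n} {rA r : nat}.
Context {A : lie_algebroid M rA} {E : vbundle M r}.
Variables (D : connection A E) (h : metric E).
Implicit Types (T : local_triv r E) (x : M) (a b : section A) (s : section E).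

Local Notation adj := (adjoint_conn D h).
Local Notation aff := (aff_conn D adj).

Lemma section_of_eq (f : forall x, E x) s : (forall x, f x = s x) -> section_of f = s.
Proof.
move=> fs; rewrite /section_of; case: pselect => [sf|nsf].
  by apply: section_ext => x /=.
exfalso; apply: nsf; have -> : f = Defs.sval s by exact: functional_extensionality_dep.
exact: section_smooth.
Qed.

Lemma fibre_derive_affine (V : vectType R) (p q : V) t :
  fibre_derive (fun u => (1 - u) *: p + u *: q) t = q - p.
Proof.
rewrite /fibre_derive [RHS](coord_vbasis (memvf _)); apply: eq_bigr => i _; congr (_ *: _).
rewrite derive1E; set f := (fun u : R => _).
have -> : f = (fun u => coord (vbasis {:V}) i p +
    u * (coord (vbasis {:V}) i q - coord (vbasis {:V}) i p)).
  by apply/funext => u; rewrite /f linearD !linearZ /=; ring.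
have d1 := @is_derive_cst R R R (coord (vbasis {:V}) i p) t 1.
have d2 := @is_deriveM _ _ id (cst (coord (vbasis {:V}) i q - coord (vbasis {:V}) i p)) t 1 1 0
  (is_derive_id _ _) (is_derive_cst _ _ _).
have := is_deriveD d1 d2 => d3.
have -> := @derive_val _ _ _ _ _ _ _ d3.
by rewrite linearB /= scaler0 !add0r -[_ *: _]/(_ * _) mulr1.
Qed.

Lemma family_derive_affine s t tau :
  family_derive (fun u => (1 - u) *: s + u *: t) tau = t - s.
Proof.
apply: section_of_eq => x; rewrite sectionB -[RHS](fibre_derive_affine (s x) (t x) tau).
by [].
Qed.

Hypothesis flatD : flat D.

Lemma aff_curvature u v s t x :
  curvature (@product_bracket _ _ _ _ A) aff u v (fun _ => s) t x =
  (u.1 *: theta D h v.2 x - v.1 *: theta D h u.2 x +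
   (t ^+ 2 - t) *: ((theta D h u.2 x \o theta D h v.2 x)%VF -
                    (theta D h v.2 x \o theta D h u.2 x)%VF)) (s x).
Proof.
have affC w : aff w (fun _ => s) = (fun tau => (1 - tau) *: D w.2 s + tau *: adj w.2 s).
  apply/funext => tau; rewrite /aff_conn.
  have -> : family_derive (fun _ : R => s) tau = 0.
    apply: section_of_eq => y; rewrite /fibre_derive big1 // => i _.
    by rewrite derive1E derive_cst scale0r.
  by rewrite scaler0 add0r.
have aff2 w z : aff w (fun tau => (1 - tau) *: D z.2 s + tau *: adj z.2 s) t =
    w.1 *: (adj z.2 s - D z.2 s) +
    ((1 - t) *: ((1 - t) *: D w.2 (D z.2 s) + t *: D w.2 (adj z.2 s)) +
     t *: ((1 - t) *: adj w.2 (D z.2 s) + t *: adj w.2 (adj z.2 s))).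
  have [lD _] := conn_leibniz D w.2; have [ladj _] := adjoint_conn_leibniz D h w.2.
  have D0 : D w.2 0 = 0 by exact: linear_map0 lD.
  have adj0 : adj w.2 0 = 0 by exact: linear_map0 ladj.
  have DZ c p : D w.2 (c *: p) = c *: D w.2 p by rewrite -[c *: p]addr0 lD D0 addr0.
  have adjZ c p : adj w.2 (c *: p) = c *: adj w.2 p by rewrite -[c *: p]addr0 ladj adj0 addr0.
  by rewrite /aff_conn family_derive_affine lD ladj DZ adjZ.
rewrite -[LHS]/((aff u (aff v (fun _ => s)) t - aff v (aff u (fun _ => s)) t -
  aff (product_bracket u v) (fun _ => s) t) x) !affC !aff2 /=.
rewrite -(adjoint_conn_flat h flatD) -(flat_commutator flatD).
rewrite !(add_lfunE, scale_lfunE, opp_lfunE, comp_lfunE) !thetaP.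
have DB a' p q : D a' (p - q) = D a' p - D a' q by exact: leibniz_sub (conn_leibniz D a') p q.
have adjB a' p q : adj a' (p - q) = adj a' p - adj a' q.
  exact: leibniz_sub (adjoint_conn_leibniz D h a') p q.
rewrite !DB !adjB; have [T tT Tx] := @trivs_cover _ _ _ _ E x.
apply: (tcol_inj Tx); rewrite !(sectionB, sectionDE, sectionZE).
have tB v1 v2 : tcol T (x := x) (v1 - v2) = tcol T v1 - tcol T v2 by rewrite linearB.
have tD v1 v2 : tcol T (x := x) (v1 + v2) = tcol T v1 + tcol T v2 by rewrite linearD.
have tZ c v1 : tcol T (x := x) (c *: v1) = c *: tcol T v1 by rewrite linearZ.
have tN v1 : tcol T (x := x) (- v1) = - tcol T v1 by rewrite linearN.
rewrite !(tB, tD, tN, tZ); apply/colP => i; rewrite !mxE.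
by ring.
Qed.

Let kap (tau : R) q (th : 'I_q.*2.+1 -> 'M[R]_r) (i j : 'I_q.*2.+2) : 'M[R]_r :=
  match unlift ord0 i, unlift ord0 j with
  | None, Some j => th j | Some i, Some j => (tau ^+ 2 - tau)%:M * (th i * th j) | _, None => 0 end.

Lemma chern_aff_eta q (a : 'I_q.*2.+1 -> section A) t x :
  chern_aff D adj (fun i : 'I_q.+1.*2 =>
    nth 0 ((1, 0) :: [seq (0, a k) | k <- enum 'I_q.*2.+1]) i : R * section A) t x =
  q.+1%:R * (t ^+ 2 - t) ^+ q * eta_form D h a x.
Proof.
have [T tT Tx] := @trivs_cover _ _ _ _ E x.
pose u (i : 'I_q.+1.*2) : R * section A :=
  nth 0 ((1, 0) :: [seq (0, a k) | k <- enum 'I_q.*2.+1]) i.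
pose th k := tmx T (theta D h (a k) x).
have u0 : u (ord0 : 'I_q.*2.+2) = (1, 0) by [].
have uS (k : 'I_q.*2.+1) : u (lift ord0 k : 'I_q.*2.+2) = (0, a k).
  by rewrite /u lift0 /= (nth_map k) ?size_enum_ord // nth_ord_enum.
have th0 : theta D h 0 x = 0.
  exact: (linear_map0 (theta_linear D h x)).
have tD := @tmx_linear _ _ _ _ E T x.
have tmxD phi psi : tmx T (x := x) (phi + psi) = tmx T phi + tmx T psi.
  by rewrite -[phi]scale1r tD !scale1r.
have tmx0 : tmx T (x := x) 0 = 0.
  exact: linear_map0 tD.
have tmxZ c phi : tmx T (x := x) (c *: phi) = c *: tmx T phi.
  by rewrite -[c *: phi]addr0 tD tmx0 addr0.
have tmxB phi psi : tmx T (x := x) (phi - psi) = tmx T phi - tmx T psi.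
  by rewrite -scaleN1r tmxD tmxZ scaleN1r.
have KE (i j : 'I_q.*2.+2) : tmx T (fibre_end (fun s : section E => s x)
     (fun s => curvature (@product_bracket _ _ _ _ A) aff (u i) (u j) (fun _ => s) t x)) =
   kap t th i j - kap t th j i.
  rewrite (@fibre_end_eq _ _ _ _ _ _ _ _ (fun s => esym (aff_curvature (u i) (u j) s t x))).
  rewrite tmxD tmxB !tmxZ tmxB !tmx_comp // /kap.
  case: (unliftP ord0 i) => [i'|] ->; case: (unliftP ord0 j) => [j'|] ->; rewrite ?u0 ?uS /= ?th0;
    rewrite ?scale0r ?scale1r ?tmx0 ?(mulmx0, mul0mx, subr0, oppr0, scaler0, addr0, add0r) //.
  by rewrite -mulrBr -mul_scalar_mx.
have e : chern_aff D adj u t x = (2 ^+ q.+1)^-1 * altsum (fun s : 'S_q.+1.*2 =>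
    \tr (\prod_(k < q.+1) (kap t th (s (ord_double k)) (s (ord_doubleS k)) -
                          kap t th (s (ord_doubleS k)) (s (ord_double k))))).
  rewrite /chern_aff /chern /curvature_power (lftrace_tmx _ Tx) tmxZ mxtraceZ; congr (_ * _).
  rewrite (big_morph _ tmxD tmx0) raddf_sum; apply: eq_bigr => s _.
  rewrite tmxZ tmx_prod // -[LHS]/(\tr (_ *: _)) mxtraceZ; congr (_ * \tr _); apply: eq_bigr => k _.
  exact: KE.
rewrite e (@altsum_antisym _ _ mxtrace q.+1 (kap t th)) mulKf ?expf_neq0 ?pnatr_eq0 //.
have cC (B : 'M[R]_r) : (t ^+ 2 - t)%:M * B = B * (t ^+ 2 - t)%:M by rewrite -!mulmxE scalar_mxC.
rewrite (@altsum_chern _ _ mxtrace q _ th cC) -mulrA; congr (_ * _).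
rewrite /eta_form (trace_formE _ _ Tx) -altsumZ; apply: eq_altsum => s.
have cX (c : R) m (B : 'M[R]_r) : c%:M ^+ m * B = c ^+ m *: B.
  elim: m => [|m IH]; first by rewrite !expr0 mul1r scale1r.
  by rewrite !exprS -[LHS]mulrA IH -[LHS]/(_ *m _) mul_scalar_mx scalerA.
by rewrite cX -[LHS]/(\tr (_ *: _)) mxtraceZ.
Qed.

End ChernSimonsForm.

Lemma chern_simons_eta (R : realType) (n : nat) (M : manifold R n) (rA r : nat)
    (A : lie_algebroid M rA) (E : vbundle M r) (D : connection A E) (q : nat) : flat D ->
  exists C : R, forall (h : Defs.metric E) (a : 'I_q.*2.+1 -> section A) x,
    chern_simons q.+1 D (adjoint_conn D h) a x = C * eta_form D h a x.
Proof.
move=> flatD; pose k (t : R) := q.+1%:R * (t ^+ 2 - t) ^+ q.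
have ck : continuous k.
  have -> : k = horner (q.+1%:R *: ('X^2 - 'X) ^+ q).
    by apply/funext => t; rewrite /k !hornerE.
  exact: continuous_horner.
exists (int01 k) => h a x; rewrite mulrC -int01Z //.
rewrite /chern_simons /int01; apply: eq_Rintegral => t _.
by rewrite (chern_aff_eta h flatD a t x) mulrC.
Qed.

(** * Homotopy between two metrics *)

Section MetricPath.
Context {R : realType} {n : nat} {M : manifold R n} {r : nat} {E : vbundle M r}.
Implicit Types (T : local_triv r E) (x : M) (t : R).

Lemma metric_ext (h h' : Defs.metric E) : (forall x (v w : E x), h x v w = h' x v w) -> h = h'.
Proof.
case: h h' => [h h1 h2 h3 h4] [h' h1' h2' h3' h4'] /= hh'.
have {}hh' : h = h'.
  apply: functional_extensionality_dep => x; apply/funext => v; apply/funext => w.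
  exact: hh'.
by subst h'; congr Defs.Metric; exact: Prop_irrelevance.
Qed.

Variables (h h' : Defs.metric E).

(* The weights (1 - t)^2 and t^2 keep this form positive definite for every real
   t, so that no restriction to [0, 1] is needed. *)
Definition hpath_fun t x (v w : E x) : R := (1 - t) ^+ 2 * h x v w + t ^+ 2 * h' x v w.

Fact hpath_linearl t x (w : E x) : scalar (fun v => hpath_fun t v w).
Proof. by move=> c u v; rewrite /hpath_fun !hmet_linearl; ring. Qed.

Fact hpath_sym t x (v w : E x) : hpath_fun t v w = hpath_fun t w v.
Proof. by rewrite /hpath_fun hmet_sym [h' x v w]hmet_sym. Qed.

Fact hpath_pos t x (v : E x) : v != 0 -> 0 < hpath_fun t v v.
Proof.
move=> v0; have h0 := hmet_pos h v0; have h0' := hmet_pos h' v0.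
rewrite /hpath_fun; have [->|t0] := eqVneq t 0.
  by rewrite subr0 expr1n mul1r expr0n mul0r addr0.
apply: ltr_wpDl; first by rewrite mulr_ge0 ?sqr_ge0 // ltW.
by rewrite mulr_gt0 // exprn_even_gt0.
Qed.

Fact hpath_smooth t T (v w : 'rV[R]_r) : trivs T ->
  smooth_in (tdom T) (fun x => hpath_fun t (tinv T x v) (tinv T x w)).
Proof.
move=> tT; have oT := tdom_open T.
by apply: smooth_in_add => //; apply: smooth_in_mul => //;
  by [exact: smooth_in_cst | exact: hmet_smooth].
Qed.

Definition hpath t : Defs.metric E :=
  Defs.Metric (hpath_linearl t) (hpath_sym t) (hpath_pos t) (hpath_smooth t).

Lemma hpath0 : hpath 0 = h.
Proof.
by apply: metric_ext => x v w; rewrite /= /hpath_fun subr0 expr1n mul1r expr0n mul0r addr0.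
Qed.

Lemma hpath1 : hpath 1 = h'.
Proof.
by apply: metric_ext => x v w; rewrite /= /hpath_fun subrr expr1n mul1r expr0n mul0r add0r.
Qed.

Lemma gram_hpath t T x :
  gram (hpath t) T x = (1 - t) ^+ 2 *: gram h T x + t ^+ 2 *: gram h' T x.
Proof. by apply/matrixP => i j; rewrite !mxE. Qed.

Definition gram_deriv t T x : 'M[R]_r :=
  (- 2 * (1 - t)) *: gram h T x + (2 * t) *: gram h' T x.

(* h_t^-1 (d h_t / dt) *)
Definition psi t x : 'End(E x) := xget 0 [set phi : 'End(E x) | forall v w,
  hpath t x v (phi w) = - 2 * (1 - t) * h x v w + 2 * t * h' x v w].

Lemma tmx_psi t T x : tdom T x -> tmx T (psi t x) = invmx (gram (hpath t) T x) *m gram_deriv t T x.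
Proof.
move=> Tx; set P := invmx _ *m _.
have hE v w : - 2 * (1 - t) * h x v w + 2 * t * h' x v w =
    ((tcol T v)^T *m (gram_deriv t T x *m tcol T w)) 0 0.
  rewrite !(hmetE _ _ _ Tx) /gram_deriv mulmxDl -!scalemxAl mulmxDr -!scalemxAr !mulmxA.
  by rewrite [RHS]mxE [X in _ = X + _]mxE [X in _ = _ + X]mxE.
have psiP v w : hpath t x v (psi t x w) = - 2 * (1 - t) * h x v w + 2 * t * h' x v w.
  rewrite /psi; set Q := [set phi | _].
  have /(_ (ex_intro _ (endmx T x P) _))/(_ v w) := @xgetPex _ 0 Q; apply.
  move=> v1 w1; rewrite hE (hmetE _ _ _ Tx) endmxE // -!mulmxA; congr ((_ *m _) 0 0).
  by rewrite mulKVmx // gram_unit.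
apply: tmx_unique => // w; rewrite -mulmxA.
apply: (canRL (mulKmx (gram_unit (hpath t) Tx))); apply/colP => i.
have := psiP (tinv T x (delta_mx i 0 : 'cV[R]_r)^T) w.
rewrite hE (hmetE _ _ _ Tx) tcolK // trmx_delta -!mulmxA -!rowE => e.
by rewrite mxE in e; rewrite e mxE.
Qed.

Variables (rA : nat) (A : lie_algebroid M rA) (D : connection A E).
Implicit Types (a b : section A).

Definition theta_num t T a x : 'M[R]_r :=
  (1 - t) ^+ 2 *: (gram h T x *m tmx T (theta D h a x)) +
  t ^+ 2 *: (gram h' T x *m tmx T (theta D h' a x)).

Lemma dmx_gram_hpath t T x (v : tangent x) : trivs T -> tdom T x ->
  dmx v (gram (hpath t) T) =
  (1 - t) ^+ 2 *: dmx v (gram h T) + t ^+ 2 *: dmx v (gram h' T).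
Proof.
move=> tT Tx; apply/matrixP => i j; rewrite !mxE.
have -> : (fun y => gram (hpath t) T y i j) =
    (fun y => (1 - t) ^+ 2 * gram h T y i j + t ^+ 2 * gram h' T y i j).
  by apply/funext => y; rewrite gram_hpath !mxE.
have s1 := smx_gram h tT Tx i j; have s2 := smx_gram h' tT Tx i j.
rewrite tangent_appD; [|by apply: smooth_nearM => //; exact: smooth_near_cst..].
by rewrite !tangent_appZ.
Qed.

Lemma gram_theta_hpath t T a x : trivs T -> tdom T x ->
  gram (hpath t) T x *m tmx T (theta D (hpath t) a x) = theta_num t T a x.
Proof.
move=> tT Tx; have [Gam HG] := leibniz_coord (conn_leibniz D a) tT Tx.
have et := gram_theta (hpath t) tT Tx HG.
have e0 := gram_theta h tT Tx HG; have e1 := gram_theta h' tT Tx HG.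
rewrite (dmx_gram_hpath _ _ tT Tx) e0 e1 gram_hpath in et.
apply: (addrI (Gam^T *m gram (hpath t) T x + gram (hpath t) T x *m Gam)).
rewrite gram_hpath -et /theta_num.
rewrite !(mulmxDl, mulmxDr, scalerDr) -!(scalemxAl, scalemxAr).
by apply/matrixP => i j; rewrite !mxE; ring.
Qed.

Lemma tmx_theta_hpath t T a x : trivs T -> tdom T x ->
  tmx T (theta D (hpath t) a x) = invmx (gram (hpath t) T x) *m theta_num t T a x.
Proof.
by move=> tT Tx; rewrite -(gram_theta_hpath _ _ tT Tx) mulKmx // gram_unit.
Qed.

Section PathFunctions.
Variables (T : local_triv r E) (tT : trivs T).
Variables (U : set M) (P : (R -> M -> R) -> Prop) (HP : funalg U P).
Hypothesis UT : U `<=` tdom T.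
Hypothesis Ptime : forall p : {poly R}, P (fun t _ => p.[t]).
Hypothesis Psmooth : forall f, smooth_in (tdom T) f -> P (fun _ => f).

Let Pgram (g : Defs.metric E) : mxfun P (fun _ => gram g T).
Proof. by move=> i j; apply: Psmooth; exact: gram_smooth_in. Qed.

Let Ptheta (g : Defs.metric E) a : mxfun P (fun _ x => tmx T (theta D g a x)).
Proof. by move=> i j; apply: Psmooth; exact: theta_smooth_in. Qed.

Let P1t : P (fun t _ => (1 - t) ^+ 2).
Proof. by have := Ptime ((1 - 'X) ^+ 2); apply: (funalg_ext HP) => t x _; rewrite !hornerE. Qed.

Let Pt : P (fun t _ => t ^+ 2).
Proof. by have := Ptime ('X ^+ 2); apply: (funalg_ext HP) => t x _; rewrite !hornerE. Qed.

Let Pinv : mxfun P (fun t x => invmx (gram (hpath t) T x)).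
Proof.
apply: (mxfun_inv HP); first by move=> t x /UT; exact: gram_unit.
apply: (@mxfun_ext _ _ _ _ _ HP _ _
  (fun t x => (1 - t) ^+ 2 *: gram h T x + t ^+ 2 *: gram h' T x)).
  by move=> t x _; rewrite gram_hpath.
by apply: (mxfun_add HP); apply: (mxfun_scale HP).
Qed.

Lemma mxfun_psi : mxfun P (fun t x => tmx T (psi t x)).
Proof.
apply: (@mxfun_ext _ _ _ _ _ HP _ _ (fun t x => invmx (gram (hpath t) T x) *m gram_deriv t T x)).
  by move=> t x /UT Tx; rewrite tmx_psi.
apply: (mxfun_mul HP) => //; apply: (mxfun_add HP); apply: (mxfun_scale HP) => //.
  by have := Ptime (-2%:P * (1 - 'X)); apply: (funalg_ext HP) => t x _; rewrite !hornerE.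
by have := Ptime (2%:P * 'X); apply: (funalg_ext HP) => t x _; rewrite !hornerE.
Qed.

Lemma mxfun_theta a : mxfun P (fun t x => tmx T (theta D (hpath t) a x)).
Proof.
apply: (@mxfun_ext _ _ _ _ _ HP _ _ (fun t x => invmx (gram (hpath t) T x) *m theta_num t T a x)).
  by move=> t x /UT Tx; rewrite tmx_theta_hpath.
by apply: (mxfun_mul HP) => //; apply: (mxfun_add HP); apply: (mxfun_scale HP) => //;
  apply: (mxfun_mul HP).
Qed.

End PathFunctions.

End MetricPath.

Section Homotopy.
Context {R : realType} {n : nat} {M : manifold R n} {rA r : nat}.
Context {A : lie_algebroid M rA} {E : vbundle M r}.
Variables (D : connection A E) (h h' : Defs.metric E).
Implicit Types (T : local_triv r E) (x : M) (a b : section A) (s : section E) (t : R).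

Local Notation ht := (hpath h h').

(* The pair (c, a) stands for c d/dt + a, a section of TR x A. *)
Definition path_theta t x (u : R^o * section A) : 'End(E x) :=
  u.1 *: psi h h' t x + theta D (ht t) u.2 x.

Definition dt_cons m (a : 'I_m -> section A) : 'I_m.+1 -> R^o * section A :=
  fun i => if unlift ord0 i is Some j then (0, a j) else (1, 0).

Definition xi_path t m : Defs.form A m :=
  fun (a : 'I_m -> section A) x => trace_form (path_theta t x) (dt_cons a).

Lemma dt_cons0 m (a : 'I_m -> section A) : dt_cons a ord0 = (1, 0).
Proof. by rewrite /dt_cons unlift_none. Qed.

Lemma dt_consS m (a : 'I_m -> section A) i : dt_cons a (lift ord0 i) = (0, a i).
Proof. by rewrite /dt_cons liftK. Qed.

Lemma path_theta_linear t x : linear (path_theta t x).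
Proof.
move=> c u v; rewrite /path_theta /= (theta_linear D (ht t) x) scalerDl scalerDr -scalerA.
by rewrite addrACA.
Qed.

Lemma tmx_path_theta t T x u :
  tmx T (path_theta t x u) = u.1 *: tmx T (psi h h' t x) + tmx T (theta D (ht t) u.2 x).
Proof.
by apply/matrixP => i j; rewrite !mxE add_lfunE scale_lfunE linearD linearZ !mxE.
Qed.

Lemma funalg_horner_jsmooth (U : set M) (p : {poly R}) : jsmooth_in U (fun t _ => p.[t]).
Proof. exact: (@jsmooth_in_time _ _ _ U (horner p) (@continuous_horner _ p)). Qed.

Lemma mxfun_path_theta T (U : set M) (P : (R -> M -> R) -> Prop) u : trivs T ->
  funalg U P -> U `<=` tdom T -> (forall p : {poly R}, P (fun t _ => p.[t])) ->
  (forall f, smooth_in (tdom T) f -> P (fun _ => f)) ->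
  mxfun P (fun t x => tmx T (path_theta t x u)).
Proof.
move=> tT HP UT Pt Ps.
apply: (@mxfun_ext _ _ _ _ _ HP _ _
  (fun t x => u.1 *: tmx T (psi h h' t x) + tmx T (theta D (ht t) u.2 x))).
  by move=> t x _; rewrite tmx_path_theta.
apply: (mxfun_add HP); last exact: (mxfun_theta _ _ _ tT HP UT).
by apply: (mxfun_scale HP); [exact: (funalg_cst HP) | exact: (mxfun_psi _ _ tT HP UT)].
Qed.

Lemma jsmooth_path_theta T u : trivs T ->
  mxfun (jsmooth_in (tdom T)) (fun t x => tmx T (path_theta t x u)).
Proof.
move=> tT; apply: (mxfun_path_theta _ tT (funalg_jsmooth (tdom_open T))) => //.
- by move=> p; exact: funalg_horner_jsmooth.
- by move=> f; exact: jsmooth_in_of.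
Qed.

Lemma smx_path_theta t T x u : trivs T -> tdom T x ->
  smx x (fun y => tmx T (path_theta t y u)).
Proof.
move=> tT Tx i j; exists (tdom T); first by split=> //; exact: tdom_open.
exact: (smooth_in_of t (jsmooth_path_theta u tT i j)).
Qed.

Lemma theta0 t x : theta D (ht t) 0 x = 0.
Proof.
exact: (linear_map0 (theta_linear D (ht t) x)).
Qed.

Lemma smx_psi t T x : trivs T -> tdom T x -> smx x (fun y => tmx T (psi h h' t y)).
Proof.
move=> tT Tx i j; have := @smx_path_theta t T x (1, 0) tT Tx i j.
congr (smooth_near x _); apply/funext => y.
by rewrite tmx_path_theta scale1r theta0 !mxE lfunE /= linear0 mxE addr0.
Qed.

Lemma time_derivable_path_theta t T x u : trivs T -> tdom T x ->
  msmooth (fun f : R -> R => derivable f t 1) (fun t => tmx T (path_theta t x u)).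
Proof.
move=> tT Tx i j; move: t.
apply: (mxfun_path_theta _ tT (funalg_derivable x)) => //.
by move=> y ->.
Qed.

Lemma jsmooth_trace_form m (u : 'I_m -> R^o * section A) :
  jsmooth_in setT (fun t x => trace_form (path_theta t x) u).
Proof.
apply: jsmooth_in_local => x _; have [T tT Tx] := @trivs_cover _ _ _ _ E x.
exists (tdom T) => //; have HP := funalg_jsmooth (tdom_open T).
apply: (funalg_ext HP (fun t y Ty => esym (trace_formE (path_theta t y) u Ty))).
apply: (funalg_sum HP) => s _; apply: (funalg_mul HP); first exact: (funalg_cst HP).
apply: (funalg_tr HP); apply: (mxfun_prod HP) => i.
exact: jsmooth_path_theta.
Qed.

Definition xi_form m : Defs.form A m :=
  fun (a : 'I_m -> section A) x => int01 (fun t => xi_path t a x).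

Lemma xi_path_continuous m (a : 'I_m -> section A) x : continuous (fun t => xi_path t a x).
Proof. exact: (jsmooth_in_continuous (jsmooth_trace_form (dt_cons a)) I). Qed.

Lemma alt_xi_form m : alt_form (xi_form (m := m)).
Proof.
split.
- by move=> a; apply: smooth_in_int01; exact: jsmooth_trace_form.
- move=> a i c u v x; rewrite /xi_form -int01Z; last exact: xi_path_continuous.
  rewrite -int01D; last exact: xi_path_continuous; last first.
    by move=> t; apply: cvgM; [exact: cvg_cst | exact: xi_path_continuous].
  apply: eq_int01 => t; rewrite /xi_path.
  have e w : dt_cons [eta a with i |-> w] =1 [eta dt_cons a with lift ord0 i |-> (0, w)].
    move=> k; rewrite /dt_cons /=; case: unliftP => [k' ->|->].
      by rewrite (inj_eq (@lift_inj _ ord0)); case: eqP.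
    by rewrite (negbTE (neq_lift ord0 i)).
  have {}e w : dt_cons [eta a with i |-> w] = [eta dt_cons a with lift ord0 i |-> (0, w)].
    exact/funext/e.
  have ec : (0, c *: u + v) = c *: ((0, u) : R^o * section A) + (0, v).
    by apply: injective_projections => //=; rewrite scaler0 addr0.
  by rewrite !e ec trace_form_linear //; exact: path_theta_linear.
- move=> a tau x; rewrite /xi_form -int01Z; last exact: xi_path_continuous.
  apply: eq_int01 => t; rewrite /xi_path.
  have -> : dt_cons (a \o tau) = dt_cons a \o lift_perm ord0 ord0 tau.
    apply/funext => k; rewrite /=; case: (unliftP ord0 k) => [k' ->|->].
      by rewrite lift_perm_lift !dt_consS.
    by rewrite lift_perm_id !dt_cons0.
  by rewrite trace_form_perm odd_lift_perm addbb.
Qed.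

Hypothesis flatD : flat D.

Section Pointwise.
Variables (T : local_triv r E) (x : M) (tT : trivs T) (Tx : tdom T x) (t : R).
Variable Gam : section A -> 'M[R]_r.
Hypothesis HGam : forall a s,
  tcol T (D a s x) = dmx (anchor (a x)) (fun y => tcol T (s y)) + Gam a *m tcol T (s x).

Local Notation dT := (mder (fun f : R -> R => 'D_1 f t)).

Definition theta_dot a : 'M[R]_r := dT (fun t => tmx T (theta D (ht t) a x)).

Definition dpsi a : 'M[R]_r := dmx (anchor (a x)) (fun y => tmx T (psi h h' t y)) +
  (Gam a *m tmx T (psi h h' t x) - tmx T (psi h h' t x) *m Gam a).

Let dT_weights p q (B C : 'M[R]_(p, q)) :
  dT (fun u => (1 - u) ^+ 2 *: B + u ^+ 2 *: C) = (- 2 * (1 - t)) *: B + (2 * t) *: C.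
Proof.
apply/matrixP => i j; rewrite !mxE.
have -> : (fun u => ((1 - u) ^+ 2 *: B + u ^+ 2 *: C) i j) =
    horner ((1 - 'X) * (1 - 'X) * (B i j)%:P + 'X * 'X * (C i j)%:P).
  by apply/funext => u; rewrite !mxE !hornerE.
rewrite derive_val derivD !derivM !derivC derivB derivX derivC !hornerE /=; ring.
Qed.

Lemma theta_dotE a : theta_dot a = dpsi a +
  (tmx T (theta D (ht t) a x) *m tmx T (psi h h' t x) -
   tmx T (psi h h' t x) *m tmx T (theta D (ht t) a x)).
Proof.
have Hd := derivation_tangent (anchor (a x)); have Ht := derivation_time t.
set Th := tmx T (theta D (ht t) a x); set P := tmx T (psi h h' t x).
set G := gram (ht t) T x; set G' := gram_deriv h h' t T x.
have uG : G \in unitmx by exact: gram_unit.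
have G'E y : tdom T y -> gram (ht t) T y *m tmx T (psi h h' t y) = gram_deriv h h' t T y.
  by move=> Ty; rewrite tmx_psi // mulKVmx // gram_unit.
have et := gram_theta (ht t) tT Tx (HGam a); rewrite -/G -/Th in et.
have e0 := gram_theta h tT Tx (HGam a); have e1 := gram_theta h' tT Tx (HGam a).
pose B' := (- 2 * (1 - t)) *: (gram h T x *m tmx T (theta D h a x)) +
  (2 * t) *: (gram h' T x *m tmx T (theta D h' a x)).
have eT : G' *m Th + G *m theta_dot a = B'.
  rewrite /B' -(dT_weights (gram h T x *m tmx T (theta D h a x))).
  have -> : (fun u => (1 - u) ^+ 2 *: (gram h T x *m tmx T (theta D h a x)) +
      u ^+ 2 *: (gram h' T x *m tmx T (theta D h' a x))) =
      (fun u => gram (ht u) T x *m tmx T (theta D (ht u) a x)).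
    by apply/funext => u; rewrite (gram_theta_hpath _ _ _ _ _ tT Tx).
  have dG : dT (fun u => gram (ht u) T x) = G'.
    rewrite -[RHS]dT_weights; congr (mder _ _); apply/funext => u.
    by rewrite gram_hpath.
  rewrite (mder_mul Ht) ?dG //.
    have -> : (fun u => gram (ht u) T x) =
        (fun u => (1 - u) ^+ 2 *: gram h T x + u ^+ 2 *: gram h' T x).
      by apply/funext => u; rewrite gram_hpath.
    move=> i j; have -> : (fun u => ((1 - u) ^+ 2 *: gram h T x + u ^+ 2 *: gram h' T x) i j) =
        horner ((1 - 'X) ^+ 2 * (gram h T x i j)%:P + 'X^2 * (gram h' T x i j)%:P).
      by apply/funext => u; rewrite !mxE !hornerE.
    exact: derivable_horner.
  move=> i j; have := @time_derivable_path_theta t T x (0, a) tT Tx i j.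
  by congr (derivable _ t 1); apply/funext => u; rewrite tmx_path_theta scale0r add0r.
have eX : dmx (anchor (a x)) (gram_deriv h h' t T) = (Gam a)^T *m G' + G' *m Gam a + B'.
  have sm0 := smx_gram h tT Tx; have sm1 := smx_gram h' tT Tx.
  rewrite (mderD Hd); [|exact: (msmoothZ Hd)..].
  rewrite !(mderZ Hd) // e0 e1 /G' /gram_deriv /B'.
  rewrite !(mulmxDl, mulmxDr, scalerDr) -!(scalemxAl, scalemxAr).
  by apply/matrixP => i j; rewrite !mxE; ring.
have := dmx_near (anchor (a x)) (tdom_open T) Tx G'E.
have spsi := smx_psi t tT Tx.
rewrite (mder_mul Hd) //; last exact: smx_gram.
rewrite eX -eT et -/G -/P /G' -(G'E x Tx) -/G -/P => e.
apply: (can_inj (mulKmx uG)); rewrite /dpsi -/P.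
set dP := dmx _ (fun y => tmx T (psi h h' t y)) in e *.
rewrite !(mulmxDl, mulmxDr, mulmxN, mulmxA) in e *.
move: ((Gam a)^T *m G *m P) (G *m Gam a *m P) (G *m Th *m P) (G *m dP) (G *m P *m Gam a)
  (G *m P *m Th) (G *m theta_dot a) e => v1 v2 v3 v4 v5 v6 v7 e.
by apply/matrixP => i j; have := congr1 (fun B : 'M[R]_r => B i j) e; rewrite !mxE => e'; lra.
Qed.

Definition dpath_theta (u v : R^o * section A) : 'M[R]_r :=
  u.1 *: theta_dot v.2 + v.1 *: dpsi u.2 + dtheta D (ht t) T x Gam u.2 v.2.

Lemma path_theta_maurer_cartan (u v : R^o * section A) :
  dpath_theta u v - dpath_theta v u - tmx T (path_theta t x (product_bracket u v)) =
  - (tmx T (path_theta t x u) *m tmx T (path_theta t x v) -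
     tmx T (path_theta t x v) *m tmx T (path_theta t x u)).
Proof.
have e := theta_maurer_cartan (ht t) flatD tT Tx HGam u.2 v.2.
rewrite !tmx_path_theta /product_bracket /= scale0r add0r /dpath_theta !theta_dotE.
rewrite !(mulmxDl, mulmxDr) -!(scalemxAl, scalemxAr).
set P := tmx T (psi h h' t x) in e *; set Tu := tmx T (theta D (ht t) u.2 x) in e *.
set Tv := tmx T (theta D (ht t) v.2 x) in e *.
move: (dtheta _ _ _ _ _ u.2 v.2) (dtheta _ _ _ _ _ v.2 u.2)
  (tmx T (theta D (ht t) (bracket u.2 v.2) x)) (dpsi u.2) (dpsi v.2)
  (P *m P) (P *m Tu) (Tu *m P) (P *m Tv) (Tv *m P) (Tu *m Tv) (Tv *m Tu) e
  => d1 d2 d3 d4 d5 m1 m2 m3 m4 m5 m6 m7 e.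
apply/matrixP => i j; have := congr1 (fun B : 'M[R]_r => B i j) e; rewrite !mxE => e'.
by lra.
Qed.

Lemma dpath_theta_space a v : dpath_theta (0, a) v =
  dmx (anchor (a x)) (fun y => tmx T (path_theta t y v)) +
  (Gam a *m tmx T (path_theta t x v) - tmx T (path_theta t x v) *m Gam a).
Proof.
have Hd := derivation_tangent (anchor (a x)).
have -> : (fun y => tmx T (path_theta t y v)) =
    (fun y => v.1 *: tmx T (psi h h' t y) + tmx T (theta D (ht t) v.2 y)).
  by apply/funext => y; rewrite tmx_path_theta.
have sp := smx_psi t tT Tx.
rewrite (mderD Hd); [|exact: (msmoothZ Hd)|exact: smx_theta].
rewrite (mderZ Hd) // tmx_path_theta /dpath_theta /= scale0r add0r /dpsi /dtheta.
rewrite !(mulmxDl, mulmxDr) -!(scalemxAl, scalemxAr).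
move: (dmx _ _) (dmx _ _) (Gam a *m _) (Gam a *m _) (_ *m Gam a) (_ *m Gam a)
  => v1 v2 v3 v4 v5 v6.
by apply/matrixP => i j; rewrite !mxE; lra.
Qed.

Lemma dpath_theta_time a : dpath_theta (1, 0) (0, a) = theta_dot a.
Proof.
rewrite /dpath_theta /= scale1r scale0r addr0.
suff -> : dtheta D (ht t) T x Gam 0 a = 0 by rewrite addr0.
apply: mulmx_col_inj => c; have [s sE] := section_through (tinv T x c^T).
have {sE} -> : c = tcol T (s x) by rewrite sE tcolK.
have D0 s' : D 0 s' = 0.
  exact: (linear_map0 (nabla_linear D s')).
rewrite -(dthetaP _ tT Tx HGam) !D0 mul0mx -[(0 : section E) x]/(0 : E x) linear0.
by rewrite mulmx0 subr0.
Qed.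

End Pointwise.

Lemma product_bracketC (u v : R^o * section A) :
  product_bracket v u = - product_bracket u v.
Proof. by apply: injective_projections => /=; [rewrite oppr0 | exact: bracketC]. Qed.

Lemma dt_cons_lift m (a : 'I_m.+1 -> section A) i k :
  dt_cons a (lift (lift ord0 i) k) = dt_cons (fun l => a (lift i l)) k.
Proof.
case: (unliftP ord0 k) => [k' ->|->].
  rewrite dt_consS -dt_consS; congr (dt_cons a _); apply: val_inj.
  by rewrite /= /bump; lia.
rewrite dt_cons0 -(dt_cons0 a); congr (dt_cons a _); apply: val_inj.
by rewrite /= /bump; lia.
Qed.

Lemma trace_form_swap (V : vectType R) (phi : R^o * section A -> 'End(V)) q
    (a : 'I_q.+1 -> section A) (i j : 'I_q.+1) w : (i < j)%N ->
  trace_form phi (fun l : 'I_q.+1 => nth 0 ((0, w) ::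
    [seq dt_cons a m | m <- enum 'I_q.+2 & (m != lift ord0 i) && (m != lift ord0 j)]) l) =
  - trace_form phi (dt_cons (fun l : 'I_q => nth 0 (w ::
    [seq a m | m <- enum 'I_q.+1 & (m != i) && (m != j)]) l)).
Proof.
case: q a i j => [|q] a i j; first by rewrite !ord1.
move=> _.
set d := (fun l : 'I_q.+1 => _); set o1 := lift ord0 ord0 : 'I_q.+2.
rewrite -[RHS]mulN1r; have <- : (-1) ^+ tperm ord0 o1 = -1 :> R by rewrite odd_tperm.
rewrite -trace_form_perm; congr trace_form; apply/funext => l.
have -> : [seq m <- enum 'I_q.+3 | (m != lift ord0 i) && (m != lift ord0 j)] =
    ord0 :: [seq lift ord0 m | m <- enum 'I_q.+2 & (m != i) && (m != j)].
  rewrite enum_ordSl /= filter_map; by congr (_ :: map _ _); apply: eq_filter => m /=.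
rewrite map_cons dt_cons0 -map_comp.
rewrite (eq_map (g := pair 0 \o a)); last by move=> m; exact: dt_consS.
rewrite map_comp /=; case: (unliftP ord0 l) => [l' ->|->]; last first.
  by rewrite tpermL /o1 dt_consS.
case: (unliftP ord0 l') => [l2 ->|->]; last by rewrite tpermR dt_cons0.
rewrite tpermD ?dt_consS //; rewrite /d !lift0 /=.
have [lt|le] := ltnP l2 (size [seq a m | m <- enum 'I_q.+2 & (m != i) && (m != j)]).
  by rewrite (nth_map 0).
by rewrite !nth_default ?size_map //; move: le; rewrite size_map.
Qed.

Lemma eta_hpath_derive q (a : 'I_q.+1 -> section A) x t : ~~ odd q ->
  is_derive t (1 : R) (fun t => eta_form D (ht t) a x) (dform (xi_path t (m := q)) a x).
Proof.
move=> oq; have [T tT Tx] := @trivs_cover _ _ _ _ E x.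
have /choice[Gam HGam] : forall a : section A, exists G : 'M[R]_r, forall s : section E,
    tcol T (D a s x) = dmx (anchor (a x)) (fun y => tcol T (s y)) + G *m tcol T (s x).
  by move=> b; exact: (leibniz_coord (conn_leibniz D b) tT Tx).
have Ht := derivation_time t.
pose th u := tmx T (path_theta t x u); pose c := dt_cons a.
pose dth := dpath_theta T x t Gam.
pose br (u v : R^o * section A) : R^o * section A := product_bracket u v.
pose F i := altsum (fun s : 'S_q.+1 => \sum_k \tr (\prod_l
  (if l == k then dth (c i) (c (lift i (s l))) else th (c (lift i (s l)))))).
pose K i j := altsum (fun s : 'S_q.+1 => \tr (\prod_l
  th (nth 0 (br (c i) (c j) :: [seq c m | m <- enum 'I_q.+2 & (m != i) && (m != j)]) (s l)))).
have th0 : th 0 = 0.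
  by rewrite /th (linear_map0 (path_theta_linear t x)) (linear_map0 (@tmx_linear _ _ _ _ E T x)).
have H : \sum_(i < q.+2) (-1) ^+ i * F i +
    \sum_(i < q.+2) \sum_(j < q.+2 | (i < j)%N) (-1) ^+ (i + j) * K i j = 0.
  apply: (@altsum_maurer_cartan _ _ mxtrace (@mxtrace_mulC _ _ _) q oq _ br th dth).
    move=> u v; rewrite /th /br product_bracketC (linear_mapN _ (path_theta_linear t x)).
    exact: linear_mapN (@tmx_linear _ _ _ _ E T x).
  by move=> u v; exact: path_theta_maurer_cartan.
have b0 b : bracket (0 : section A) b = 0.
  exact: (linear_map0 (bracket_linearl b)).
have K0 j : K ord0 (lift ord0 j) = 0.
  rewrite /K /altsum big1 // => s _.
  rewrite (@prod_eq0 _ _ _ (s^-1 ord0)%g) ?mem_index_enum ?mxtrace0 ?mulr0 //.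
  by rewrite permKV /= /c dt_cons0 dt_consS /br /product_bracket /= b0.
have KS (i j : 'I_q.+1) : (i < j)%N -> K (lift ord0 i) (lift ord0 j) =
    - xi_path t (fun l : 'I_q => nth 0 (bracket (a i) (a j) ::
        [seq a m | m <- enum 'I_q.+1 & (m != i) && (m != j)]) l) x.
  move=> ij; rewrite /xi_path -trace_form_swap // (trace_formE _ _ Tx).
  by rewrite /K /c !dt_consS.
have FS (i : 'I_q.+1) : F (lift ord0 i) =
    tangent_app (anchor (a i x)) (xi_path t (fun l => a (lift i l))).
  have Hd := derivation_tangent (anchor (a i x)).
  rewrite (tangent_app_near _ (tdom_open T) Tx (fun y Ty => trace_formE (path_theta t y) _ Ty)).
  have sB (s : 'S_q.+1) k := smx_path_theta t (dt_cons (fun l => a (lift i l)) (s k)) tT Tx.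
  have sP (s : 'S_q.+1) : smooth_near x (fun y =>
      \tr (\prod_k tmx T (path_theta t y (dt_cons (fun l => a (lift i l)) (s k))))).
    exact/(der_smooth_trace Hd)/(msmooth_prod Hd).
  rewrite (der_sum Hd) => [|s]; last by apply: smooth_nearM => //; exact: smooth_near_cst.
  apply: eq_bigr => s _; rewrite (derZ Hd) // (der_trace_prod Hd (Gam (a i))) //.
  congr (_ * _); apply: eq_bigr => k _; congr (\tr _); apply: eq_bigr => l _.
  by rewrite /c dt_cons_lift dt_consS /dth dpath_theta_space.
have etaE : (fun t => eta_form D (ht t) a x) = (fun t => \sum_(s : 'S_q.+1)
    (-1) ^+ s * \tr (\prod_k tmx T (theta D (ht t) (a (s k)) x))).
  by apply/funext => u; exact: eta_formE.
have sT b : msmooth (fun f : R -> R => derivable f t 1) (fun t => tmx T (theta D (ht t) b x)).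
  move=> i j; have := @time_derivable_path_theta t T x (0, b) tT Tx i j.
  by congr (derivable _ t 1); apply/funext => u; rewrite tmx_path_theta scale0r add0r.
have sTP (s : 'S_q.+1) :
    derivable (fun t => \tr (\prod_k tmx T (theta D (ht t) (a (s k)) x))) t 1.
  exact/(der_smooth_trace Ht)/(msmooth_prod Ht).
have sTM (s : 'S_q.+1) : derivable
    (fun t => (-1) ^+ s * \tr (\prod_k tmx T (theta D (ht t) (a (s k)) x))) t 1.
  by apply: (der_smoothM Ht) => //; exact: (der_smooth_cst Ht).
have de : derivable (fun t => eta_form D (ht t) a x) t 1.
  by rewrite etaE; exact: (der_smooth_sum Ht).
have F0 : F ord0 = 'D_1 (fun t => eta_form D (ht t) a x) t.
  rewrite etaE (der_sum Ht) //; apply: eq_bigr => s _.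
  rewrite (derZ Ht) // (der_trace_prod Ht 0) //; congr (_ * _).
  apply: eq_bigr => k _; congr (\tr _); apply: eq_bigr => l _.
  rewrite mul0mx mulmx0 subr0 addr0 /c dt_cons0 dt_consS /dth dpath_theta_time //.
  by rewrite /th tmx_path_theta scale0r add0r.
apply: DeriveDef => //; rewrite -F0; apply/eqP; rewrite -subr_eq0; apply/eqP.
rewrite -[RHS]H big_ord_recl expr0 mul1r -addrA; congr (_ + _).
rewrite /dform opprD; congr (_ + _).
  rewrite -sumrN; apply: eq_bigr => i _.
  by rewrite FS lift0 exprS mulN1r mulNr.
rewrite [RHS]big_ord_recl [X in _ = X + _]big1 ?add0r; last first.
  by move=> j; case: (unliftP ord0 j) => [j' ->|->] // _; rewrite K0 mulr0.
rewrite -sumrN; apply: eq_bigr => i _.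
rewrite [RHS]big_mkcond big_ord_recl /= add0r -big_mkcond -sumrN; apply: eq_big => // j ij.
by rewrite KS // mulrN /bump !add1n addSn addnS !exprS !mulN1r opprK.
Qed.

Lemma dform_xi m (a : 'I_m.+1 -> section A) x :
  continuous (fun t => dform (xi_path t (m := m)) a x) /\
  dform (xi_form (m := m)) a x = int01 (fun t => dform (xi_path t (m := m)) a x).
Proof.
have cS (I : Type) (l : seq I) (P : pred I) (f : I -> R -> R) :
    (forall i, continuous (f i)) -> continuous (fun t => \sum_(i <- l | P i) f i t).
  by move=> cf t; apply: cvg_big => [|i _]; [exact: add_continuous | exact: cf].
have cZ (k : R) (f : R -> R) : continuous f -> continuous (fun t => k * f t).
  by move=> cf t; apply: cvgM; [exact: cvg_cst | exact: cf].
pose f1 (i : 'I_m.+1) t := tangent_app (anchor (a i x)) (xi_path t (fun l => a (lift i l))).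
pose f2 (i j : 'I_m.+1) t := xi_path t (fun l : 'I_m => nth 0 (bracket (a i) (a j) ::
  [seq a k | k <- enum 'I_m.+1 & (k != i) && (k != j)]) l) x.
have c1 i : continuous (f1 i).
  by apply: tangent_app_continuous; exact: jsmooth_trace_form.
have c2 i j : continuous (f2 i j) by exact: xi_path_continuous.
have cs1 : continuous (fun t => \sum_(i < m.+1) (-1) ^+ i * f1 i t) by apply: cS => i; exact: cZ.
have cr2 (i : 'I_m.+1) : continuous (fun t =>
    \sum_(j < m.+1 | (i < j)%N) (-1) ^+ (i + j) * f2 i j t).
  by apply: cS => j; exact: cZ.
have cs2 : continuous (fun t =>
    \sum_(i < m.+1) \sum_(j < m.+1 | (i < j)%N) (-1) ^+ (i + j) * f2 i j t).
  by apply: cS => i; exact: cr2.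
split; first by move=> t; exact: (cvgD (cs1 t) (cs2 t)).
rewrite (int01D cs1 cs2) !int01_sum //; last by move=> i; exact: cZ.
rewrite /dform; congr (_ + _).
  apply: eq_bigr => i _; rewrite int01Z //; congr (_ * _).
  by apply: tangent_app_int01; exact: jsmooth_trace_form.
apply: eq_bigr => i _; rewrite int01_sum; last by move=> j; exact: cZ.
by apply: eq_bigr => j _; rewrite int01Z.
Qed.

Lemma eta_form_homotopy q (a : 'I_q.+1 -> section A) x : ~~ odd q ->
  eta_form D h' a x - eta_form D h a x = dform (xi_form (m := q)) a x.
Proof.
move=> oq; have [cd ->] := dform_xi a x.
have Hd t := eta_hpath_derive a x t oq.
by rewrite (int01_derive cd Hd) hpath0 hpath1.
Qed.

End Homotopy.

Section FormAlgebra.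
Context {R : realType} {n : nat} {M : manifold R n} {rA : nat}.
Context {A : lie_algebroid M rA}.

Lemma alt_form_smooth_near k (eta : Defs.form A k) a x : alt_form eta -> smooth_near x (eta a).
Proof. by case=> se _ _; exists setT; [split=> //; exact: openT | exact: se]. Qed.

Lemma alt_form_linear k (c : R) (eta xi : Defs.form A k) : alt_form eta -> alt_form xi ->
  alt_form (fun a x => c * eta a x + xi a x).
Proof.
move=> [s1 l1 p1] [s2 l2 p2]; split.
- move=> a; apply: smooth_in_add; [exact: openT| |exact: s2].
  by apply: smooth_in_mul; [exact: openT|exact: smooth_in_cst|exact: s1].
- by move=> a i d u v x; rewrite l1 l2; ring.
- by move=> a tau x; rewrite p1 p2 mulrDr mulrCA.
Qed.

Lemma dform_linear k (c : R) (eta xi : Defs.form A k) a x : alt_form eta -> alt_form xi ->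
  dform (fun a x => c * eta a x + xi a x) a x = c * dform eta a x + dform xi a x.
Proof.
move=> ae ax; rewrite /dform mulrDr addrACA; congr (_ + _).
  rewrite mulr_sumr -big_split; apply: eq_bigr => i _ /=; rewrite /vfield_app tangent_appD.
  - by rewrite tangent_appZ; [ring | exact: alt_form_smooth_near].
  - by apply: smooth_nearM; [exact: smooth_near_cst | exact: alt_form_smooth_near].
  - exact: alt_form_smooth_near.
rewrite mulr_sumr -big_split; apply: eq_bigr => i _ /=.
rewrite mulr_sumr -big_split; apply: eq_bigr => j _ /=.
by ring.
Qed.

Lemma alt_form0 k : alt_form (fun (_ : 'I_k -> section A) (_ : M) => 0 : R).
Proof.
split=> [a|a i c u v x|a tau x]; [exact: smooth_in_cst | by rewrite mulr0 addr0 | by rewrite mulr0].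
Qed.

Lemma dform0 k a x : dform (fun (_ : 'I_k -> section A) (_ : M) => 0 : R) a x = 0.
Proof.
rewrite /dform !big1 ?addr0 // => i _.
  by rewrite big1 // => j _; rewrite mulr0.
by rewrite /vfield_app tangent_app_cst mulr0.
Qed.

Lemma alt_formZ k (c : R) (eta : Defs.form A k) : alt_form eta -> alt_form (fun a x => c * eta a x).
Proof.
move=> ae; have := alt_form_linear c ae (alt_form0 k).
by congr alt_form; apply/funext => a; apply/funext => x; rewrite addr0.
Qed.

Lemma dformZ k (c : R) (eta : Defs.form A k) a x : alt_form eta ->
  dform (fun a x => c * eta a x) a x = c * dform eta a x.
Proof.
move=> ae; rewrite -[RHS]addr0 -(dform0 a x) -(dform_linear _ _ _ ae (alt_form0 k)).
by congr (dform _ a x); apply/funext => b; apply/funext => y; rewrite addr0.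
Qed.

Lemma cohomology_class_sub k (eta eta' : Defs.form A k.+1) (xi : Defs.form A k) :
  alt_form xi -> (forall a x, eta a x - eta' a x = dform xi a x) ->
  cohomology_class eta `<=` cohomology_class eta'.
Proof.
move=> axi e omega [co [zeta [azeta ze]]]; split=> //.
exists (fun a x => 1 * xi a x + zeta a x); split; first exact: alt_form_linear.
by move=> a x; rewrite dform_linear // -e -ze; ring.
Qed.

End FormAlgebra.

Theorem theorem2 (R : realType) (n : nat) (M : manifold R n) (rA rE : nat)
    (A : lie_algebroid M rA) (E : vbundle M rE) (D : connection A E) (p : nat)
    (hp : (0 < p)%N) (flatD : flat D) :
  (forall h : metric E,
     closed_form (chern_simons p D (adjoint_conn D h))) /\
  (forall h h' : metric E,
     cohomology_class (chern_simons p D (adjoint_conn D h)) =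
     cohomology_class (chern_simons p D (adjoint_conn D h'))).
Proof.
case: p hp => [//|q _].
have [C HC] := chern_simons_eta q flatD.
have csE h : chern_simons q.+1 D (adjoint_conn D h) =
    (fun (a : 'I_q.*2.+1 -> section A) x => C * eta_form D h a x).
  by apply/funext => a; apply/funext => x; exact: HC.
have oq : ~~ odd q.*2 by rewrite odd_double.
split=> [h|h h'].
  rewrite csE; split; first exact/alt_formZ/alt_eta_form.
  move=> a x; rewrite dformZ; last exact: alt_eta_form.
  by rewrite dform_eta ?mulr0.
suff sub g g' : cohomology_class (chern_simons q.+1 D (adjoint_conn D g)) `<=`
    cohomology_class (chern_simons q.+1 D (adjoint_conn D g')).
  by apply/seteqP; split.
rewrite !csE.
apply: (@cohomology_class_sub _ _ _ _ _ q.*2 _ _ (fun a x => C * xi_form D g' g a x)).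
  exact/alt_formZ/alt_xi_form.
move=> a x; rewrite dformZ; last exact: alt_xi_form.
by rewrite -eta_form_homotopy // mulrBr.
Qed.
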